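(* Let $(\boldsymbol\gamma,\mathbf{A},\rho)$ be a multiplicative Lévy triplet on $\mathbb{T}^d$. Given an infinitesimal triangular array $\{\nu_{nk}\}_{n\geq1,1\leq k\leq k_n}\subset\mathscr{P}_{\mathbb{T}^d}$ and a sequence $\{\boldsymbol\xi_n\}\subset\mathbb{T}^d$, let $\rho_n=\sum_{k=1}^{k_n}\mathring\nu_{nk}$ and $$\boldsymbol\gamma_n=\boldsymbol\xi_n\exp\Big[i\sum_{k=1}^{k_n}\Big(\arg\boldsymbol b_{nk}+\int_{\mathbb{T}^d}(\Im\boldsymbol s)\,d\mathring\nu_{nk}(\boldsymbol s)\Big)\Big].$$ Then the sequence $\delta_{\boldsymbol\xi_n}\circledast\nu_{n1}\circledast\cdots\circledast\nu_{nk_n}$ converges weakly to $\nu_{\circledast}^{(\boldsymbol\gamma,\mathbf{A},\rho)}$ if and only if: (1) $\lim_{n\to\infty}\boldsymbol\gamma_n=\boldsymbol\gamma$; (2) for all $j,\ell$, the limit $\lim_{\epsilon\to0}\limsup_{n\to\infty}\int_{\mathscr{U}_\epsilon}(\Im s_j)(\Im s_\ell)\,d\rho_n=\lim_{\epsilon\to0}\liminf_{n\to\infty}\int_{\mathscr{U}_\epsilon}(\Im s_j)(\Im s_\ell)\,d\rho_n$ exists and equals the $(j,\ell)$-entry of $\mathbf{A}$; (3) $\{1_{\mathbb{T}^d\setminus\{\mathbf1\}}\rho_n\}$ is relatively compact in $\tilde{\mathscr{M}}_{\mathbb{T}^d}^{\mathbf1}$ and all its limit points belong to $\mathcal{L}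(\rho)$.
   Context: A multiplicative Lévy triplet $(\boldsymbol\gamma,\mathbf{A},\rho)$ consists of $\boldsymbol\gamma\in\mathbb{T}^d$, a positive semi-definite symmetric $d\times d$ real matrix $\mathbf{A}$, and a positive measure $\rho$ on $\mathbb{T}^d$ with $\rho(\{\mathbf{1}\})=0$ and $\|\mathbf{1}-\Re\boldsymbol s\|\in L^1(\rho)$; $\nu_{\circledast}^{(\boldsymbol\gamma,\mathbf{A},\rho)}$ is the probability measure on $\mathbb{T}^d$ with characteristic function $\widehat{\nu}(\boldsymbol p)=\boldsymbol\gamma^{\boldsymbol p}\exp\big(-\frac12\langle\mathbf{A}\boldsymbol p,\boldsymbol p\rangle+\int_{\mathbb{T}^d}(\boldsymbol s^{\boldsymbol p}-1-i\langle\boldsymbol p,\Im\boldsymbol s\rangle)\,d\rho(\boldsymbol s)\big)$, $\boldsymbol p\in\mathbb{Z}^d$; $\circledast$ is the classical convolution on $\mathbb{T}^d$. $\mathcal{L}(\rho)$ is the set of Lévy measures $\widetilde\rho$ with $\nu_{\circledast}^{(\mathbf1,\mathbf0,\rho)}=\nu_{\circledast}^{(\mathbf1,\mathbf0,\widetilde\rho)}$. Infinitesimal means $k_1<k_2<\cdots$ and $\lim_n\max_k\nu_{nk}(\{\|\arg\boldsymbol s\|\geq\epsilon\})=0$ for every $\epsilon>0$. Fix $\theta\in(0,1)$; $\mathscr{U}_\epsilon=\{\boldsymbol s\in\mathbb{T}^d:\|\arg\boldsymbol s\|<\epsilon\}$ with $\arg\in(-\pi,\pi]$ componentwise; $\boldsymbol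 b_{nk}=\exp[i\int_{\mathscr{U}_\theta}(\arg\boldsymbol s)\,d\nu_{nk}(\boldsymbol s)]$ and $d\mathring\nu_{nk}(\boldsymbol s)=d\nu_{nk}(\boldsymbol b_{nk}\boldsymbol s)$. $\tilde{\mathscr{M}}_{\mathbb{T}^d}^{\mathbf1}$ is the (complete separable metrizable) space of positive Borel measures on $\mathbb{T}^d$ not charging $\mathbf1$ and finite on Borel sets bounded away from $\mathbf1$, with the topology of convergence $\int f\,d\tau_n\to\int f\,d\tau$ for all bounded continuous $f$ with support bounded away from $\mathbf1$. *)

(* Defs.v *)
From HB Require Import structures.
From mathcomp Require Import all_boot all_order all_algebra.
From mathcomp Require Import all_classical all_reals all_analysis.
From mathcomp Require Import complex.

Set Implicit Arguments.
Unset Strict Implicit.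
Unset Printing Implicit Defensive.

Import Order.TTheory GRing.Theory Num.Theory.
Import numFieldNormedType.Exports.

Local Open Scope classical_set_scope.
Local Open Scope ring_scope.
Local Open Scope complex_scope.

(* Borel measurable space on R^d (sigma-algebra generated by the open sets);
   measures on T^d are measures on it concentrated on [tbox]. *)
Notation TB R d := (g_sigma_algebraType (@open 'rV[R]_d)).

(* the fundamental domain (-pi, pi]^d = range of arg *)
Definition tbox (R : realType) (d : nat) : set 'rV[R]_d :=
  [set x | forall j, - pi < (x ord0 j) <= pi].

(* reduction of an angle mod 2pi into (-pi, pi] : arg (exp (i x)) *)
Definition wrap1 (R : realType) (x : R) : R :=
  x - 2 * pi * (Num.ceil ((x - pi) / (2 * pi)))%:~R.

Definition twrap (R : realType) (d : nat) (x : 'rV[R]_d) : 'rV[R]_d :=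
  \row_j wrap1 (x ord0 j).

Definition tmul (R : realType) (d : nat) (x y : 'rV[R]_d) : 'rV[R]_d :=
  twrap (x + y).

Definition tnorm (R : realType) (d : nat) (x : 'rV[R]_d) : R :=
  Num.sqrt (\sum_j (x ord0 j) ^+ 2).

Definition Ueps (R : realType) (d : nat) (eps : R) : set 'rV[R]_d :=
  [set x | tbox x /\ tnorm x < eps].

Definition ipair (R : realType) (d : nat) (p : 'rV[int]_d) (x : 'rV[R]_d) : R :=
  \sum_j ((p ord0 j))%:~R * (x ord0 j).

Definition tint (R : realType) (d : nat) (mu : {measure set (TB R d) -> \bar R})
  (f : 'rV[R]_d -> R) : R := Rintegral mu setT f.

Definition on_torus (R : realType) (d : nat) (mu : {measure set (TB R d) -> \bar R}) :=
  mu (~` tbox (d:=d)) = 0%E.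

(* Levy measure on T^d: rho({1}) = 0 and ||1 - Re s|| in L^1(rho) *)
Definition levy_measure (R : realType) (d : nat) (rho : {measure set (TB R d) -> \bar R}) :=
  [/\ on_torus rho, rho [set 0] = 0%E &
      rho.-integrable setT (fun x : 'rV[R]_d => (tnorm (\row_j (1 - cos (x ord0 j))))%:E)].

Definition cexp (R : realType) (z : R[i]) : R[i] :=
  (expR (complex.Re z) * cos (complex.Im z)) +i* (expR (complex.Re z) * sin (complex.Im z)).

Definition charfun (R : realType) (d : nat) (nu : {measure set (TB R d) -> \bar R})
  (p : 'rV[int]_d) : R[i] :=
  (tint nu (fun x => cos (ipair p x))) +i* (tint nu (fun x => sin (ipair p x))).

(* \int (s^p - 1 - i <p, Im s>) drho(s) *)
Definition levy_int (R : realType) (d : nat) (rho : {measure set (TB R d) -> \bar R})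
  (p : 'rV[int]_d) : R[i] :=
  (tint rho (fun x => cos (ipair p x) - 1)) +i*
  (tint rho (fun x => sin (ipair p x) - ipair p (\row_j sin (x ord0 j)))).

Definition quadform (R : realType) (d : nat) (A : 'M[R]_d) (p : 'rV[int]_d) : R :=
  \sum_j \sum_l A j l * ((p ord0 j))%:~R * ((p ord0 l))%:~R.

Definition levy_cf (R : realType) (d : nat) (gam : 'rV[R]_d) (A : 'M[R]_d)
  (rho : {measure set (TB R d) -> \bar R}) (p : 'rV[int]_d) : R[i] :=
  (cexp (0 +i* ipair p gam) *
   cexp ((- (quadform A p) / 2)%:C + levy_int rho p))%R.

Definition levy_triplet (R : realType) (d : nat) (gam : 'rV[R]_d) (A : 'M[R]_d)
  (rho : {measure set (TB R d) -> \bar R}) :=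
  [/\ A^T = A, (forall v : 'rV[R]_d, 0 <= (v *m A *m v^T) ord0 ord0) &
      levy_measure rho].

Definition is_levy_law (R : realType) (d : nat) (gam : 'rV[R]_d) (A : 'M[R]_d)
  (rho : {measure set (TB R d) -> \bar R}) (nu : probability (TB R d) R) :=
  on_torus nu /\ forall p, charfun nu p = levy_cf gam A rho p.

(* rho' in L(rho): rho' is a Levy measure with
   nu^(1,0,rho) = nu^(1,0,rho') (equality of their characteristic functions) *)
Definition in_L (R : realType) (d : nat) (rho rho' : {measure set (TB R d) -> \bar R}) :=
  levy_measure rho' /\ forall p, levy_cf 0 0 rho p = levy_cf 0 0 rho' p.

(* continuous functions on T^d (in angle coordinates: continuous and
   invariant under reduction mod 2pi, i.e. 2pi-periodic) *)
Definition tcontinuous (R : realType) (d : nat) (f : 'rV[R]_d -> R) :=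
  continuous f /\ forall x, f (twrap x) = f x.

(* continuous (hence bounded) functions on T^d whose support is bounded
   away from 1 *)
Definition tcont_away (R : realType) (d : nat) (f : 'rV[R]_d -> R) :=
  tcontinuous f /\ exists2 e : R, 0 < e & forall x, tnorm (twrap x) < e -> f x = 0.

(* convergence in T^d (as a subspace of C^d) *)
Definition tcvg (R : realType) (d : nat) (u : nat -> 'rV[R]_d) (l : 'rV[R]_d) :=
  forall j, (fun n => cos ((u n) ord0 j)) @ \oo --> cos (l ord0 j) /\
            (fun n => sin ((u n) ord0 j)) @ \oo --> sin (l ord0 j).

Definition in_Mtilde (R : realType) (d : nat) (tau : {measure set (TB R d) -> \bar R}) :=
  [/\ on_torus tau, tau [set 0] = 0%E &
      forall A : set (TB R d), measurable A ->
        (exists2 e : R, 0 < e & A `&` [set x | tnorm x < e] = set0) ->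
        (tau A < +oo)%E].

(* convergence in tilde M of a sequence of measures, given through the
   integrals I n f = \int f dtau_n *)
Definition Mtilde_cvg (R : realType) (d : nat) (I : nat -> ('rV[R]_d -> R) -> R)
  (tau : {measure set (TB R d) -> \bar R}) :=
  forall f, tcont_away f -> (fun n => I n f) @ \oo --> tint tau f.

(* \int f d(delta_x ⊛ nu_1 ⊛ ... ⊛ nu_k), l = [:: nu_1; ...; nu_k] *)
Fixpoint iconv (R : realType) (d : nat) (l : seq (probability (TB R d) R))
  (f : 'rV[R]_d -> R) (x : 'rV[R]_d) : R :=
  match l with
  | [::] => f x
  | nu :: l' => tint nu (fun t => iconv l' f (tmul x t))
  end.

Definition arow (R : realType) (d : nat) (kn : nat -> nat)
  (nu : nat -> nat -> probability (TB R d) R) (n : nat) :=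
  map (nu n) (iota 0 (kn n)).

Definition infinitesimal (R : realType) (d : nat) (kn : nat -> nat)
  (nu : nat -> nat -> probability (TB R d) R) :=
  (forall n, (kn n < kn n.+1)%N) /\
  forall eps : R, 0 < eps ->
    (fun n => \big[maxe/0%E]_(i < kn n)
       nu n i [set x | tbox x /\ eps <= tnorm x]) @ \oo --> 0%E.

(* arg b_nk = \int_{U_theta} arg s dnu_nk(s) (angle vector of b_nk) *)
Definition bvec (R : realType) (d : nat) (th : R)
  (nu : nat -> nat -> probability (TB R d) R) (n k : nat) : 'rV[R]_d :=
  \row_j Rintegral (nu n k) (Ueps th) (fun x => (x ord0 j)).

(* \int f d(mathring nu_nk), where d mathring nu_nk (s) = d nu_nk (b_nk s) *)
Definition ring_int (R : realType) (d : nat) (th : R)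
  (nu : nat -> nat -> probability (TB R d) R) (n k : nat) (f : 'rV[R]_d -> R) : R :=
  tint (nu n k) (fun t => f (twrap (t - bvec th nu n k))).

Definition rho_int (R : realType) (d : nat) (th : R) (kn : nat -> nat)
  (nu : nat -> nat -> probability (TB R d) R) (n : nat) (f : 'rV[R]_d -> R) : R :=
  \sum_(k < kn n) ring_int th nu n k f.

Definition gam_n (R : realType) (d : nat) (th : R) (kn : nat -> nat)
  (nu : nat -> nat -> probability (TB R d) R) (xi : nat -> 'rV[R]_d) (n : nat) :=
  twrap (xi n + \sum_(k < kn n)
     (twrap (bvec th nu n k) +
      \row_j ring_int th nu n k (fun s => sin (s ord0 j)))).

(* Main.v *)
Require Import Defs.
From HB Require Import structures.
From mathcomp Require Import all_boot all_order all_algebra.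
From mathcomp Require Import all_classical all_reals all_analysis.
From mathcomp Require Import measurable_realfun complex ring lra zify.
Import Order.TTheory GRing.Theory Num.Theory.
Import numFieldNormedType.Exports.
Local Open Scope classical_set_scope.
Local Open Scope ring_scope.

Set Implicit Arguments.
Unset Strict Implicit.
Unset Printing Implicit Defensive.

                                

(** Points of the torus are represented by their angles in (-pi, pi]^d and functions on it by 2
    pi-periodic functions. Trigonometric polynomials are dense ([trig_approx]), so weak convergence
    of the convolutions amounts to convergence of their Fourier coefficients [array_cf]
    ([tmean_cvg]). Sizes are measured by [tgauge], the sum over j of 1 - cos x_j: it is periodic,
    comparable on the box to the squared norm, and its integrability is the Lévy condition.

    The first half is the method of accompanying laws. Each factor is e^{i<p, b_nk>} psi_nk(p), with
    psi_nk the characteristic function of the centred law; let G_nk be the integral of the gauge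
    under that law. Centring at the truncated mean makes the mean of the sines O(G_nk)
    ([centered_sin_le]), so |psi_nk - 1| = O(G_nk), and infinitesimality makes max_k G_nk tend to 0
    ([infinitesimal_small]). Hence the product of the psi_nk differs from the product of the
    exp(psi_nk - 1) by O(max_k G_nk) times the sum of the G_nk ([array_approx]). Together with the
    translations, the second product is exactly e^{i<p, gamma_n>} times the exponential of the
    integral of s^p - 1 - i<p, Im s> against rho_n; this is [levy_approx]. So everything reduces to
    [levy_approx] once the sum of the G_nk, which is the integral of the gauge against rho_n, is
    bounded. Both sides of the equivalence give this bound: nonzero limits of the characteristic
    functions at the coordinate characters ([array_mass]), or condition (2) near 1 together with
    condition (3) away from 1 ([mass_bound]).

    The second half is compactness. Under that bound the measures with density [tgauge] against
    rho_n are weakly relatively compact ([helly]), so along a subsequence rho_n converges away from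
    1 to a Lévy measure tau ([vague_compact]), and the energies, the integrals of <p, Im s>^2
    against rho_n, converge to some c(p). The imaginary integrand, and the real one increased by <p,
    Im s>^2 / 2, are negligible against the gauge at 1, so their integrals converge to those under
    tau ([vague_cvg_small]). The exponents therefore converge to -D(p)/2 plus the exponent of tau
    ([levy_int_cvg]), where the [defect] D(p) is c(p) minus the energy of tau: the energy absorbed
    by the point 1. The double limit in (2) computes the same quantity ([local_energy_dlim],
    [dlim_defect]).

    Suppose the convolutions converge. At coordinate characters the exponent is real, so dividing by
    the modulus gives gamma_n -> gamma ([gam_n_tcvg]). Every subsequential pair (D, tau) then has
    the same exponential as the pair given by A and rho. Replacing p by np and dividing the real
    exponents by n^2 isolates the quadratic part ([quadratic_part_unique]), whence D(p) = <Ap, p>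
    and tau is in L(rho); polarization recovers the entries of A. Only exponentials are compared, so
    L(rho), rather than rho alone, is what the argument yields. Conversely, (1)-(3) identify the
    limit of [levy_approx] along a further subsequence of any subsequence ([levy_approx_cvg]). *)

Section trig_inequalities.
Context {R : realType}.
Implicit Types x y a b : R.

(** * Taylor-type inequalities for sine, cosine and the complex exponential *)

Lemma is_derive_le_ge0 (f g df dg : R -> R) x :
  (forall t, is_derive t (1 : R) f (df t)) -> (forall t, is_derive t (1 : R) g (dg t)) ->
  (forall t, 0 <= t -> df t <= dg t) -> f 0 = g 0 -> 0 <= x -> f x <= g x.
Proof.
move=> Df Dg le_d fg0 x0.
have Dh t : is_derive t (1 : R) (fun u => g u - f u) (dg t - df t).
  by apply: is_deriveB.
have ch : {within `[0, x], continuous (fun u => g u - f u)}.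
  by apply: derivable_within_continuous => t _; exact: (@ex_derive _ _ _ _ _ _ _ (Dh t)).
have [c + Ec] := MVT_segment x0 (fun t _ => Dh t) ch.
rewrite in_itv /= => /andP[c0 _].
move: Ec; rewrite subr0 fg0 subrr subr0 => Ec.
by rewrite -subr_ge0 Ec mulr_ge0 // subr_ge0 le_d //.
Qed.

Lemma sin_le_id x : 0 <= x -> sin x <= x.
Proof.
apply: (@is_derive_le_ge0 _ id cos (fun=> 1)); rewrite ?sin0 //.
Qed.

Lemma cos_ge_sqr_ge0 x : 0 <= x -> 1 - x ^+ 2 / 2 <= cos x.
Proof.
apply: (@is_derive_le_ge0 (fun t => 1 - t ^+ 2 / 2) _ (fun t => - t) (fun t => - sin t)).
- move=> t; apply: is_derive_eq; rewrite /GRing.scale /=; lra.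
- by move=> t t0; rewrite lerN2 sin_le_id.
- by rewrite cos0; lra.
Qed.

Lemma cos_ge_sqr x : 1 - x ^+ 2 / 2 <= cos x.
Proof. by rewrite -cos_norm -real_normK ?num_real// cos_ge_sqr_ge0. Qed.

Lemma sin_ge_cube x : 0 <= x -> x - x ^+ 3 / 6 <= sin x.
Proof.
apply: (@is_derive_le_ge0 (fun t => t - t ^+ 3 / 6) _ (fun t => 1 - t ^+ 2 / 2) cos).
- move=> t; apply: is_derive_eq; rewrite /GRing.scale /=; lra.
- by move=> t t0; rewrite cos_ge_sqr.
- by rewrite sin0; lra.
Qed.

Lemma cos_le_quartic x : cos x <= 1 - x ^+ 2 / 2 + x ^+ 4 / 24.
Proof.
suff H y : 0 <= y -> cos y <= 1 - y ^+ 2 / 2 + y ^+ 4 / 24.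
  have := H `|x| (normr_ge0 x).
  rewrite cos_norm (_ : 4 = 2 * 2)%N // !exprM real_normK ?num_real //.
apply: (@is_derive_le_ge0 _ (fun t => 1 - t ^+ 2 / 2 + t ^+ 4 / 24)
   (fun t => - sin t) (fun t => - (t - t ^+ 3 / 6))).
- move=> t; apply: is_derive_eq; rewrite /GRing.scale /=; lra.
- by move=> t t0; rewrite lerN2 sin_ge_cube.
- by rewrite cos0; lra.
Qed.

Lemma norm_sin_le x : `|sin x| <= `|x|.
Proof.
wlog x0 : x / 0 <= x => [H|].
  case: (lerP 0 x) => [|/ltW x0]; first exact: H.
  by rewrite -normrN -sinN -[`|x|]normrN; apply: H; rewrite oppr_ge0.
rewrite (ger0_norm x0) ler_norml sin_le_id // andbT.
have := sin_ge_cube x0; have := sin_geN1 x.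
case: (lerP x 1) => x1; nra.
Qed.

Lemma norm_sin_sub_cube x : `|sin x - x| <= `|x| ^+ 3 / 6.
Proof.
wlog x0 : x / 0 <= x => [H|].
  case: (lerP 0 x) => [|/ltW x0]; first exact: H.
  rewrite -normrN opprD -sinN -[in leRHS](normrN x).
  by apply: H; rewrite oppr_ge0.
rewrite (ger0_norm x0) ler_norml; have := sin_le_id x0; have := sin_ge_cube x0.
have := exprn_ge0 3 x0; lra.
Qed.

Lemma norm_sin_sub_sqr x : `|sin x - x| <= x ^+ 2.
Proof.
have := norm_sin_sub_cube x; have := ler_normB (sin x) x; have := sin_max x.
rewrite -(real_normK (num_real x)); have := normr_ge0 x.
move: `|x| `|sin x| `|_ - _| => t u v t0 u1 uv vt.
case: (lerP t 2) => t2; first by have := exprn_ge0 2 t0; nra.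
nra.
Qed.

Lemma norm_cos_sub_cube x : `|cos x - 1 + x ^+ 2 / 2| <= `|x| ^+ 3.
Proof.
rewrite ger0_norm; last by have := cos_ge_sqr x; lra.
have := cos_le_quartic x; have := cos_le1 x.
rewrite (_ : x ^+ 4 = `|x| ^+ 4); last first.
  by rewrite (_ : 4 = 2 * 2)%N // !exprM real_normK ?num_real.
rewrite -(real_normK (num_real x)).
have := normr_ge0 x; move: `|x| => t t0; case: (lerP t 2) => t2 h1 h2.
  have : 0 <= t ^+ 3 * (2 - t) by apply: mulr_ge0; [exact: exprn_ge0 | lra].
  have := exprn_ge0 3 t0; have := exprn_ge0 2 t0; nra.
have : 0 <= t ^+ 2 * (t - 2) by apply: mulr_ge0; [exact: exprn_ge0 | lra].
have := exprn_ge0 2 t0; nra.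
Qed.

Lemma onem_cos_ge0 x : 0 <= 1 - cos x.
Proof. by rewrite subr_ge0 cos_le1. Qed.

Lemma onem_cos_le_sqr x : 1 - cos x <= x ^+ 2 / 2.
Proof. by have := cos_ge_sqr x; lra. Qed.

(** For |x| <= 2 the quartic bound on the cosine suffices. On [2, pi] the cosine is at most cos 2 <=
    -1/3, and 12 times 4/3 is 16, which exceeds pi^2 because pi < 4; this is where 12 comes from. *)
Lemma sqr_le_onem_cos x : `|x| <= pi -> x ^+ 2 <= 12 * (1 - cos x).
Proof.
move=> xpi; rewrite -(real_normK (num_real x)) -cos_norm.
have := normr_ge0 x; move: `|x| xpi => t tpi t0.
have := cos_le_quartic t.
case: (lerP t 2) => t2 h.
  have : 0 <= t ^+ 2 * (4 - t ^+ 2).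
    by apply: mulr_ge0; [exact: exprn_ge0 | nra].
  have := exprn_ge0 2 t0; nra.
have pi4 : (pi : R) < 4 by have := @pihalf_lt2 R; lra.
have ct : cos t <= cos 2.
  case: (ltrP 2 t) => [lt2|]; last by lra.
  rewrite ltW // ltr_cos // in_itv /=; have := @pi_ge2 R; lra.
have := cos_le_quartic (2 : R); nra.
Qed.

(** Since 1 - cos x = 2 sin(x/2)^2, this is the bound sin(a + b)^2 <= 2 sin(a)^2 + 2 sin(b)^2. It
    gives the gauge its substitute for the triangle inequality. *)
Lemma onem_cosD x y : 1 - cos (x + y) <= 2 * (1 - cos x) + 2 * (1 - cos y).
Proof.
have hx : 1 - cos x = 2 * sin (x / 2) ^+ 2.
  by rewrite sin2cos2 {1}(splitr x) cosD -!expr2 sin2cos2; ring.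
have hy : 1 - cos y = 2 * sin (y / 2) ^+ 2.
  by rewrite sin2cos2 {1}(splitr y) cosD -!expr2 sin2cos2; ring.
have hxy : 1 - cos (x + y) = 2 * sin (x / 2 + y / 2) ^+ 2.
  rewrite sin2cos2 {1}(splitr x) {1}(splitr y).
  rewrite (_ : x / 2 + x / 2 + (y / 2 + y / 2) = (x / 2 + y / 2) + (x / 2 + y / 2)); last by ring.
  by rewrite cosD -!expr2 sin2cos2; ring.
rewrite hx hy hxy sinD.
have ca := cos2Dsin2 (x / 2); have cb := cos2Dsin2 (y / 2).
move: (sin (x / 2)) (cos (x / 2)) (sin (y / 2)) (cos (y / 2)) ca cb.
move=> s c s' c' ca cb.
have : (s * c' + c * s') ^+ 2 <= 2 * (s * c') ^+ 2 + 2 * (c * s') ^+ 2.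
  by have := sqr_ge0 (s * c' - c * s'); lra.
have : s ^+ 2 * (1 - c' ^+ 2) >= 0.
  by apply: mulr_ge0; [exact: sqr_ge0 | have := sqr_ge0 s'; lra].
have : s' ^+ 2 * (1 - c ^+ 2) >= 0.
  by apply: mulr_ge0; [exact: sqr_ge0 | have := sqr_ge0 s; lra].
rewrite !exprMn; lra.
Qed.

Lemma sin_sqr_le x : sin x ^+ 2 <= 2 * (1 - cos x).
Proof. by have := cos2Dsin2 x; have := sqr_ge0 (1 - cos x); nra. Qed.

Lemma expR_sub_sqr a : a <= 0 -> `|expR a - 1 - a| <= a ^+ 2.
Proof.
move=> a0; rewrite ger0_norm; last by have := expR_ge1Dx a; lra.
have h1 := expR_ge1Dx (- a); have ha := expR_gt0 a.
have e : expR a * expR (- a) = 1 by rewrite -expRD subrr expR0.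
have : expR a * (1 - a) <= 1 by rewrite -{2}e ler_pM2l.
have : 0 <= - a * a ^+ 2 by rewrite mulr_ge0 ?sqr_ge0 // oppr_ge0.
move: (expR a) ha => E E0 h2 h3.
(* For a <= 0, (1 + a + a^2)(1 - a) = 1 - a^3 >= 1 >= e^a (1 - a). *)
have : 0 <= (1 + a + a ^+ 2 - E) * (1 - a) by nra.
rewrite pmulr_lge0; lra.
Qed.

Lemma normc_cexp (z : R[i]) : Normc.normc (cexp z) = expR (complex.Re z).
Proof.
case: z => a b /=; rewrite !exprMn -mulrDr cos2Dsin2 mulr1 sqrtr_sqr.
by rewrite ger0_norm // expR_ge0.
Qed.

Lemma cexpD (z w : R[i]) : cexp (z + w) = cexp z * cexp w.
Proof.
case: z w => [a b] [a' b']; rewrite /cexp /= expRD cosD sinD.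
by simpc; congr (_ +i* _)%C; ring.
Qed.

Lemma cexp0 : cexp 0 = 1 :> R[i].
Proof. by rewrite /cexp /= expR0 cos0 sin0 mulr1 mulr0. Qed.

Lemma cexp_neq0 (z : R[i]) : cexp z != 0.
Proof.
apply/eqP => e; have := normc_cexp z; rewrite e Normc.normc0.
by move/esym/eqP; rewrite expR_eq0.
Qed.

Lemma normc_le_sum (z : R[i]) : Normc.normc z <= `|complex.Re z| + `|complex.Im z|.
Proof.
case: z => a b /=; rewrite -[leRHS]ger0_norm ?addr_ge0 // -sqrtr_sqr.
rewrite ler_wsqrtr // sqrrD !real_normK ?num_real //.
by rewrite -addrA lerD2l lerDr mulrn_wge0 // mulr_ge0.
Qed.

Lemma normc_sqr (z : R[i]) : Normc.normc z ^+ 2 = complex.Re z ^+ 2 + complex.Im z ^+ 2.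
Proof. by case: z => a b /=; rewrite sqr_sqrtr // addr_ge0 ?sqr_ge0. Qed.

Lemma normc_ge0 (z : R[i]) : 0 <= Normc.normc z.
Proof. by case: z => a b; exact: sqrtr_ge0. Qed.

Lemma norm_Re_le (z : R[i]) : `|complex.Re z| <= Normc.normc z.
Proof.
by case: z => a b /=; rewrite -[leLHS]sqrtr_sqr ler_wsqrtr // lerDl sqr_ge0.
Qed.

Lemma norm_Im_le (z : R[i]) : `|complex.Im z| <= Normc.normc z.
Proof.
by case: z => a b /=; rewrite -[leLHS]sqrtr_sqr ler_wsqrtr // lerDr sqr_ge0.
Qed.

(** The bound is uniform on the half plane Re z <= 0, with no restriction on Im z: e^a stays below 1
    there, and the trigonometric remainders are at most b^2 for every real b. It compares a
    characteristic function psi with exp(psi - 1). *)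
Lemma cexp_sub_sqr (z : R[i]) : complex.Re z <= 0 ->
  Normc.normc (cexp z - (1 + z)) <= 4 * Normc.normc z ^+ 2.
Proof.
move=> z0; rewrite normc_sqr; apply: (le_trans (normc_le_sum _)).
case: z z0 => a b /= a0.
have -> : expR a * cos b - (1 + a) = (expR a - 1 - a) + expR a * (cos b - 1) by ring.
have -> : expR a * sin b - (0 + b) = (expR a - 1) * sin b + (sin b - b) by ring.
have h1 := expR_sub_sqr a0.
have e1 : expR a <= 1 by rewrite -expR0 ler_expR.
have e0 := expR_ge0 a.
have h2 : `|expR a * (cos b - 1)| <= b ^+ 2.
  rewrite normrM (ger0_norm e0) distrC (ger0_norm (onem_cos_ge0 b)).
  by have := onem_cos_le_sqr b; have := onem_cos_ge0 b; have := sqr_ge0 b; nra.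
have h3 : `|(expR a - 1) * sin b| <= `|a| * `|b|.
  rewrite normrM ler_pM // ?norm_sin_le // distrC ger0_norm ?subr_ge0 //.
  rewrite (ler0_norm a0); have := expR_ge1Dx a; lra.
have h4 := norm_sin_sub_sqr b.
have h5 : `|a| * `|b| <= a ^+ 2 + b ^+ 2.
  rewrite -(real_normK (num_real a)) -(real_normK (num_real b)).
  by have := sqr_ge0 (`|a| - `|b|); have := sqr_ge0 `|a|; have := sqr_ge0 `|b|; nra.
have := ler_normD (expR a - 1 - a) (expR a * (cos b - 1)).
have := ler_normD ((expR a - 1) * sin b) (sin b - b).
by have := sqr_ge0 a; have := sqr_ge0 b; lra.
Qed.

End trig_inequalities.

                                       

(** * Reduction of angles modulo 2 pi *)

Section wrap.
Context {R : realType}.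
Implicit Types x y : R.

Lemma cosD2pin x n : cos (x + 2 * pi * n%:R) = cos x.
Proof. by rewrite [2 * pi]mulrC mulr_natr mulr_natr (periodicn (@cosD2pi R)). Qed.

Lemma sinD2pin x n : sin (x + 2 * pi * n%:R) = sin x.
Proof. by rewrite [2 * pi]mulrC mulr_natr mulr_natr (periodicn (@sinD2pi R)). Qed.

Lemma cosD2piz x (k : int) : cos (x + 2 * pi * k%:~R) = cos x.
Proof.
case: k => n; first by rewrite cosD2pin.
by rewrite NegzE mulrNz -{2}(subrK (2 * pi * n.+1%:R) x) cosD2pin mulrN.
Qed.

Lemma sinD2piz x (k : int) : sin (x + 2 * pi * k%:~R) = sin x.
Proof.
case: k => n; first by rewrite sinD2pin.
by rewrite NegzE mulrNz -{2}(subrK (2 * pi * n.+1%:R) x) sinD2pin mulrN.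
Qed.

Lemma wrap1_bounds x : - pi < wrap1 x <= pi.
Proof.
have p0 : 0 < 2 * pi :> R by rewrite mulr_gt0 // pi_gt0.
have /andP[] := ceil_itv ((x - pi) / (2 * pi)).
rewrite ltr_pdivlMr // ler_pdivrMr // intrB /wrap1.
by move: (_%:~R) => c; have := @pi_gt0 R; nra.
Qed.

Lemma wrap1E x : exists k : int, wrap1 x = x + 2 * pi * k%:~R.
Proof.
by exists (- Num.ceil ((x - pi) / (2 * pi))); rewrite /wrap1 mulrNz mulrN.
Qed.

Lemma wrap1_eq x y (k : int) : - pi < y <= pi -> y = x + 2 * pi * k%:~R -> wrap1 x = y.
Proof.
have p0 : 0 < 2 * pi :> R by rewrite mulr_gt0 // pi_gt0.
move=> yb yx; have := wrap1_bounds x; have [l wl] := wrap1E x.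
rewrite wl yx; rewrite yx in yb => wb; congr (_ + _ * _%:~R).
have lt1 : `|(l - k)%:~R : R| < 1.
  rewrite -(ltr_pM2l p0) mulr1 -[X in X * _](gtr0_norm p0) -normrM.
  rewrite intrB ltr_norml.
  by move: (l%:~R) (k%:~R) yb wb => u v; nra.
move: lt1; rewrite -intr_norm (_ : 1 = 1%:~R) // ltr_int; lia.
Qed.

Lemma wrap1_id x : - pi < x <= pi -> wrap1 x = x.
Proof. by move=> xb; apply: (@wrap1_eq _ _ 0) => //; rewrite mulr0 addr0. Qed.

Lemma wrap1D x y : wrap1 (wrap1 x + y) = wrap1 (x + y).
Proof.
have [k Ek] := wrap1E x; have [l El] := wrap1E (wrap1 x + y).
apply/esym; apply: (@wrap1_eq _ _ (k + l)); first exact: wrap1_bounds.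
by rewrite El Ek intrD; ring.
Qed.

Lemma cos_wrap1 x : cos (wrap1 x) = cos x.
Proof. by have [k ->] := wrap1E x; rewrite cosD2piz. Qed.

Lemma sin_wrap1 x : sin (wrap1 x) = sin x.
Proof. by have [k ->] := wrap1E x; rewrite sinD2piz. Qed.

Lemma measurable_wrap1 : measurable_fun setT (@wrap1 R).
Proof.
rewrite /wrap1; apply: measurable_funB => //; apply: measurable_funM => //.
have mceil : measurable_fun setT (fun x : R => (Num.ceil x)%:~R : R).
  apply: (measurability _ (RGenCInfty.measurableE R)) => //.
  move=> _ [_ [y ->] <-]; rewrite setTI.
  rewrite (_ : _ @^-1` _ = `](Num.ceil y - 1)%:~R, +oo[%classic) //.
  apply/seteqP; split => x /=; rewrite !in_itv /= !andbT.
    by rewrite -ceil_le_int -ceil_gt_int ltrBlDr ltzD1.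
  by rewrite -ceil_gt_int ltrBlDr ltzD1 ceil_le_int.
apply: (measurableT_comp mceil); apply: measurable_funM => //.
exact: measurable_funB.
Qed.

End wrap.

(** * The torus: gauge, norm, Borel structure and periodic continuous functions *)

Section torus.
Context {R : realType} {d : nat}.
Implicit Types (x y : 'rV[R]_d) (p : 'rV[int]_d).

Lemma tbox_twrap x : tbox (twrap x).
Proof. by move=> j; rewrite mxE; exact: wrap1_bounds. Qed.

Lemma twrap_id x : tbox x -> twrap x = x.
Proof. by move=> bx; apply/rowP => j; rewrite mxE wrap1_id. Qed.

Lemma twrapD x y : twrap (twrap x + y) = twrap (x + y).
Proof. by apply/rowP => j; rewrite !mxE wrap1D. Qed.

Lemma twrap_twrap x : twrap (twrap x) = twrap x.
Proof. by rewrite twrap_id //; exact: tbox_twrap. Qed.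

Lemma ipairE p x : ipair p (twrap x) = ipair p x +
  2 * pi * (\sum_j p ord0 j * (- Num.ceil ((x ord0 j - pi) / (2 * pi))))%:~R.
Proof.
rewrite /ipair (big_morph (intmul (1 : R)) (@intrD R) (erefl _)) mulr_sumr -big_split /=; apply: eq_bigr => j _.
by rewrite mxE /wrap1 intrM mulrNz; ring.
Qed.

Lemma ipairD p x y : ipair p (x + y) = ipair p x + ipair p y.
Proof. by rewrite /ipair -big_split; apply: eq_bigr => j _ /=; rewrite mxE mulrDr. Qed.

Lemma ipairN p x : ipair p (- x) = - ipair p x.
Proof. by rewrite /ipair -sumrN; apply: eq_bigr => j _ /=; rewrite mxE mulrN. Qed.

Lemma cos_ipair_twrap p x : cos (ipair p (twrap x)) = cos (ipair p x).
Proof. by rewrite ipairE cosD2piz. Qed.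

Lemma sin_ipair_twrap p x : sin (ipair p (twrap x)) = sin (ipair p x).
Proof. by rewrite ipairE sinD2piz. Qed.

                                                                                                
(** The l^1 norm of 1 - Re s in angle coordinates. Periodic, continuous and quasi-subadditive, it
    stands for the squared distance to 1 everywhere below. *)
Definition tgauge x : R := \sum_j (1 - cos (x ord0 j)).

Lemma tgauge_ge0 x : 0 <= tgauge x.
Proof. by apply: sumr_ge0 => j _; exact: onem_cos_ge0. Qed.

Lemma tgauge_le x : tgauge x <= 2 * d%:R.
Proof.
apply: (@le_trans _ _ (\sum_(j < d) 2)); last by rewrite sumr_const card_ord mulr_natr.
by apply: ler_sum => j _; have := cos_geN1 (x ord0 j); lra.
Qed.

Lemma onem_cos_le_tgauge x j : 1 - cos (x ord0 j) <= tgauge x.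
Proof. by rewrite /tgauge (bigD1 j) //= lerDl sumr_ge0 // => i _; exact: onem_cos_ge0. Qed.

Lemma tgauge_twrap x : tgauge (twrap x) = tgauge x.
Proof. by apply: eq_bigr => j _; rewrite mxE cos_wrap1. Qed.

Lemma tgaugeD x y : tgauge (x + y) <= 2 * tgauge x + 2 * tgauge y.
Proof.
rewrite /tgauge !mulr_sumr -big_split; apply: ler_sum => j _ /=.
by rewrite mxE onem_cosD.
Qed.

Lemma tgaugeN x : tgauge (- x) = tgauge x.
Proof. by apply: eq_bigr => j _; rewrite mxE cosN. Qed.

Lemma sin_sqr_le_tgauge x j : sin (x ord0 j) ^+ 2 <= 2 * tgauge x.
Proof. by apply: (le_trans (sin_sqr_le _)); rewrite ler_pM2l // onem_cos_le_tgauge. Qed.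

Lemma tnorm_ge0 x : 0 <= tnorm x.
Proof. exact: sqrtr_ge0. Qed.

Lemma tnorm_sqr x : tnorm x ^+ 2 = \sum_j x ord0 j ^+ 2.
Proof. by rewrite sqr_sqrtr // sumr_ge0 // => j _; exact: sqr_ge0. Qed.

Lemma coord_le_tnorm x j : `|x ord0 j| <= tnorm x.
Proof.
rewrite -[leLHS]sqrtr_sqr; apply: ler_wsqrtr.
by rewrite (bigD1 j) //= lerDl sumr_ge0 // => i _; exact: sqr_ge0.
Qed.

Lemma tnorm_le_sum x : tnorm x <= \sum_j `|x ord0 j|.
Proof.
have s0 : 0 <= \sum_j `|x ord0 j| by apply: sumr_ge0.
rewrite -[leRHS]ger0_norm // -sqrtr_sqr; apply: ler_wsqrtr.
rewrite expr2 mulr_suml; apply: ler_sum => j _.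
rewrite -(real_normK (num_real (x ord0 j))) expr2 ler_wpM2l //.
by rewrite (bigD1 j) //= lerDl sumr_ge0.
Qed.

Lemma tgauge_le_tnorm x : tgauge x <= tnorm x ^+ 2 / 2.
Proof.
rewrite tnorm_sqr mulr_suml; apply: ler_sum => j _; exact: onem_cos_le_sqr.
Qed.

Lemma tbox_le_pi x j : tbox x -> `|x ord0 j| <= pi.
Proof. by move=> /(_ j); rewrite ler_norml => /andP[/ltW -> ->]. Qed.

Lemma tnorm_le_tgauge x : tbox x -> tnorm x ^+ 2 <= 12 * tgauge x.
Proof.
move=> bx; rewrite tnorm_sqr mulr_sumr; apply: ler_sum => j _.
by apply: sqr_le_onem_cos; exact: tbox_le_pi.
Qed.

Lemma continuous_coord j : continuous (fun x => x ord0 j).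
Proof. exact: coord_continuous. Qed.

Lemma cvg_sumr I (r : seq I) (P : pred I) (T : Type) (F : set_system T) (f : I -> T -> R) (l : I -> R) :
  Filter F -> (forall i, P i -> f i u @[u --> F] --> l i) ->
  (\sum_(i <- r | P i) f i u) @[u --> F] --> \sum_(i <- r | P i) l i.
Proof.
move=> FF fl; elim: r => [|i r IH].
  by under eq_fun do rewrite big_nil; rewrite big_nil; exact: cvg_cst.
under eq_fun do rewrite big_cons; rewrite big_cons; case: ifPn => // Pi.
by apply: cvgD => //; exact: fl.
Qed.

Lemma continuous_sum I (r : seq I) (P : pred I) (T : topologicalType) (f : I -> T -> R) :
  (forall i, P i -> continuous (f i)) -> continuous (fun u => \sum_(i <- r | P i) f i u).
Proof. by move=> cf u; apply: cvg_sumr => i Pi; exact: cf. Qed.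

Lemma continuous_ipair p : continuous (fun x => ipair p x).
Proof.
apply: (@continuous_sum _ _ _ _ (fun j x => (p ord0 j)%:~R * x ord0 j)) => j _ x.
by apply: continuousM; [exact: cst_continuous|exact: continuous_coord].
Qed.

Lemma continuous_tgauge : continuous tgauge.
Proof.
apply: (@continuous_sum _ _ _ _ (fun j (x : 'rV[R]_d) => 1 - cos (x ord0 j))) => j _ x.
apply: continuousB; first exact: cst_continuous.
by apply: continuous_comp; [exact: continuous_coord|exact: continuous_cos].
Qed.

Lemma continuous_tnorm : continuous (fun x => tnorm x).
Proof.
move=> x; apply: (@continuous_comp _ _ _ (fun x : 'rV[R]_d => \sum_j (x ord0 j) ^+ 2)).
  apply: (@continuous_sum _ _ _ _ (fun j (x : 'rV[R]_d) => x ord0 j ^+ 2)) => j _ y.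
  by apply: (@continuousM _ _ (fun x => x ord0 j) (fun x => x ord0 j)); exact: continuous_coord.
exact: sqrt_continuous.
Qed.

Lemma continuous_measurable_TB (f : 'rV[R]_d -> R) :
  continuous f -> measurable_fun setT (f : TB R d -> R).
Proof.
move=> /continuousP cf; apply: (measurability _ (RGenOpens.measurableE R)).
move=> _ [_ [a [b ->] <-]]; rewrite setTI.
by apply: sub_sigma_algebra; apply: cf; exact: interval_open.
Qed.

(** The sigma-algebra on the target is generated by all open sets, not by coordinates. Every open
    set is a countable union of sup-norm balls with rational centres and radii 1/(m+1), and the
    preimage of a ball is a finite intersection of coordinate conditions. *)
Lemma measurable_to_TB (dT : measure_display) (T : measurableType dT) (F : T -> 'rV[R]_d) :
  (forall j, measurable_fun setT (fun t => F t ord0 j)) ->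
  @measurable_fun _ _ T (TB R d) setT F.
Proof.
move=> mF; apply: (@measurability _ _ T (TB R d : measurableType _) setT F (@open 'rV[R]_d)) => //.
move=> _ [U oU <-]; rewrite setTI.
pose S (qm : 'rV[rat]_d * nat) : set T :=
  if pselect (ball (map_mx ratr qm.1 : 'rV[R]_d) qm.2.+1%:R^-1 `<=` U)
  then \bigcap_(j in [set: 'I_d]) [set t | `|ratr (qm.1 ord0 j) - F t ord0 j| < qm.2.+1%:R^-1]
  else set0.
have -> : F @^-1` U = \bigcup_n (if unpickle n is Some qm then S qm else set0).
  apply/seteqP; split => [t Ut|t [n _]] /=; last first.
    case: unpickle => // -[q m]; rewrite /S; case: pselect => //= sU h.
    apply: sU; split => [|i j]; first by rewrite invr_gt0.
    by rewrite ord1 mxE; exact: (h j).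
  have /nbhs_ballP[e /= e0 sU] : nbhs (F t) U by apply: open_nbhs_nbhs.
  pose m := Num.truncn (2 / e).
  have m0 : 0 < m.+1%:R^-1 :> R by rewrite invr_gt0.
  have me : m.+1%:R^-1 + m.+1%:R^-1 < e.
    have : 2 / e < m.+1%:R by exact: truncnS_gt.
    rewrite ltr_pdivrMr // mulrC -ltr_pdivrMr // => h.
    by move: h; rewrite mulrDl mul1r.
  have ex j : {q : rat | `|ratr q - F t ord0 j| < m.+1%:R^-1}.
    apply: cid; have : F t ord0 j - m.+1%:R^-1 < F t ord0 j + m.+1%:R^-1.
      by rewrite ltrBlDr -addrA ltrDl addr_gt0.
    move=> /rat_in_itvoo[q]; rewrite in_itv /= => /andP[h1 h2]; exists q.
    by rewrite ltr_distl h1 h2.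
  pose q : 'rV[rat]_d := \row_j sval (ex j).
  have hq j : `|ratr (q ord0 j) - F t ord0 j| < m.+1%:R^-1.
    by rewrite mxE; case: (ex j).
  exists (pickle (q, m)) => //; rewrite pickleK /S; case: pselect => /= [_ j _|]; first exact: hq.
  case; apply: subset_trans sU => y [_ qy]; split => // i j.
  have := qy i j; have := hq j; rewrite (ord1 i) /ball /= [map_mx _ _ _ _]mxE => h1 h2.
  rewrite -(subrK (ratr (q ord0 j)) (F t ord0 j)) -addrA.
  by apply: (le_lt_trans (ler_normD _ _)); rewrite distrC; apply: lt_trans me; exact: ltrD.
apply: bigcupT_measurable => n; case: unpickle => [[q m]|]; last exact: measurable0.
rewrite /S; case: pselect => ? /=; last exact: measurable0.
apply: fin_bigcap_measurable => // j _ /=.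
have mj : measurable_fun setT (fun t => `|ratr (q ord0 j) - F t ord0 j|).
  by apply: measurableT_comp => //; apply: measurable_funB.
rewrite [X in measurable X](_ : _ = (fun t => `|ratr (q ord0 j) - F t ord0 j|) @^-1` `]-oo, m.+1%:R^-1[).
  by rewrite -[X in measurable X]setTI; apply: mj.
by apply/seteqP; split => t /=; rewrite in_itv.
Qed.

Lemma measurable_coord j : measurable_fun setT (fun x : TB R d => (x : 'rV[R]_d) ord0 j).
Proof. by apply: (@continuous_measurable_TB (fun x => x ord0 j)); exact: continuous_coord. Qed.

Lemma measurable_twrap_sub y :
  @measurable_fun _ _ (TB R d) (TB R d) setT (fun t => twrap (t - y)).
Proof.
apply: measurable_to_TB => j.
rewrite (_ : (fun t => _) = (@wrap1 R) \o (fun t : TB R d => (t : 'rV[R]_d) ord0 j - y ord0 j)).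
  apply: measurableT_comp; first exact: measurable_wrap1.
  by apply: measurable_funB => //; exact: measurable_coord.
by apply/funext => t /=; rewrite !mxE.
Qed.

Lemma measurable_tmul y : @measurable_fun _ _ (TB R d) (TB R d) setT (tmul y).
Proof.
rewrite (_ : tmul y = fun t => twrap (t - (- y))); first exact: measurable_twrap_sub.
by apply/funext => t; rewrite opprK addrC.
Qed.

Lemma measurable_twrap : @measurable_fun _ _ (TB R d) (TB R d) setT (@twrap R d).
Proof.
rewrite (_ : (@twrap R d) = fun t => twrap (t - 0)); first exact: measurable_twrap_sub.
by apply/funext => t; rewrite subr0.
Qed.

Lemma measurable_tbox : measurable (@tbox R d : set (TB R d)).
Proof.
rewrite (_ : @tbox R d = \bigcap_(j in [set: 'I_d]) [set x | - pi < x ord0 j <= pi]).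
  apply: fin_bigcap_measurable => // j _.
  rewrite [X in measurable X](_ : _ =
      (fun x : TB R d => (x : 'rV[R]_d) ord0 j) @^-1` `]-pi, pi]); last first.
    by apply/seteqP; split => t /=; rewrite in_itv.
  by rewrite -[X in measurable X]setTI; apply: measurable_coord.
by apply/seteqP; split => x /=; [move=> h j _; exact: h|move=> h j; exact: (h j)].
Qed.

Lemma measurable_tnorm_lt (e : R) : measurable ([set x | tnorm x < e] : set (TB R d)).
Proof.
rewrite (_ : [set x | _] = (fun x : TB R d => @tnorm R d x) @^-1` `]-oo, e[).
  by rewrite -[X in measurable X]setTI; apply: (continuous_measurable_TB continuous_tnorm).
by apply/seteqP; split => t /=; rewrite in_itv.
Qed.

Lemma measurable_Ueps (e : R) : measurable (Ueps e : set (TB R d)).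
Proof. by apply: measurableI; [exact: measurable_tbox|exact: measurable_tnorm_lt]. Qed.

Lemma tmulE (f : 'rV[R]_d -> R) x t : tcontinuous f -> f (tmul x t) = f (x + t).
Proof. by move=> [_ fw]; rewrite /tmul fw. Qed.

Lemma tcontinuous_cos p : tcontinuous (fun x => cos (ipair p x)).
Proof.
split=> [x|x]; last exact: cos_ipair_twrap.
by apply: continuous_comp; [exact: continuous_ipair|exact: continuous_cos].
Qed.

Lemma tcontinuous_sin p : tcontinuous (fun x => sin (ipair p x)).
Proof.
split=> [x|x]; last exact: sin_ipair_twrap.
by apply: continuous_comp; [exact: continuous_ipair|exact: continuous_sin].
Qed.

Lemma tcontinuous_cst (c : R) : tcontinuous (fun _ : 'rV[R]_d => c).
Proof. by split => // x; exact: cst_continuous. Qed.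

Lemma tcontinuousD (f h : 'rV[R]_d -> R) :
  tcontinuous f -> tcontinuous h -> tcontinuous (fun x => f x + h x).
Proof.
by move=> [cf pf] [ch ph]; split=> [x|x]; [apply: continuousD; [exact: cf|exact: ch]|rewrite pf ph].
Qed.

Lemma tcontinuousM (f h : 'rV[R]_d -> R) :
  tcontinuous f -> tcontinuous h -> tcontinuous (fun x => f x * h x).
Proof.
by move=> [cf pf] [ch ph]; split=> [x|x]; [apply: continuousM; [exact: cf|exact: ch]|rewrite pf ph].
Qed.

Lemma tcontinuousN (f : 'rV[R]_d -> R) : tcontinuous f -> tcontinuous (fun x => - f x).
Proof. by move=> [cf pf]; split=> [x|x]; [apply: continuousN; exact: cf|rewrite pf]. Qed.

Lemma tcontinuous_sum I (r : seq I) (f : I -> 'rV[R]_d -> R) :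
  (forall i, tcontinuous (f i)) -> tcontinuous (fun x => \sum_(i <- r) f i x).
Proof.
move=> tf; split=> [|x]; first by apply: continuous_sum => i _; exact: (tf i).1.
by apply: eq_bigr => i _; case: (tf i).
Qed.

Lemma tcontinuous_tgauge : tcontinuous tgauge.
Proof. by split; [exact: continuous_tgauge|exact: tgauge_twrap]. Qed.

Lemma tcontinuous_sinj j : tcontinuous (fun x => sin (x ord0 j)).
Proof.
split=> [x|x]; last by rewrite mxE sin_wrap1.
by apply: continuous_comp; [exact: continuous_coord|exact: continuous_sin].
Qed.

End torus.

                                    

(** * Real-valued integrals, image measures and finite sums of measures *)

Section real_integrals.
Context {dd : measure_display} {T : measurableType dd} {R : realType}.
Implicit Types (mu : {measure set T -> \bar R}) (f h : T -> R).

Lemma integrable_dominated mu f h : measurable_fun setT f ->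
  (forall x, `|f x| <= h x) -> mu.-integrable setT (EFin \o h) ->
  mu.-integrable setT (EFin \o f).
Proof.
move=> mf fh ih; apply: (le_integrable measurableT _ _ ih).
  exact/measurable_EFinP.
by move=> x _; rewrite lee_fin (le_trans (fh x)) // ler_norm.
Qed.

Lemma integrable_bounded mu f : (mu setT < +oo)%E -> measurable_fun setT f ->
  (exists M, forall x, `|f x| <= M) -> mu.-integrable setT (EFin \o f).
Proof.
move=> muT mf [M fM]; apply: measurable_bounded_integrable => //.
exists M; split; first exact: num_real.
by move=> y My x _; apply: (le_trans (fM x)); exact: ltW.
Qed.

Lemma norm_Rintegral_le mu f h :
  mu.-integrable setT (EFin \o f) -> mu.-integrable setT (EFin \o h) ->
  (forall x, `|f x| <= h x) ->
  `|\int[mu]_x f x| <= \int[mu]_x h x.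
Proof.
move=> jf jh fh; apply: (le_trans (le_normr_Rintegral measurableT jf)).
apply: le_Rintegral => //.
rewrite (_ : EFin \o _ = abse \o (EFin \o f)) //; exact: integrable_abse.
Qed.

Lemma Rintegral_sum I (s : seq I) mu (f : I -> T -> R) :
  (forall i, mu.-integrable setT (EFin \o f i)) ->
  \int[mu]_x (\sum_(i <- s) f i x) = \sum_(i <- s) \int[mu]_x f i x.
Proof.
move=> jf; elim: s => [|i s IH].
  rewrite big_nil; under eq_Rintegral do rewrite big_nil.
  by rewrite Rintegral_cst // mul0r.
rewrite big_cons -IH -RintegralD //; last first.
  rewrite (_ : EFin \o _ = fun x => \sum_(j <- s) (EFin \o f j) x)%E; last first.
    by apply/funext => x /=; rewrite sumEFin.
  exact: integrable_sum.
by apply: eq_Rintegral => x _; rewrite big_cons.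
Qed.

Lemma integrable_real_sum I (s : seq I) mu (f : I -> T -> R) :
  (forall i, mu.-integrable setT (EFin \o f i)) ->
  mu.-integrable setT (EFin \o (fun x => \sum_(i <- s) f i x)).
Proof.
move=> jf; rewrite (_ : EFin \o _ = fun x => \sum_(j <- s) (EFin \o f j) x)%E; last first.
  by apply/funext => x /=; rewrite sumEFin.
exact: integrable_sum.
Qed.

Lemma integrable_realD mu f h : mu.-integrable setT (EFin \o f) ->
  mu.-integrable setT (EFin \o h) ->
  mu.-integrable setT (EFin \o (fun x => f x + h x)).
Proof. by move=> jf jh; apply: (integrableD measurableT jf jh). Qed.

Lemma integrable_realB mu f h : mu.-integrable setT (EFin \o f) ->
  mu.-integrable setT (EFin \o h) ->
  mu.-integrable setT (EFin \o (fun x => f x - h x)).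
Proof. by move=> jf jh; apply: (integrableB measurableT jf jh). Qed.

Lemma integrable_realZ mu f (k : R) : mu.-integrable setT (EFin \o f) ->
  mu.-integrable setT (EFin \o (fun x => k * f x)).
Proof. by move=> jf; apply: (integrableZl measurableT k jf). Qed.

Lemma Rintegral_cst1 (P : probability T R) (c : R) : \int[P]_x c = c.
Proof.
rewrite Rintegral_cst // -[RHS]mulr1; congr (_ * _).
exact: (congr1 fine (probability_setT P)).
Qed.

Lemma probability_setT_lty (P : probability T R) : (P setT < +oo)%E.
Proof. by rewrite probability_setT ltry. Qed.

Lemma Rintegral_indic mu (A : set T) : measurable A -> \int[mu]_x (\1_A x : R) = fine (mu A).
Proof. by move=> mA; rewrite /Rintegral integral_indic // setIT. Qed.

End real_integrals.

Section pushforward_measures.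
Context {d1 d2 : measure_display} {T1 : measurableType d1} {T2 : measurableType d2}.
Context {R : realType}.
Variables (mu : {measure set T1 -> \bar R}) (phi : T1 -> T2).
Hypothesis mphi : measurable_fun setT phi.

Definition push_measure : {measure set T2 -> \bar R} :=
  measure_function_pushforward__canonical__measure_function_Measure mu mphi.

Lemma push_measureE A : push_measure A = mu (phi @^-1` A).
Proof. by []. Qed.

Lemma Rintegral_push_measure (f : T2 -> R) : measurable_fun setT f ->
  mu.-integrable setT (EFin \o (f \o phi)) ->
  \int[push_measure]_x f x = \int[mu]_x f (phi x).
Proof.
move=> mf jf; rewrite /Rintegral; congr fine.
rewrite (integral_pushforward mphi) ?preimage_setT //.
exact/measurable_EFinP.
Qed.

End pushforward_measures.

Section sums_of_measures.
Context {dd : measure_display} {T : measurableType dd} {R : realType}.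
Variable m : nat -> {measure set T -> \bar R}.
Hypothesis m_lty : forall k, (m k setT < +oo)%E.

Lemma msum_lty n : (msum m n setT < +oo)%E.
Proof. by rewrite /msum; apply: lte_sum_pinfty => k _; exact: m_lty. Qed.

Lemma Rintegral_msum n (f : T -> R) : measurable_fun setT f -> (exists M, forall x, `|f x| <= M) ->
  \int[msum m n]_x f x = \sum_(k < n) \int[m k]_x f x.
Proof.
move=> mf [M fM].
have pos (h : T -> R) : measurable_fun setT h -> (forall x, 0 <= h x) -> (forall x, h x <= 2 * M) ->
    \int[msum m n]_x h x = \sum_(k < n) \int[m k]_x h x.
  move=> mh h0 hM; rewrite /Rintegral ge0_integral_measure_sum //; last 2 first.
  - by move=> x _; rewrite lee_fin.
  - exact/measurable_EFinP.
  rewrite sum_fine // => k _; apply: integrable_fin_num => //.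
  apply: integrable_bounded => //; exists (2 * M) => x.
  by rewrite ger0_norm.
have fb x := lerNnormlW (fM x); have fb' x := ler_normlW (fM x).
have mfM : measurable_fun setT (fun x => f x + M) by apply: measurable_funD.
(* Writing f as (f + M) - M reduces a signed integrand to nonnegative ones, for which additivity in
   the measure holds by [pos]. *)
have e (mu : {measure set T -> \bar R}) : (mu setT < +oo)%E ->
    \int[mu]_x f x = \int[mu]_x (f x + M) - \int[mu]_x M.
  move=> muT; rewrite -RintegralB //.
  - by apply: eq_Rintegral => x _; rewrite addrK.
  - apply: integrable_bounded => //; exists (M + M) => x.
    by apply: (le_trans (ler_normD _ _)); rewrite lerD // ger0_norm // (le_trans _ (fM x)).
  - by apply: integrable_bounded => //; exists `|M|.
rewrite e; last exact: msum_lty.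
rewrite pos //; last 2 first.
- by move=> x; have := fb x; lra.
- by move=> x; have := fb' x; lra.
rewrite [\int[msum m n]_x M]Rintegral_cst //.
under [RHS]eq_bigr => k _ do rewrite (e _ (m_lty k)) [X in _ - X]Rintegral_cst //.
rewrite sumrB; congr (_ - _); rewrite -mulr_sumr; congr (_ * _).
rewrite sum_fine // => k _; rewrite ge0_fin_numE //; exact: m_lty.
Qed.

End sums_of_measures.

Section torus_integrals.
Context {R : realType} {d : nat}.
Implicit Types (mu : {measure set (TB R d) -> \bar R}) (f h : 'rV[R]_d -> R).

Lemma measurable_comp_twrap f : measurable_fun setT (f : TB R d -> R) ->
  measurable_fun setT ((fun x => f (twrap x)) : TB R d -> R).
Proof. by move=> mf; apply: (measurableT_comp mf); exact: measurable_twrap. Qed.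

Lemma ae_twrap mu f : on_torus mu -> ae_eq mu setT (f : TB R d -> R) (fun x => f (twrap x)).
Proof.
move=> mu0; exists (~` @tbox R d); split => //.
  by apply: measurableC; exact: measurable_tbox.
move=> x /= nfx bx; apply: nfx => _; by rewrite twrap_id.
Qed.

Lemma Rintegral_twrap mu f : on_torus mu -> measurable_fun setT (f : TB R d -> R) ->
  tint mu f = tint mu (fun x => f (twrap x)).
Proof.
move=> mu0 mf; rewrite /tint /Rintegral; congr fine.
apply: ae_eq_integral => //.
- exact/measurable_EFinP.
- by apply/measurable_EFinP; exact: measurable_comp_twrap.
- have [N [mN N0 sN]] := ae_twrap f mu0; exists N; split => //.
  by move=> x /= nx; apply: sN => /= h; apply: nx => _; congr EFin; exact: h.
Qed.

Lemma tcontinuous_measurable f : tcontinuous f -> measurable_fun setT (f : TB R d -> R).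
Proof. by move=> [cf _]; exact: continuous_measurable_TB. Qed.

Lemma tcontinuous_bounded f : tcontinuous f -> exists M, forall x, `|f x| <= M.
Proof.
move=> [cf pf].
have cbox : compact [set x : 'rV[R]_d | forall j, `[- pi, pi]%classic (x ord0 j)].
  by apply: (@rV_compact _ _ (fun=> `[- pi, pi]%classic)) => _; exact: segment_compact.
have := continuous_compact (continuous_subspaceT cf) cbox.
move=> /compact_bounded[M [_ /(_ (M + 1))]]; rewrite ltrDl ltr01 => /(_ isT) H.
exists (M + 1) => x; rewrite -pf; apply: H; exists (twrap x) => // j.
by have /andP[h1 h2] := tbox_twrap x j; rewrite /= in_itv /= (ltW h1) h2.
Qed.

Lemma tcontinuous_integrable mu f : (mu setT < +oo)%E -> tcontinuous f ->
  mu.-integrable setT (EFin \o f).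
Proof.
move=> muT cf; apply: integrable_bounded => //; first exact: tcontinuous_measurable.
exact: tcontinuous_bounded.
Qed.

End torus_integrals.

                                    

(** * Uniform continuity of periodic functions *)

Section uniform_continuity.
Context {R : realType} {d : nat}.
Implicit Types (f h : 'rV[R]_d -> R) (x y : 'rV[R]_d).

Lemma tcontinuous_uniform f eta : tcontinuous f -> 0 < eta ->
  exists2 delta : R, 0 < delta &
    forall x y, (forall j, `|x ord0 j - y ord0 j| < delta) -> `|f x - f y| < eta.
Proof.
move=> [cf pf] eta0.
pose K : set 'rV[R]_d := [set x | forall j, `[- pi, pi]%classic (x ord0 j)].
have cK : compact K.
  by apply: (@rV_compact _ _ (fun=> `[- pi, pi]%classic)) => _; exact: segment_compact.
pose P (delta : R) x := forall y, (forall j, `|x ord0 j - y ord0 j| < delta) -> `|f x - f y| < eta.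
have [delta d0 HK] : exists2 delta : R, 0 < delta & forall x, K x -> P delta x.
  have /near_covering_withinP := (compact_near_coveringP K).1 cK.
  move=> /(_ R (0^'+) P _) H.
  have : \forall delta \near 0^'+, K `<=` P delta.
    apply: H => x _.
    have /nbhs_ballP[r /= r0 Hr] : nbhs x (f @^-1` ball (f x) (eta / 2)).
      by apply: cf; apply: nbhsx_ballx; rewrite divr_gt0.
    exists (ball x (r / 2), [set delta : R | delta < r / 2]).
      split; first by apply: nbhsx_ballx; rewrite divr_gt0.
      by apply: nbhs_right_lt; rewrite divr_gt0.
    move=> [z delta] [/= xz dr] _ y zy.
    have r2 : 0 < r / 2 by rewrite divr_gt0.
    have hz : ball (f x) (eta / 2) (f z).
      by apply: Hr; apply: le_ball xz; rewrite ler_pdivrMr //; lra.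
    have hy : ball (f x) (eta / 2) (f y).
      apply: Hr; rewrite [r]splitr; apply: ball_triangle xz _.
      split=> // i j; rewrite ord1 /ball /=; exact: lt_trans (zy j) dr.
    rewrite (_ : f z - f y = (f x - f y) - (f x - f z)); last by ring.
    apply: (le_lt_trans (ler_normB _ _)); rewrite [eta]splitr; exact: ltrD.
  move=> [e /= e0 He]; exists (e / 2); first by rewrite divr_gt0.
  apply: He; last by rewrite divr_gt0.
  by rewrite /= sub0r normrN gtr0_norm ?divr_gt0 // ltr_pdivrMr // ltr_pMr // ltr1n.
exists delta => // x y xy.
have -> : f x = f (twrap x) by rewrite pf.
(* The multiples of 2 pi that bring x into the box are added to y as well, so the coordinate
   differences do not change. *)
have -> : f y = f (y + (twrap x - x)).
  rewrite -pf -[RHS]pf; congr f; rewrite addrCA -[RHS]twrapD.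
  by rewrite twrap_twrap twrapD addrCA subrr addr0.
apply: HK => [j|j].
  by have /andP[h1 h2] := tbox_twrap x j; rewrite /= in_itv /= (ltW h1) h2.
rewrite !mxE; have -> : wrap1 (x ord0 j) - (y ord0 j + (wrap1 (x ord0 j) - x ord0 j)) =
  x ord0 j - y ord0 j by ring.
exact: xy.
Qed.

Lemma tcontinuous_modulus f eta : tcontinuous f -> 0 < eta ->
  exists2 C : R, 0 <= C & forall x y, `|f x - f y| <= eta + C * tgauge (x - y).
Proof.
move=> tf eta0; have [delta d0 Hd] := tcontinuous_uniform tf eta0.
have [M fM] := tcontinuous_bounded tf.
have M0 : 0 <= M := le_trans (normr_ge0 _) (fM 0).
(* If some coordinate of x - y, reduced modulo 2 pi, is at least delta in size, then the gauge of x
   - y is at least delta^2 / 12, and this constant lifts the right-hand side to 2 M. *)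
exists (24 * M / delta ^+ 2).
  by rewrite divr_ge0 ?sqr_ge0 // mulr_ge0.
move=> x y.
have C0 : 0 <= 24 * M / delta ^+ 2 * tgauge (x - y).
  by rewrite mulr_ge0 ?tgauge_ge0 // divr_ge0 ?sqr_ge0 // mulr_ge0.
have [small|/existsNP[j /negP]] := pselect (forall j, `|twrap (x - y) ord0 j| < delta).
  have -> : f x = f (twrap (x - y) + y).
    by rewrite -tf.2 -[RHS]tf.2 twrapD subrK.
  rewrite -[leLHS]addr0; apply: lerD => //; apply: ltW; apply: Hd => j.
  by rewrite mxE addrK.
rewrite -leNgt => large.
have : delta ^+ 2 <= 12 * tgauge (x - y).
  rewrite -tgauge_twrap; apply: (@le_trans _ _ (twrap (x - y) ord0 j ^+ 2)).
    by rewrite -[leRHS]real_normK ?num_real // ler_pXn2r // nnegrE // ltW.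
  apply: (le_trans (sqr_le_onem_cos _)); first exact/tbox_le_pi/tbox_twrap.
  by rewrite ler_pM2l // onem_cos_le_tgauge.
move=> hd; have := ler_normB (f x) (f y); have := fM x; have := fM y => h1 h2 h3.
have : 2 * M <= 24 * M / delta ^+ 2 * tgauge (x - y).
  rewrite mulrAC ler_pdivlMr ?exprn_gt0 //.
  have : 0 <= 2 * M * (12 * tgauge (x - y) - delta ^+ 2).
    by rewrite mulr_ge0 ?subr_ge0 // mulr_ge0.
  lra.
lra.
Qed.

End uniform_continuity.

(** * A positive trigonometric kernel and its exact partition of unity *)

Section kernel.
Context {R : realType}.
Implicit Types (t a : R).

                                                                            
(** Cosine polynomials of degree at most N with arbitrary phases. Being closed under the operations
    that build the kernel, they allow exact summation over a grid. *)
Inductive cosdeg (N : nat) : (R -> R) -> Prop :=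
| cosdeg_cos m a : (m <= N)%N -> cosdeg N (fun t => cos (m%:R * t + a))
| cosdegD f h : cosdeg N f -> cosdeg N h -> cosdeg N (fun t => f t + h t)
| cosdegZ c f : cosdeg N f -> cosdeg N (fun t => c * f t).

Lemma cosdeg_mul N f : cosdeg N f -> cosdeg N.+1 (fun t => f t * ((1 + cos t) / 2)).
Proof.
elim=> [m a mN|g h _ IHg _ IHh|c h _ IHh].
(* Multiplication by (1 + cos t)/2 spreads frequency m over m - 1, m and m + 1; for m = 0 the
   frequency -1 is folded into 1 with the phase negated. *)
- rewrite (_ : (fun t => _) = fun t => 2^-1 * cos (m%:R * t + a) +
     (4^-1 * cos (m.+1%:R * t + a) + 4^-1 * (if m is m'.+1 then cos (m'%:R * t + a) else cos (1%:R * t + - a)))).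
    apply: cosdegD; first by apply: cosdegZ; apply: cosdeg_cos; exact: leqW.
    apply: cosdegD; first by apply: cosdegZ; exact: cosdeg_cos.
    apply: cosdegZ; case: m mN => [|m] mN; first exact: cosdeg_cos.
    by apply: cosdeg_cos; rewrite ltnW // leqW.
  apply/funext => t; case: m mN => [|m] mN.
    by rewrite mul0r add0r mul1r cosD [cos (t - a)]cosB; field.
  rewrite (_ : m%:R * t + a = (m.+1%:R * t + a) - t); last by rewrite -[m.+1]addn1 natrD; ring.
  rewrite (_ : m.+2%:R * t + a = (m.+1%:R * t + a) + t); last first.
    by rewrite -[m.+2]addn1 natrD; ring.
  by rewrite cosB [cos (_ + t)]cosD; field.
- rewrite (_ : (fun t => _) = fun t => g t * ((1 + cos t) / 2) + h t * ((1 + cos t) / 2)).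
    exact: cosdegD.
  by apply/funext => t; rewrite mulrDl.
- rewrite (_ : (fun t => _) = fun t => c * (h t * ((1 + cos t) / 2))).
    exact: cosdegZ.
  by apply/funext => t; rewrite -mulrA.
Qed.

Lemma cosdeg_kernel N : cosdeg N (fun t => ((1 + cos t) / 2) ^+ N).
Proof.
elim: N => [|N IH].
  rewrite (_ : (fun t => _) = fun t => cos (0%:R * t + 0)); first exact: cosdeg_cos.
  by apply/funext => t; rewrite mul0r addr0 cos0 expr0.
under eq_fun do rewrite exprSr; exact: cosdeg_mul.
Qed.

(** Multiplied by sin b with b = m pi / M, which is nonzero because 0 < m < M, the sum telescopes,
    and its end terms differ by m full turns. *)
Lemma sum_cos_grid m M a : (0 < m < M)%N ->
  \sum_(k < M) cos (a - m%:R * (2 * pi * k%:R / M%:R)) = 0 :> R.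
Proof.
move=> /andP[m0 mM]; have M0 : (M%:R : R) != 0 by rewrite pnatr_eq0 -lt0n (ltn_trans m0).
pose b : R := m%:R * pi / M%:R.
have sb : sin b != 0.
  apply: lt0r_neq0; apply: sin_gt0_pi; rewrite /b.
  have M0' : (0 : R) < M%:R by rewrite ltr0n (ltn_trans m0).
  apply/andP; split; first by rewrite divr_gt0 // mulr_gt0 ?ltr0n // pi_gt0.
  by rewrite ltr_pdivrMr // mulrC ltr_pM2l ?pi_gt0 // ltr_nat.
apply: (mulIf sb); rewrite mul0r mulr_suml.
pose F k := sin (a + b - 2 * b * k%:R) / 2.
rewrite (eq_bigr (fun k : 'I_M => - (F k.+1 - F k))); last first.
  move=> k _; rewrite /F -[k.+1%:R]natr1.
  rewrite (_ : a - m%:R * (2 * pi * k%:R / M%:R) = a - 2 * b * k%:R); last by rewrite /b; ring.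
  rewrite (_ : a + b - 2 * b * (k%:R + 1) = (a - 2 * b * k%:R) - b); last by ring.
  rewrite (_ : a + b - 2 * b * k%:R = (a - 2 * b * k%:R) + b); last by ring.
  by move: (a - 2 * b * k%:R) => u; rewrite sinB sinD; field.
rewrite sumrN -(big_mkord xpredT (fun k => F k.+1 - F k)) telescope_sumr //.
rewrite /F mulr0 subr0 (_ : 2 * b * M%:R = 2 * pi * m%:R); last by rewrite /b; field.
by rewrite -{2}(subrK (2 * pi * m%:R) (a + b)) sinD2pin subrr oppr0.
Qed.

(** A grid of more than N equally spaced points annihilates all nonzero frequencies, so the grid
    translates of the kernel add up to a constant and can be normalized into a partition of
    unity. *)
Lemma cosdeg_grid N M f : cosdeg N f -> (N < M)%N ->
  exists c : R, forall t, \sum_(k < M) f (t - 2 * pi * k%:R / M%:R) = c.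
Proof.
move=> cf NM; elim: cf => [[|m] a mN|g h _ [c1 IHg] _ [c2 IHh]|c h _ [c1 IHh]].
- exists (\sum_(k < M) cos a) => t; apply: eq_bigr => k _.
  by rewrite mul0r add0r.
- exists 0 => t; rewrite -[RHS](@sum_cos_grid m.+1 M (m.+1%:R * t + a)).
    by apply: eq_bigr => k _; congr cos; ring.
  by rewrite /= (leq_ltn_trans mN).
- by exists (c1 + c2) => t; rewrite big_split /= IHg IHh.
- by exists (c * c1) => t; rewrite -mulr_sumr IHh.
Qed.

Lemma bernoulli_ge (k : R) m : 0 <= k -> 1 + m%:R * k <= (1 + k) ^+ m.
Proof.
move=> k0; elim: m => [|m IH]; first by rewrite mul0r addr0 expr0.
rewrite exprS -natr1; have : 0 <= m%:R * k * k by rewrite !mulr_ge0.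
have : (1 + k) * (1 + m%:R * k) <= (1 + k) * (1 + k) ^+ m by rewrite ler_pM2l //; lra.
lra.
Qed.

Lemma geometric_beats_linear (k : R) : 0 < k < 1 ->
  exists N : nat, N.+1%:R * (1 - k) ^+ N <= k.
Proof.
(* Bernoulli gives (1 - k)^m <= 1/(m k). Squaring, (2m + 1)(1 - k)^(2m) <= 3/(m k^2), which m >
   4/k^3 brings below k. *)
move=> /andP[k0 k1]; pose m := (Num.truncn (4 / k ^+ 3)).+1.
have m1 : 4 / k ^+ 3 < m%:R by exact: truncnS_gt.
exists (2 * m)%N; rewrite mulnC exprM.
have pm : 0 < m%:R :> R by rewrite ltr0n.
have h1 : (1 - k) ^+ m * (1 + m%:R * k) <= 1.
  apply: (@le_trans _ _ ((1 - k) ^+ m * (1 + k) ^+ m)).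
    by apply: ler_wpM2l; [apply: exprn_ge0; lra|apply: bernoulli_ge; exact: ltW].
  rewrite -exprMn; apply: exprn_ile1; nra.
have mk : 4 < m%:R * k ^+ 3 by move: m1; rewrite ltr_pdivrMr // exprn_gt0.
have q0 : 0 <= (1 - k) ^+ m by apply: exprn_ge0; lra.
move: ((1 - k) ^+ m) q0 h1 => q q0 h1.
have -> : (m * 2).+1%:R = 2 * m%:R + 1 :> R by rewrite -natr1 natrM mulrC.
have m1' : 1 <= m%:R :> R by rewrite ler1n.
move: (m%:R : R) pm m1' h1 mk => u u0 u1 h1 mk.
have quk : q * (u * k) <= 1 by nra.
have h2 : (q * (u * k)) ^+ 2 <= 1 by rewrite expr_le1 // !mulr_ge0 // ltW.
have h3 : (2 * u + 1) * q ^+ 2 * (u * k ^+ 3) <= 3 * k * (q * (u * k)) ^+ 2.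
  have -> : 3 * k * (q * (u * k)) ^+ 2 = (3 * u) * q ^+ 2 * (u * k ^+ 3) by ring.
  apply: ler_wpM2r; first by rewrite mulr_ge0 ?exprn_ge0 // ltW.
  by apply: ler_wpM2r; [exact: sqr_ge0|lra].
have h4 : 0 <= (2 * u + 1) * q ^+ 2 by rewrite mulr_ge0 ?sqr_ge0 //; lra.
nra.
Qed.

                                                                                                     
                                                            
(** The weights are normalized grid translates of ((1 + cos t)/2)^N. They concentrate: with q = (1 +
    cos u)/2 and 1 - cos u = 2 (1 - q), either 1 - q <= kap, or the kernel is at most (1 - kap)^N,
    which stays below kap even after summing over the N + 1 grid points. *)
Lemma kernel_weights (kap : R) : 0 < kap < 1 ->
  exists M : nat, exists y : 'I_M -> R, exists2 w : 'I_M -> R -> R,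
   (forall k, exists c N, forall t, w k t = c * ((1 + cos (t - y k)) / 2) ^+ N) &
   [/\ (forall k t, 0 <= w k t), (forall t, \sum_k w k t = 1) &
     forall t, \sum_k w k t * (1 - cos (t - y k)) <= 4 * kap].
Proof.
move=> kap01; have [N HN] := geometric_beats_linear kap01.
pose M := N.+1; pose y (k : 'I_M) : R := 2 * pi * k%:R / M%:R.
pose K t : R := ((1 + cos t) / 2) ^+ N.
have q0 t : 0 <= (1 + cos t) / 2 by have := cos_geN1 t; lra.
have q1 t : (1 + cos t) / 2 <= 1 by have := cos_le1 t; lra.
have K0 t : 0 <= K t by exact: exprn_ge0.
have [W HW] : exists c : R, forall t, \sum_(k < M) K (t - y k) = c.
  exact: (cosdeg_grid (cosdeg_kernel N)).
(* At t = 0 the grid point y_0 = 0 alone contributes 1. *)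
have W1 : 1 <= W.
  rewrite -(HW 0) (bigD1 ord0) //= /y mulr0 mul0r subr0.
  rewrite {1}/K cos0 (_ : (1 + 1) / 2 = 1) ?expr1n ?lerDl ?sumr_ge0 //; first by field.
have W0 : 0 < W by lra.
exists M, y, (fun k t => W^-1 * K (t - y k)).
  by move=> k; exists W^-1, N.
split=> [k t|t|t].
- by rewrite mulr_ge0 // invr_ge0 ltW.
- by rewrite -mulr_sumr HW mulVf // gt_eqF.
rewrite (eq_bigr (fun k => W^-1 * (K (t - y k) * (1 - cos (t - y k))))); last first.
  by move=> k _; rewrite mulrA.
rewrite -mulr_sumr mulrC ler_pdivrMr //.
apply: (@le_trans _ _ (\sum_(k < M) (2 * kap * K (t - y k) + 2 * (1 - kap) ^+ N))).
  apply: ler_sum => k _; move: (t - y k) => u; rewrite /K.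
  have -> : 1 - cos u = 2 * (1 - (1 + cos u) / 2) by field.
  move: ((1 + cos u) / 2) (q0 u) (q1 u) => q qq0 qq1.
  have /andP[k0 k1] := kap01.
  have [qk|kq] := lerP (1 - q) kap.
    have hq : 0 <= q ^+ N by exact: exprn_ge0.
    have : 0 <= (1 - kap) ^+ N by apply: exprn_ge0; lra.
    have := ler_wpM2l hq qk; lra.
  have : q ^+ N <= (1 - kap) ^+ N by apply: lerXn2r; rewrite ?nnegrE; lra.
  have hq : 0 <= q ^+ N by exact: exprn_ge0.
  have : 0 <= kap * q ^+ N by rewrite mulr_ge0 // ltW.
  have : q ^+ N * (1 - q) <= q ^+ N * 1 by apply: ler_wpM2l => //; lra.
  lra.
rewrite big_split /= -mulr_sumr HW sumr_const card_ord -[X in _ + X <= _]mulr_natl.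
have /andP[k0 k1] := kap01; move: HN; rewrite -/M.
have : kap <= kap * W by rewrite ler_peMr // ltW.
move: (_ ^+ N) (M%:R : R) => A B; lra.
Qed.

End kernel.

(** * Density of trigonometric polynomials and the continuity theorem *)

Section trig_approximation.
Context {R : realType} {d : nat}.
Implicit Types (f h : 'rV[R]_d -> R) (p : 'rV[int]_d).

Inductive trigp : ('rV[R]_d -> R) -> Prop :=
| trigp_cos p a : trigp (fun x => cos (ipair p x + a))
| trigpD f h : trigp f -> trigp h -> trigp (fun x => f x + h x)
| trigpZ c f : trigp f -> trigp (fun x => c * f x).

Lemma trigp_cst c : trigp (fun _ => c).
Proof.
rewrite (_ : (fun _ => _) = fun x : 'rV[R]_d => c * cos (ipair 0 x + 0)).
  by apply: trigpZ; exact: trigp_cos.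
apply/funext => x; rewrite /ipair big1 ?addr0 ?cos0 ?mulr1 // => j _.
by rewrite mxE mul0r.
Qed.

Lemma trigp_sum I (s : seq I) (f : I -> 'rV[R]_d -> R) :
  (forall i, trigp (f i)) -> trigp (fun x => \sum_(i <- s) f i x).
Proof.
move=> tf; elim: s => [|i s IH].
  by under eq_fun do rewrite big_nil; exact: trigp_cst.
by under eq_fun do rewrite big_cons; apply: trigpD.
Qed.

Lemma ipairDl p q (x : 'rV[R]_d) : ipair (p + q) x = ipair p x + ipair q x.
Proof.
by rewrite /ipair -big_split; apply: eq_bigr => j _ /=; rewrite mxE intrD mulrDl.
Qed.

Lemma ipairNl p (x : 'rV[R]_d) : ipair (- p) x = - ipair p x.
Proof.
by rewrite /ipair -sumrN; apply: eq_bigr => j _ /=; rewrite mxE mulrNz mulNr.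
Qed.

Lemma trigpM f h : trigp f -> trigp h -> trigp (fun x => f x * h x).
Proof.
move=> tf th; elim: tf => [p a|f1 f2 _ IH1 _ IH2|c f1 _ IH1].
- elim: th => [q b|h1 h2 _ IH1 _ IH2|c h1 _ IH1].
  + rewrite (_ : (fun x => _) = fun x => 2^-1 * cos (ipair (p + q) x + (a + b)) +
       2^-1 * cos (ipair (p - q) x + (a - b))).
      by apply: trigpD; apply: trigpZ; exact: trigp_cos.
    apply/funext => x; rewrite !ipairDl ipairNl.
    rewrite (_ : _ + _ + (a + b) = (ipair p x + a) + (ipair q x + b)); last by ring.
    rewrite (_ : _ - _ + (a - b) = (ipair p x + a) - (ipair q x + b)); last by ring.
    move: (ipair p x + a) (ipair q x + b) => u v.
    by rewrite cosD cosB; field.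
  + by under eq_fun do rewrite mulrDr; exact: trigpD.
  + by under eq_fun do rewrite mulrCA; exact: trigpZ.
- by under eq_fun do rewrite mulrDl; exact: trigpD.
- by under eq_fun do rewrite -mulrA; exact: trigpZ.
Qed.

Lemma trigpX f n : trigp f -> trigp (fun x => f x ^+ n).
Proof.
move=> tf; elim: n => [|n IH]; first by under eq_fun do rewrite expr0; exact: trigp_cst.
by under eq_fun do rewrite exprS; exact: trigpM.
Qed.

Lemma trigp_prod I (s : seq I) (f : I -> 'rV[R]_d -> R) :
  (forall i, trigp (f i)) -> trigp (fun x => \prod_(i <- s) f i x).
Proof.
move=> tf; elim: s => [|i s IH].
  by under eq_fun do rewrite big_nil; exact: trigp_cst.
by under eq_fun do rewrite big_cons; apply: trigpM.
Qed.

Definition zdelta (j : 'I_d) : 'rV[int]_d := delta_mx ord0 j.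

Lemma ipair_zdelta j (x : 'rV[R]_d) : ipair (zdelta j) x = x ord0 j.
Proof.
rewrite /ipair (bigD1 j) //= mxE !eqxx mul1r big1 ?addr0 // => i ij.
by rewrite mxE eqxx (negbTE ij) mul0r.
Qed.

Lemma trigp_coord j a : trigp (fun x => cos (x ord0 j + a)).
Proof. by under eq_fun do rewrite -ipair_zdelta; exact: trigp_cos. Qed.

Lemma trigp_tcontinuous f : trigp f -> tcontinuous f.
Proof.
elim=> [p a|f1 f2 _ t1 _ t2|c f1 _ t1].
- under eq_fun do rewrite cosD; apply: tcontinuousD; last apply: tcontinuousN;
    apply: tcontinuousM; [exact: tcontinuous_cos|exact: tcontinuous_cst|
      exact: tcontinuous_sin|exact: tcontinuous_cst].
- exact: tcontinuousD.
- by apply: tcontinuousM => //; exact: tcontinuous_cst.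
Qed.

(** Averaging the values of f at the points of a product grid with the product weights gives a
    trigonometric polynomial. By [tcontinuous_modulus] the error is at most eta/2 plus C times the
    mean gauge distance to the grid points, which the choice of [kap] makes at most eta/2. *)
Lemma trig_approx f eta : tcontinuous f -> 0 < eta ->
  exists2 h, trigp h & forall x, `|f x - h x| <= eta.
Proof.
move=> tf eta0; have eta2 : 0 < eta / 2 by rewrite divr_gt0.
have [C C0 HC] := tcontinuous_modulus tf eta2.
pose kap : R := Num.min (1 / 2) (eta / 2 / (4 * (C * d%:R + 1))).
have Cd : 0 <= C * d%:R by rewrite mulr_ge0.
have kap01 : 0 < kap < 1.
  rewrite lt_min gt_min divr_gt0 //= divr_gt0 ?mulr_gt0 //; last by lra.
  by apply/orP; left; lra.
have kapC : C * d%:R * (4 * kap) <= eta / 2.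
  have : kap <= eta / 2 / (4 * (C * d%:R + 1)) by rewrite ge_min lexx orbT.
  rewrite ler_pdivlMr; last by lra.
  move: (C * d%:R) Cd => u; have /andP[] := kap01; nra.
have [M [y [w wE [w0 w1 wk]]]] := kernel_weights kap01.
pose ys (s : {ffun 'I_d -> 'I_M}) : 'rV[R]_d := \row_j y (s j).
pose ws (s : {ffun 'I_d -> 'I_M}) (x : 'rV[R]_d) := \prod_j w (s j) (x ord0 j).
have ws0 s x : 0 <= ws s x by apply: prodr_ge0 => j _; exact: w0.
have ws1 x : \sum_s ws s x = 1.
  rewrite /ws -(bigA_distr_bigA (fun j k => w k (x ord0 j))) big1 // => j _; exact: w1.
have wsk x : \sum_s ws s x * tgauge (x - ys s) <= d%:R * (4 * kap).
  rewrite (eq_bigr (fun s => \sum_j ws s x * (1 - cos (x ord0 j - y (s j))))); last first.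
    move=> s _; rewrite /tgauge mulr_sumr; apply: eq_bigr => j _.
    by rewrite !mxE.
  rewrite exchange_big /=.
  have -> : d%:R * (4 * kap) = \sum_(j < d) (4 * kap) by rewrite sumr_const card_ord mulr_natl.
  apply: ler_sum => j _.
  (* Only coordinate j carries the extra factor 1 - cos. Distributing the sum over s across the
     product turns every other coordinate into a sum of weights, equal to 1. *)
  pose G i k := if i == j then w k (x ord0 i) * (1 - cos (x ord0 i - y k)) else w k (x ord0 i).
  rewrite (eq_bigr (fun s : {ffun 'I_d -> 'I_M} => \prod_i G i (s i))); last first.
    move=> s _; rewrite /ws (bigD1 j) //= [RHS](bigD1 j) //= [X in _ = X * _]/G eqxx mulrAC.
    by congr (_ * _); apply: eq_bigr => i /negbTE ij; rewrite /G ij.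
  rewrite -(bigA_distr_bigA G) (bigD1 j) //= [X in _ * X]big1 ?mulr1; last first.
    by move=> i ij; rewrite /G (negbTE ij) w1.
  by under eq_bigr do rewrite /G eqxx.
exists (fun x => \sum_s f (ys s) * ws s x).
  apply: trigp_sum => s; apply: trigpZ; apply: trigp_prod => j.
  have [c [N cE]] := wE (s j); under eq_fun do rewrite cE.
  apply: trigpZ; apply: trigpX; under eq_fun do rewrite mulrC.
  by apply: trigpZ; apply: trigpD; [exact: trigp_cst|exact: trigp_coord].
move=> x; have -> : f x - \sum_s f (ys s) * ws s x = \sum_s (f x - f (ys s)) * ws s x.
  rewrite -[X in X - _]mulr1 -(ws1 x) mulr_sumr -sumrB.
  by apply: eq_bigr => s _; rewrite mulrBl.
apply: (le_trans (ler_norm_sum _ _ _)).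
apply: (@le_trans _ _ (\sum_s (eta / 2 * ws s x + C * (ws s x * tgauge (x - ys s))))).
  apply: ler_sum => s _; rewrite normrM (ger0_norm (ws0 s x)).
  have := ler_wpM2r (ws0 s x) (HC x (ys s)); lra.
rewrite big_split /= -!mulr_sumr ws1 mulr1.
have := ler_wpM2l C0 (wsk x); lra.
Qed.

(** What is retained of integration against a probability: linearity, and contraction in the uniform
    norm. The convolutions occur only as iterated integrals [iconv], and this notion lets the
    continuity theorem apply to them without a convolution measure. *)
Definition tmean (L : ('rV[R]_d -> R) -> R) :=
  [/\ forall f h, tcontinuous f -> tcontinuous h -> L (fun x => f x + h x) = L f + L h,
      forall c f, tcontinuous f -> L (fun x => c * f x) = c * L f &
      forall f h eta, tcontinuous f -> tcontinuous h ->
        (forall x, `|f x - h x| <= eta) -> `|L f - L h| <= eta].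

Lemma tmean_cvg (L : nat -> ('rV[R]_d -> R) -> R) (L0 : ('rV[R]_d -> R) -> R) :
  (forall n, tmean (L n)) -> tmean L0 ->
  (forall p, (fun n => L n (fun x => cos (ipair p x))) @ \oo --> L0 (fun x => cos (ipair p x))) ->
  (forall p, (fun n => L n (fun x => sin (ipair p x))) @ \oo --> L0 (fun x => sin (ipair p x))) ->
  forall f, tcontinuous f -> (fun n => L n f) @ \oo --> L0 f.
Proof.
move=> mL mL0 cosL sinL.
have Htrig h : trigp h -> (fun n => L n h) @ \oo --> L0 h.
  elim=> [p a|f1 f2 t1 IH1 t2 IH2|c f1 t1 IH1].
  - have e (F : ('rV[R]_d -> R) -> R) : tmean F -> F (fun x => cos (ipair p x + a)) =
       cos a * F (fun x => cos (ipair p x)) + (- sin a) * F (fun x => sin (ipair p x)).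
      move=> [FD FZ _].
      have tc := tcontinuous_cos (R := R) p; have ts := tcontinuous_sin (R := R) p.
      rewrite -!FZ // -FD; last 2 first.
      + by apply: tcontinuousM => //; exact: tcontinuous_cst.
      + by apply: tcontinuousM => //; exact: tcontinuous_cst.
      by congr F; apply/funext => x; rewrite cosD; ring.
    under eq_fun do rewrite e //; rewrite e //.
    by apply: cvgD; apply: cvgMr.
  - have tc1 := trigp_tcontinuous t1; have tc2 := trigp_tcontinuous t2.
    case: (mL0) => FD _ _; rewrite FD //.
    rewrite (_ : (fun n => _) = fun n => L n f1 + L n f2); first exact: cvgD.
    by apply/funext => n; case: (mL n) => -> //.
  - have tc1 := trigp_tcontinuous t1.
    case: (mL0) => _ FZ _; rewrite FZ //.
    rewrite (_ : (fun n => _) = fun n => c * L n f1); first exact: cvgMr.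
    by apply/funext => n; case: (mL n) => _ -> //.
move=> f tf; apply/cvgrPdist_le => e e0; have e3 : 0 < e / 3 by rewrite divr_gt0.
have [h th fh] := trig_approx tf e3; have tch := trigp_tcontinuous th.
have /cvgrPdist_le/(_ _ e3) := Htrig h th.
apply: filterS => n Hn; case: (mL0) => _ _ B0; case: (mL n) => _ _ Bn.
have h1 := B0 f h _ tf tch fh; have h2 := Bn f h _ tf tch fh.
rewrite (_ : L0 f - L n f = (L0 f - L0 h) + (L0 h - L n h) - (L n f - L n h)); last by ring.
apply: (le_trans (ler_normB _ _)); apply: (le_trans (lerD (ler_normD _ _) (lexx _))); lra.
Qed.

End trig_approximation.

                         

(** * Extraction of subsequences *)

Section extraction.

Lemma extract_subsequence (P : nat -> nat -> Prop) :
  (forall m N, exists2 n, (m <= n)%N & P N n) ->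
  exists2 psi : nat -> nat, {homo psi : m n / (m < n)%N} & forall N, P N (psi N).
Proof.
move=> H; have /choice[h hP] : forall mN : nat * nat, exists n, (mN.1 <= n)%N /\ P mN.2 n.
  by move=> [m N]; have [n mn Pn] := H m N; exists n.
pose psi := fix psi N := if N is N'.+1 then h ((psi N').+1, N) else h (0%N, 0%N).
exists psi; last by case=> [|N] /=; [case: (hP (0%N, 0%N))|case: (hP ((psi N).+1, N.+1))].
by apply: homo_ltn => [x y z|N] /=; [exact: ltn_trans|case: (hP ((psi N).+1, N.+1))].
Qed.

Lemma homo_ltn_ge (psi : nat -> nat) : {homo psi : m n / (m < n)%N} -> forall n, (n <= psi n)%N.
Proof.
move=> hpsi; elim=> // n IH; apply: (leq_ltn_trans IH); exact: hpsi.
Qed.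

Lemma cvg_subsequence (T : topologicalType) (u : nat -> T) (l : T) (psi : nat -> nat) :
  {homo psi : m n / (m < n)%N} -> u @ \oo --> l -> (u \o psi) @ \oo --> l.
Proof.
move=> hpsi ul A /ul[N _ NA]; exists N => // n /= Nn; apply: NA => /=.
exact: leq_trans Nn (homo_ltn_ge hpsi n).
Qed.

(** The cube [-M, M]^I is compact by Tychonoff, so the sequence has a cluster point c. The
    neighbourhood [V N] fixes the coordinates with code at most N within 1/(N+1); a subsequence
    whose N-th term lies in [V N] converges in every coordinate. *)
Lemma diagonal_subsequence {R : realType} (I : countType) (u : nat -> I -> R) (M : R) :
  (forall n i, `|u n i| <= M) ->
  exists2 psi : nat -> nat, {homo psi : m n / (m < n)%N} &
    exists c : I -> R, forall i, (fun n => u (psi n) i) @ \oo --> c i.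
Proof.
move=> uM.
pose K : set (prod_topology (fun _ : I => R)) := [set f | forall i, `[- M, M]%classic (f i)].
have cK : compact K.
  by apply: (@tychonoff I (fun=> R) (fun=> `[- M, M]%classic)) => i; exact: segment_compact.
pose U (n : nat) : prod_topology (fun _ : I => R) := u n.
have FK : (U @ \oo) K.
  by exists 0%N => // n _ i; rewrite /= in_itv /= -ler_norml uM.
have [c [_ clc]] := cK (U @ \oo) _ FK.
pose V N : set (prod_topology (fun _ : I => R)) :=
  \bigcap_(k in `I_N.+1) (if unpickle k is Some i then [set f | `|c i - f i| < N.+1%:R^-1] else setT).
have nV N : nbhs c (V N).
  rewrite /V bigcap_mkord.
  elim/big_ind: _ => [|A B|k _]; [exact: filterT|exact: filterI|].
  case: (unpickle k) => [i|]; last exact: filterT.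
  apply: (@proj_continuous I (fun=> R : topologicalType) i c (ball (c i) N.+1%:R^-1)).
  by apply: nbhsx_ballx; rewrite invr_gt0.
have [psi hpsi psiV] : exists2 psi : nat -> nat, {homo psi : m n / (m < n)%N} &
    forall N, V N (U (psi N)).
  apply: (@extract_subsequence (fun N n => V N (U n))) => m N.
  have FA : (U @ \oo) [set f | exists2 n, (m <= n)%N & f = U n].
    by exists m => // n /= mn; exists n.
  by have [f [[n mn ->] Vf]] := clc _ _ FA (nV N); exists n.
exists psi => //; exists c => i; apply/cvgrPdist_lt => e e0.
pose N := maxn (pickle i) (Num.truncn (e^-1)).
exists N => // n /= Nn; have := psiV n (pickle i).
rewrite pickleK /= => /(_ _) h; apply: (lt_trans (h _)).
  by rewrite ltnS (leq_trans _ Nn) // leq_maxl.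
rewrite invf_plt ?posrE //; apply: lt_le_trans (truncnS_gt _) _.
by rewrite ler_nat ltnS (leq_trans _ Nn) // leq_maxr.
Qed.

End extraction.

(** * Binary codes of torus points and of the interval *)

Section codes.
Context {T : Type}.
Implicit Types (bit : seq bool -> T -> bool).

                                                                                                  
                    
(** The newest bit comes first, and each test sees the bits already found. That dependence is what
    makes nested interval subdivisions expressible. *)
Fixpoint code bit N x : seq bool :=
  if N is N'.+1 then bit (code bit N' x) x :: code bit N' x else [::].

Lemma size_code bit N x : size (code bit N x) = N.
Proof. by elim: N => //= N ->. Qed.

Lemma code_sum {R : realType} bit N x (F : seq bool -> R) :
  F (code bit N x) = \sum_(w : N.-tuple bool) F w * (code bit N x == w)%:R.
Proof.
have sN : size (code bit N x) == N by rewrite size_code.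
rewrite (bigD1 (Tuple sN)) //= eqxx mulr1 big1 ?addr0 // => w wx.
case: eqP => [e|_]; last by rewrite mulr0.
by case/negP: wx; apply/eqP/val_inj; rewrite /= e.
Qed.

End codes.

Lemma code_le {T1 T2 : Type} (bit1 : seq bool -> T1 -> bool) (bit2 : seq bool -> T2 -> bool)
    N N0 x y : (N0 <= N)%N -> code bit1 N x = code bit2 N y -> code bit1 N0 x = code bit2 N0 y.
Proof.
move=> /subnK <-; elim: (N - N0)%N => // k IH /= [_]; exact: IH.
Qed.

Lemma measurable_code {dd : measure_display} {T : measurableType dd} {R : realType}
    (bit : seq bool -> T -> bool) N (F : seq bool -> T -> R) :
  (forall w, measurable_fun setT (bit w)) -> (forall w, measurable_fun setT (F w)) ->
  measurable_fun setT (fun x => F (code bit N x) x).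
Proof.
move=> mbit; elim: N F => [|N IH] F mF //=.
pose F' w x := if bit w x then F (true :: w) x else F (false :: w) x.
rewrite (_ : (fun x => _) = fun x => F' (code bit N x) x).
  by apply: IH => w; apply: measurable_fun_ifT.
by apply/funext => x; rewrite /F'; case: (bit _ x).
Qed.

Section torus_code.
Context {R : realType} {d : nat}.
Implicit Types (x y : 'rV[R]_d).

(** The test of rank n compares one coordinate with one rational, the pair being decoded from n;
    every such comparison is made at some rank. *)
Definition tbit (w : seq bool) x : bool :=
  if unpickle (size w) is Some (j, q) then twrap x ord0 j < ratr (q : rat) else false.

Lemma measurable_tbit w : measurable_fun setT (tbit w : TB R d -> bool).
Proof.
rewrite /tbit; case: unpickle => [[j q]|] //; apply: measurable_fun_ltr => //.
rewrite (_ : (fun x => _) = (fun x : TB R d => (x : 'rV[R]_d) ord0 j) \o (@twrap R d)) //.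
apply: (@measurableT_comp _ _ _ (TB R d) (TB R d)); first exact: measurable_coord.
exact: measurable_twrap.
Qed.

Lemma tcode_close (delta : R) : 0 < delta -> exists N, forall x y,
  code tbit N x = code tbit N y ->
  forall j, `|twrap x ord0 j - twrap y ord0 j| < delta.
Proof.
move=> d0; pose m := (Num.truncn (1 / delta)).+1.
have md : m%:R^-1 < delta.
  rewrite invf_plt ?posrE ?ltr0n // -div1r; exact: truncnS_gt.
have m0 : (0 : R) < m%:R by rewrite ltr0n.
(* A grid of step 1/m on [-4, 4], which contains [-pi, pi]. Coordinates at distance at least 1/m are
   separated by a grid point, and N exceeds the rank of every test involving the grid. *)
pose q (k : nat) : rat := (k%:R - (4 * m)%:R) / m%:R.
pose N := (\max_(j < d) \max_(k < (8 * m).+1) (pickle (j, q k))).+1.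
exists N.
have key (x y : 'rV[R]_d) j : code tbit N x = code tbit N y ->
    twrap x ord0 j + m%:R^-1 <= twrap y ord0 j -> False.
  move=> e xy; pose t := twrap y ord0 j.
  have [pi4 p0] : (pi : R) < 4 /\ 0 < (pi : R).
    by split; [have := @pihalf_lt2 R; lra|exact: pi_gt0].
  have /andP[t1 t2] : - pi < t <= pi by exact: tbox_twrap.
  pose k := Num.truncn (m%:R * (t + 4)).
  have k0 : 0 <= m%:R * (t + 4) by rewrite mulr_ge0 //; lra.
  have /andP[k1 k2] := truncn_itv k0.
  have k8 : (k < (8 * m).+1)%N.
    rewrite ltnS -(ler_nat R); apply: (le_trans k1).
    rewrite natrM mulrC ler_pM2r //; lra.
  have qE : ratr (q k) = k%:R / m%:R - 4 :> R.
    rewrite /q fmorph_div rmorphB /= !ratr_nat natrM.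
    by field; rewrite gt_eqF.
  have q1 : ratr (q k) <= t.
    rewrite qE lerBlDr ler_pdivrMr // mulrC; exact: k1.
  have q2 : t - m%:R^-1 < ratr (q k).
    rewrite qE ltrBrDr ltr_pdivlMr //.
    have : (t - m%:R^-1 + 4) * m%:R = m%:R * (t + 4) - 1 by field; rewrite gt_eqF.
    move=> ->; rewrite ltrBlDr natr1; exact: k2.
  pose i := pickle (j, q k).
  have iN : (i.+1 <= N)%N.
    rewrite ltnS; apply: leq_trans (leq_bigmax j).
    exact: (leq_bigmax (Ordinal k8)).
  have := code_le iN e; rewrite /= => -[+ _].
  rewrite /tbit !size_code /i pickleK.
  rewrite (_ : twrap x ord0 j < _ = true); last first.
    by apply: le_lt_trans q2; rewrite lerBrDr.
  by move/esym; rewrite ltNge q1.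
move=> x y e j; rewrite ltNge; apply/negP => /(lt_le_trans md) h.
have [xy|xy] := lerP (twrap x ord0 j) (twrap y ord0 j).
  apply: (key x y j e); move: h; rewrite ler0_norm ?subr_le0 // opprB => h.
  by rewrite addrC -lerBrDr ltW.
apply: (key y x j (esym e)); move: h; rewrite gtr0_norm ?subr_gt0 // => h.
by rewrite addrC -lerBrDr ltW.
Qed.

End torus_code.

Section lebesgue_code.
Context {R : realType}.
Variable m : seq bool -> R.
Hypothesis m_ge0 : forall w, 0 <= m w.
Hypothesis m_split : forall w, m w = m (true :: w) + m (false :: w).

                                                                                                    
                                             
(** Left end of the interval of length m w attached to w when [0, m [::]) is subdivided, the [false]
    part lying to the left of the [true] part. *)
Fixpoint lend (w : seq bool) : R :=
  if w is b :: w' then lend w' + (if b then m (false :: w') else 0) else 0.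

Definition lbit (w : seq bool) (u : R) : bool := lend w + m (false :: w) <= u.

Lemma measurable_lbit w : measurable_fun setT (lbit w).
Proof. by apply: measurable_fun_ler. Qed.

Lemma code_lbitE w (u : R) : 0 <= u < m [::] ->
  (code lbit (size w) u == w) = (lend w <= u < lend w + m w).
Proof.
move=> um; elim: w => [|b w IH] /=; first by rewrite add0r um.
rewrite eqseq_cons; have [e|ne] := eqVneq (code lbit (size w) u) w; last first.
  rewrite andbF; move: IH; rewrite (negbTE ne) => /esym/negbT h.
  apply/esym/negbTE; apply: contra h.
  have := m_ge0 (true :: w); have := m_ge0 (false :: w); rewrite (m_split w).
  by case: b; lra.
move: IH; rewrite e eqxx andbT => /esym/andP[h1 h2]; rewrite /lbit.
rewrite (m_split w) in h2; case: b; rewrite ?eqb_id ?eqbF_neg.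
  by apply/idP/idP => h; lra.
by rewrite -ltNge; apply/idP/idP => h; lra.
Qed.

Lemma lend_bounds w : 0 <= lend w /\ lend w + m w <= m [::].
Proof.
elim: w => [|b w [h1 h2]] /=; first by rewrite add0r.
have := m_ge0 (true :: w); have := m_ge0 (false :: w); rewrite (m_split w) in h2.
by case: b; split; lra.
Qed.

Definition lmass : {measure set (measurableTypeR R) -> \bar R} :=
  mrestr (@lebesgue_measure R) (@measurable_itv R `[0, m [::][).

Lemma lmass_code w : fine (lmass [set u | code lbit (size w) u == w]) = m w.
Proof.
have [l0 l1] := lend_bounds w.
rewrite /lmass /= /mrestr /=.
rewrite (_ : _ `&` _ = `[lend w, lend w + m w[%classic); last first.
  apply/seteqP; split=> u /=; rewrite !in_itv /=.
    by move=> [h um]; rewrite -code_lbitE.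
  move=> h; have um : 0 <= u < m [::] by lra.
  by split => //; rewrite code_lbitE.
rewrite lebesgue_measure_itv /= lte_fin.
have := m_ge0 w; rewrite le_eqVlt => /predU1P[<-|mw].
  by rewrite addr0 ltxx.
by rewrite ltrDl mw /= addrAC subrr add0r.
Qed.

Lemma lmass_setT : lmass setT = (m [::])%:E.
Proof.
rewrite /lmass /= /mrestr /= setTI lebesgue_measure_itv /= lte_fin.
have := m_ge0 [::]; rewrite le_eqVlt => /predU1P[<-|mw]; first by rewrite ltxx.
by rewrite mw oppr0 adde0.
Qed.

End lebesgue_code.

(** * Weak compactness of bounded measures on the torus *)

Section helly.
Context {R : realType} {d : nat}.
Implicit Types (f : 'rV[R]_d -> R).

Lemma measurable_code_ind {dd : measure_display} {T : measurableType dd}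
    (bit : seq bool -> T -> bool) N w : (forall v, measurable_fun setT (bit v)) ->
  measurable_fun setT (fun x => (code bit N x == w)%:R : R).
Proof.
by move=> mbit; apply: (@measurable_code _ _ _ bit N (fun v _ => (v == w)%:R)).
Qed.

                                                                                               
                                                                      
(** The measure is the image of Lebesgue measure on [0, m [::]). A point u reads off words of
    positive mass, each of which is the code of some torus point; the chosen representatives form a
    Cauchy sequence by [tcode_close], and u is sent to their limit. Only integrals of continuous
    functions are matched, so mass accumulating on cell boundaries is harmless. *)
Lemma measure_of_masses (m : seq bool -> R) : (forall w, 0 <= m w) ->
  (forall w, m w = m (true :: w) + m (false :: w)) ->
  (forall w, 0 < m w -> exists x : 'rV[R]_d, code tbit (size w) x = w) ->
  exists2 sigma : {measure set (TB R d) -> \bar R}, (sigma setT < +oo)%E /\ on_torus sigma &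
  exists z : seq bool -> 'rV[R]_d, 
   (forall N (x : 'rV[R]_d), code tbit N (z (code tbit N x)) = code tbit N x) /\
   forall f eta, tcontinuous f -> 0 < eta -> exists N0, forall N, (N0 <= N)%N ->
     `|tint sigma f - \sum_(w : N.-tuple bool) f (z w) * m w| <= eta.
Proof.
move=> m0 ms mne.
pose z (w : seq bool) : 'rV[R]_d := xget 0 [set x | code tbit (size w) x = w].
have zP N (x : 'rV[R]_d) : code tbit N (z (code tbit N x)) = code tbit N x.
  have : code tbit (size (code tbit N x)) (z (code tbit N x)) = code tbit N x.
    by apply: (@xgetPex _ 0 [set y | _ y = _]); exists x; rewrite /= size_code.
  by rewrite size_code.
have [mE|mpos] := leP (m [::]) 0.
  have {}mE : m [::] = 0 by apply/eqP; rewrite eq_le mE m0.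
  have mw0 w : m w = 0.
    elim: w => // b w IH; have := m0 (true :: w); have := m0 (false :: w).
    by have := ms w; rewrite IH; case: b; lra.
  exists mzero; first by split; [exact: ltry|].
  exists z; split => // f eta tf eta0; exists 0%N => N _.
  rewrite big1 ?subr0; last by move=> w _; rewrite mw0 mulr0.
  by rewrite /tint /Rintegral integral_measure_zero normr0 ltW.
(* Replacing u by 0 outside the interval ensures that every word read off has positive mass, hence
   is realized. *)
pose c (u : R) : R := if 0 <= u < m [::] then u else 0.
have cI u : 0 <= c u < m [::] by rewrite /c; case: ifP => // _; rewrite lexx.
have mc : measurable_fun setT c.
  apply: measurable_fun_ifT => //; apply: measurable_and; exact: measurable_fun_ler || exact: measurable_fun_ltr.
pose br N u := code (lbit m) N (c u).
have zbr N u : code tbit N (z (br N u)) = br N u.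
  have [x] : exists x : 'rV[R]_d, code tbit (size (br N u)) x = br N u.
    apply: mne; have := code_lbitE m0 ms (br N u) (cI u).
    rewrite /br !size_code eqxx => /esym/andP[h1 h2].
    by rewrite -(ltrD2l (lend m (code (lbit m) N (c u)))) addr0 (le_lt_trans h1).
  by rewrite size_code => <-; exact: zP.
pose X N u : 'rV[R]_d := twrap (z (br N u)).
have Xc (delta : R) : 0 < delta -> exists N0, forall N N' u, (N0 <= N)%N -> (N0 <= N')%N ->
    forall j, `|X N u ord0 j - X N' u ord0 j| < delta.
  move=> d0; have [N0 HN0] := tcode_close (R := R) (d := d) d0.
  exists N0 => N N' u h1 h2 j; apply: HN0.
  rewrite (code_le h1 (zbr N u)) (code_le h2 (zbr N' u)).
  by rewrite /br.
pose Y u : 'rV[R]_d := \row_j lim ((fun N => X N u ord0 j) @ \oo).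
have XY u j : (fun N => X N u ord0 j) @ \oo --> Y u ord0 j.
  rewrite mxE; apply/cauchy_cvgP/cauchy_ballP => e e0; near_simpl.
  have [N0 HN0] := Xc _ e0.
  exists ([set k | (N0 <= k)%N], [set k | (N0 <= k)%N]); first by split; exists N0.
  by move=> [a b] [/= h1 h2]; apply: HN0.
have mbr F N : measurable_fun setT (fun u : measurableTypeR R => F (br N u) : R).
  rewrite (_ : (fun u => _) = (fun v : measurableTypeR R => F (code (lbit m) N v)) \o c) //.
  apply: measurableT_comp => //.
  by apply: (@measurable_code _ _ _ (lbit m) N (fun w _ => F w)) => // w; exact: measurable_lbit.
have mY : @measurable_fun _ _ (measurableTypeR R) (TB R d) setT Y.
  apply: measurable_to_TB => j.
  apply: (measurable_fun_cvg (h := fun N u => X N u ord0 j)) => [N|u _]; last exact: XY.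
  exact: (mbr (fun w => twrap (z w) ord0 j)).
(* A limit of points of the box may have a coordinate equal to -pi; wrapping returns it to the
   box. *)
have mtY : @measurable_fun _ _ (measurableTypeR R) (TB R d) setT (fun u => twrap (Y u)).
  exact: (measurableT_comp measurable_twrap mY).
exists (push_measure (lmass m) mtY).
  split; first by rewrite push_measureE preimage_setT lmass_setT // ltry.
  rewrite /on_torus push_measureE (_ : _ @^-1` _ = set0) ?measure0 //.
  by apply/seteqP; split=> // u /= h; exfalso; apply: h; exact: tbox_twrap.
exists z; split => // f eta tf eta0.
pose M := m [::].
have eta' : 0 < eta / M by rewrite divr_gt0.
have [delta d0 Hd] := tcontinuous_uniform tf eta'.
have d2 : 0 < delta / 2 by rewrite divr_gt0.
have [N0 HN0] := Xc _ d2.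
exists N0 => N NN0.
have lfin : (lmass m setT < +oo)%E by rewrite lmass_setT // ltry.
have fYX u : `|f (twrap (Y u)) - f (z (br N u))| <= eta / M.
  rewrite tf.2 -[f (z _)]tf.2; apply: ltW; apply: Hd => j.
  have /cvgrPdist_le/(_ _ d2)[K _ HK] := XY u j.
  pose N' := maxn N0 K.
  rewrite (_ : _ - _ = (Y u ord0 j - X N' u ord0 j) + (X N' u ord0 j - X N u ord0 j)); last first.
    by rewrite /X; ring.
  apply: (le_lt_trans (ler_normD _ _)); rewrite [delta]splitr; apply: ler_ltD.
    by apply: HK; rewrite /= leq_maxr.
  by apply: HN0; rewrite ?leq_maxl.
have [B fB] := tcontinuous_bounded tf.
have mfY : measurable_fun setT (fun u : measurableTypeR R => f (twrap (Y u))).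
  apply: (@measurableT_comp _ _ _ _ (TB R d) _ f) => //; exact: tcontinuous_measurable.
have jfY : (lmass m).-integrable setT (EFin \o (fun u => f (twrap (Y u)))).
  by apply: integrable_bounded => //; exists B.
rewrite /tint Rintegral_push_measure; [|exact: tcontinuous_measurable|exact: jfY].
have jfz : (lmass m).-integrable setT (EFin \o (fun u => f (z (br N u)))).
  by apply: integrable_bounded => //; [exact: (mbr (fun w => f (z w)))|exists B].
have -> : \sum_(w : N.-tuple bool) f (z w) * m w = \int[lmass m]_u f (z (br N u)).
  have jw (w : N.-tuple bool) : (lmass m).-integrable setT (EFin \o (fun u : measurableTypeR R => (br N u == w)%:R : R)).
    apply: integrable_bounded => //; first exact: (mbr (fun v => (v == w)%:R)).
    by exists 1 => u; case: eqP => _; rewrite ?normr1 ?normr0.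
  under [RHS]eq_Rintegral do rewrite (code_sum _ _ _ (fun w => f (z w))).
  rewrite (Rintegral_sum _ (f := fun (w : N.-tuple bool) (u : measurableTypeR R) => f (z w) * (br N u == w)%:R)); last first.
    by move=> w; exact: (integrable_realZ (f (z w)) (jw w)).
  apply: eq_bigr => w _; rewrite [RHS](RintegralZl _ measurableT (jw w)).
  congr (_ * _); rewrite -(lmass_code m0 ms w) size_tuple.
  rewrite (_ : (fun u => _) = \1_[set u | br N u == w]); last first.
    apply/funext => u; rewrite indicE; case: (boolP (br N u == w)) => h.
      by rewrite mem_set.
    by rewrite memNset //; exact/negP.
  rewrite Rintegral_indic; last first.
    rewrite [X in measurable X](_ : _ = (fun u : measurableTypeR R => (br N u == w)%:R : R) @^-1` [set 1]).
      by rewrite -[X in measurable X]setTI; apply: (mbr (fun v => (v == w)%:R)).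
    apply/seteqP; split => u /=; first by move=> ->.
    by case: eqP => // _ /esym/eqP; rewrite oner_eq0.
  congr fine; rewrite /lmass /= /mrestr /=; congr (lebesgue_measure _).
  apply/seteqP; split => u /= [cu um]; split => //; move: cu;
    by have h := um; rewrite in_itv /= in h; rewrite /br /c h.
rewrite -RintegralB //.
apply: (@le_trans _ _ (\int[lmass m]_u (eta / M))).
  apply: norm_Rintegral_le => //; first exact: integrable_realB.
  by apply: integrable_bounded => //; exists `|eta / M|.
rewrite Rintegral_cst // lmass_setT //=.
by rewrite -mulrA mulVf ?mulr1 // gt_eqF.
Qed.

(** Along a diagonal subsequence the g-weighted masses of all code cells converge. The limits are
    again additive under splitting a cell, so they come from a measure, and a continuous f is
    uniformly close to a function of a long enough code. *)
Lemma helly (rho : nat -> {measure set (TB R d) -> \bar R}) (g : 'rV[R]_d -> R) (M : R) :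
  (forall n, (rho n setT < +oo)%E) -> measurable_fun setT (g : TB R d -> R) ->
  (forall x, 0 <= g x) -> (exists B, forall x, g x <= B) ->
  (forall n, tint (rho n) g <= M) ->
  exists2 psi : nat -> nat, {homo psi : m n / (m < n)%N} &
  exists2 sigma : {measure set (TB R d) -> \bar R}, (sigma setT < +oo)%E /\ on_torus sigma &
  forall f, tcontinuous f ->
    (fun n => tint (rho (psi n)) (fun x => f x * g x)) @ \oo --> tint sigma f.
Proof.
move=> rho_fin mg g0 [B gB] gM.
have jb n (h : 'rV[R]_d -> R) : measurable_fun setT (h : TB R d -> R) ->
    (exists C, forall x, `|h x| <= C) -> (rho n).-integrable setT (EFin \o (fun x => h x * g x)).
  move=> mh [C hC]; apply: integrable_bounded => //; first exact: measurable_funM.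
  exists (C * B) => x; rewrite normrM (ger0_norm (g0 x)) ler_pM //.
have jg n : (rho n).-integrable setT (EFin \o g).
  by apply: integrable_bounded => //; exists B => x; rewrite ger0_norm.
pose ind w (x : 'rV[R]_d) : R := (code tbit (size w) x == w)%:R.
have ind01 w x : 0 <= ind w x <= 1 by rewrite /ind; case: eqP; rewrite ?lexx ?ler01.
have mind w : measurable_fun setT (ind w : TB R d -> R).
  by apply: measurable_code_ind => v; exact: measurable_tbit.
have jind n w : (rho n).-integrable setT (EFin \o (fun x => ind w x * g x)).
  by apply: jb => //; exists 1 => x; have /andP[h1 h2] := ind01 w x; rewrite ger0_norm.
pose mass n w := tint (rho n) (fun x => ind w x * g x).
have mass0 n w : 0 <= mass n w.
  apply: Rintegral_ge0 => x _; rewrite mulr_ge0 //; by case/andP: (ind01 w x).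
have massM n w : `|mass n w| <= M.
  apply: le_trans (gM n); apply: norm_Rintegral_le => // x.
  have /andP[h1 h2] := ind01 w x; rewrite normrM !ger0_norm //.
  by rewrite ler_piMl.
have mass_split n w : mass n w = mass n (true :: w) + mass n (false :: w).
  rewrite /mass /tint -RintegralD //; apply: eq_Rintegral => x _.
  rewrite -mulrDl; congr (_ * _); rewrite /ind /= !eqseq_cons.
  by case: (tbit _ x); case: eqP => _ /=; rewrite ?addr0 ?add0r.
have M0 : 0 <= M := le_trans (normr_ge0 _) (massM 0%N [::]).
have [psi hpsi [m mE]] := diagonal_subsequence massM.
have m0 w : 0 <= m w.
  rewrite -(cvg_lim _ (mE w)) //; apply: limr_ge; first by apply/cvg_ex; exists (m w).
  by apply: nearW => n; exact: mass0.
have ms w : m w = m (true :: w) + m (false :: w).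
  apply: (cvg_unique _ (mE w)) => //=; under eq_fun do rewrite mass_split.
  exact: cvgD.
have mne w : 0 < m w -> exists x : 'rV[R]_d, code tbit (size w) x = w.
  move=> mw; apply: contrapT => /forallNP nex; move: mw.
  have -> : m w = 0.
    apply: (cvg_unique _ (mE w)) => //=.
    rewrite (_ : (fun n => _) = fun=> 0); first exact: cvg_cst.
    apply/funext => n; rewrite /mass /tint; under eq_Rintegral => x _.
      by rewrite /ind (_ : (_ == _) = false) ?mul0r; [over|apply/eqP; exact: nex].
    by rewrite Rintegral_cst // mul0r.
  by rewrite ltxx.
have [sigma sigmaP [z [zP zE]]] := measure_of_masses m0 ms mne.
exists psi => //; exists sigma => // f tf.
apply/cvgrPdist_le => e e0.
pose eta := e / (3 * (M + 1)).
have eta0 : 0 < eta by rewrite divr_gt0 // mulr_gt0 //; lra.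
have [N1 HN1] := zE f eta tf eta0.
have [delta d0 Hd] := tcontinuous_uniform tf eta0.
have [N2 HN2] := tcode_close (R := R) (d := d) d0.
pose N := maxn N1 N2.
have fz x : `|f x - f (z (code tbit N x))| <= eta.
  rewrite -[f x]tf.2 -[f (z _)]tf.2; apply: ltW; apply: Hd => j; apply: HN2.
  by apply: (@code_le _ _ _ _ N); [rewrite leq_maxr|rewrite zP].
have [C fC] := tcontinuous_bounded tf.
have mfz : measurable_fun setT ((fun x => f (z (code tbit N x))) : TB R d -> R).
  apply: (@measurable_code _ (TB R d) R tbit N (fun w _ => f (z w))) => // w.
  exact: measurable_tbit.
have jfz n : (rho n).-integrable setT (EFin \o (fun x => f (z (code tbit N x)) * g x)).
  by apply: jb => //; exists C => x; exact: fC.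
have jf n : (rho n).-integrable setT (EFin \o (fun x => f x * g x)).
  by apply: jb; [exact: tcontinuous_measurable|exists C].
have sumE n : tint (rho n) (fun x => f (z (code tbit N x)) * g x) =
    \sum_(w : N.-tuple bool) f (z w) * mass n w.
  rewrite (eq_bigr (fun w : N.-tuple bool =>
      \int[rho n]_x (f (z w) * (ind w x * g x)))); last first.
    by move=> w _; rewrite (RintegralZl _ measurableT (jind n w)).
  rewrite -Rintegral_sum; last by move=> w; exact: (integrable_realZ (f (z w)) (jind n w)).
  apply: eq_Rintegral => x _; rewrite (code_sum _ _ _ (fun w => f (z w))) mulr_suml.
  by apply: eq_bigr => w _; rewrite /ind size_tuple mulrA.
have e3 : 0 < e / 3 by rewrite divr_gt0.
have sum_cvg : (fun n => \sum_(w : N.-tuple bool) f (z w) * mass (psi n) w) @ \oo -->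
    \sum_(w : N.-tuple bool) f (z w) * m w.
  by apply: cvg_sumr => w _; apply: cvgMr; exact: mE.
have /cvgrPdist_le/(_ _ e3) := sum_cvg.
apply: filterS => n Hn.
have h1 := HN1 N (leq_maxl _ _).
have h2 : `|tint (rho (psi n)) (fun x => f x * g x) - \sum_(w : N.-tuple bool) f (z w) * mass (psi n) w| <= eta * M.
  rewrite -sumE /tint -RintegralB //.
  apply: (@le_trans _ _ (\int[rho (psi n)]_x (eta * g x))).
    apply: norm_Rintegral_le; [exact: integrable_realB|exact: integrable_realZ|] => x.
    by rewrite -mulrBl normrM (ger0_norm (g0 x)) ler_wpM2r.
  by rewrite RintegralZl //; apply: ler_wpM2l; [exact: ltW|exact: gM].
have h3 : eta + eta * M = e / 3 by rewrite /eta; field; lra.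
have key (u v a b : R) : `|a - b| <= e / 3 -> `|u - a| <= eta -> `|v - b| <= eta * M -> `|u - v| <= e.
  move=> h4 h5 h6; rewrite (_ : u - v = (u - a) + (a - b) - (v - b)); last by ring.
  apply: (le_trans (ler_normB _ _)); apply: (le_trans (lerD (ler_normD _ _) (lexx _))); lra.
exact: key Hn h1 h2.
Qed.

End helly.

                                      

(** * Measures with a density *)

Section density.
Context {dd : measure_display} {T : measurableType dd} {R : realType}.
Variables (mu : {measure set T -> \bar R}) (w : T -> R).
Hypotheses (mw : measurable_fun setT w) (w0 : forall x, 0 <= w x).
Local Open Scope ereal_scope.

Definition density (A : set T) : \bar R := \int[mu]_(x in A) (w x)%:E.

Let density0 : density set0 = 0.
Proof. by rewrite /density integral_set0. Qed.

Let density_ge0 A : 0 <= density A.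
Proof. by apply: integral_ge0 => x _; rewrite lee_fin. Qed.

Let density_sigma_additive : semi_sigma_additive density.
Proof.
move=> F mF tF mUF; rewrite /density ge0_integral_bigcup //; last 2 first.
- by apply: measurable_funTS; exact/measurable_EFinP.
- by move=> x _; rewrite lee_fin.
by apply: is_cvg_ereal_nneg_natsum_cond => n _ _; exact: density_ge0.
Qed.

HB.instance Definition _ := isMeasure.Build _ _ _ density
  density0 density_ge0 density_sigma_additive.

Definition densitym : {measure set T -> \bar R} := density.

Import HBNNSimple.

Lemma ge0_integral_densitym (f : T -> \bar R) : measurable_fun setT f ->
  (forall x, 0 <= f x) ->
  \int[densitym]_x f x = \int[mu]_x (f x * (w x)%:E).
Proof.
move=> mf f0; pose f_ := nnsfun_approx measurableT mf.
have mwE : measurable_fun setT (EFin \o w) by exact/measurable_EFinP.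
have f_f x : (EFin \o f_ ^~ x) @ \oo --> f x by apply: cvg_nnsfun_approx.
transitivity (limn (fun n => \int[densitym]_x (f_ n x)%:E)).
  rewrite -monotone_convergence //.
  - apply: eq_integral => x _; apply/esym/cvg_lim => //; exact: f_f.
  - by move=> n; exact/measurable_EFinP.
  - by move=> n x _; rewrite lee_fin.
  - by move=> x _ m n mn; rewrite lee_fin; exact/lefP/nd_nnsfun_approx.
rewrite [X in limn X](_ : _ = fun n => \int[mu]_x ((f_ n x)%:E * (w x)%:E)).
  rewrite -monotone_convergence //.
  - apply: eq_integral => x _; apply/cvg_lim => //.
    by apply: cvgeZr => //; exact: f_f.
  - by move=> n; apply: emeasurable_funM => //; exact/measurable_EFinP.
  - by move=> n x _; rewrite mule_ge0 ?lee_fin.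
  - move=> x _ m n mn; rewrite lee_pmul ?lee_fin //.
    exact/lefP/nd_nnsfun_approx.
apply/funext => n; rewrite integral_nnsfun // sintegralE.
have -> : \int[mu]_x ((f_ n x)%:E * (w x)%:E) =
    \int[mu]_x (\sum_(r \in range (f_ n)) (r * \1_(f_ n @^-1` [set r]) x * w x)%:E).
  apply: eq_integral => x _; rewrite fsumEFin // -EFinM; congr EFin.
  by rewrite {1}fimfunE !fsbig_finite // mulr_suml.
rewrite ge0_integral_fsum //; last 2 first.
- move=> r; apply/measurable_EFinP; apply: measurable_funM => //.
  by apply: measurable_funM.
- move=> r x _; rewrite lee_fin mulr_ge0 // indicE.
  by case: (boolP (_ \in _)) => [/set_mem /= <-|]; rewrite ?mulr1 ?mulr0.
rewrite patch_setT; apply: eq_fsbigr => r; rewrite inE => -[y _ <-].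
under [RHS]eq_integral do rewrite -mulrA EFinM.
rewrite ge0_integralZl_EFin //; last 2 first.
- by move=> x _; rewrite lee_fin mulr_ge0.
- by apply/measurable_EFinP; exact: measurable_funM.
congr (_ * _); rewrite /= /density integral_mkcond; apply: eq_integral => x _.
by rewrite patchE indicE; case: ifP => _; rewrite ?mul1r ?mul0r.
Qed.

Lemma integral_densitym (f : T -> R) : measurable_fun setT f ->
  \int[densitym]_x (f x)%:E = \int[mu]_x (f x * w x)%:E.
Proof.
move=> mf; have mfE : measurable_fun setT (EFin \o f) by exact/measurable_EFinP.
rewrite integralE [RHS]integralE.
rewrite !ge0_integral_densitym //; last 2 first.
- exact: measurable_funeneg.
- exact: measurable_funepos.
congr (_ - _); apply: eq_integral => x _.
  by rewrite !funeposE maxe_pMl ?lee_fin // mul0e.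
by rewrite !funenegE maxe_pMl ?lee_fin // mul0e EFinM mulNe.
Qed.

End density.

(** * Smooth localization near and away from 1 *)

Section cutoff.
Context {R : realType} {d : nat}.
Implicit Types (x : 'rV[R]_d) (e : R).

(** A cutoff equal to 0 where the gauge is at most e and to 1 where it is at least 2 e. Thus f times
    [chi e] is an admissible test function away from 1, while f times 1 - [chi e] is local at 1. *)
Definition chi e x : R := Num.min 1 (Num.max 0 (tgauge x / e - 1)).

Lemma chi_ge0 e x : 0 <= chi e x.
Proof. by rewrite le_min ler01 le_max lexx. Qed.

Lemma chi_le1 e x : chi e x <= 1.
Proof. by rewrite ge_min lexx. Qed.

Lemma chi0 e x : 0 < e -> tgauge x <= e -> chi e x = 0.
Proof.
move=> e0 xe; rewrite /chi max_l; first by rewrite min_r.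
by rewrite subr_le0 ler_pdivrMr // mul1r.
Qed.

Lemma chi1 e x : 0 < e -> 2 * e <= tgauge x -> chi e x = 1.
Proof.
move=> e0 xe; have h : 1 <= tgauge x / e - 1 by rewrite lerBrDr ler_pdivlMr.
by rewrite /chi max_r ?min_l // (le_trans ler01).
Qed.

Lemma tcontinuous_chi e : tcontinuous (chi e).
Proof.
split=> [x|x]; last by rewrite /chi tgauge_twrap.
apply: (@continuous_min _ _ (fun=> 1) (fun x => Num.max 0 (tgauge x / e - 1))).
  exact: cst_continuous.
apply: (@continuous_max _ _ (fun=> 0) (fun x => tgauge x / e - 1)).
  exact: cst_continuous.
apply: continuousB; last exact: cst_continuous.
by apply: continuousM; [exact: continuous_tgauge|exact: cst_continuous].
Qed.

Lemma tcont_away_chi (f : 'rV[R]_d -> R) e : 0 < e -> tcontinuous f ->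
  tcont_away (fun x => f x * chi e x).
Proof.
move=> e0 tf; split; first by apply: tcontinuousM => //; exact: tcontinuous_chi.
exists (Num.min 1 e); first by rewrite lt_min ltr01.
move=> x; rewrite lt_min => /andP[x1 xe].
rewrite chi0 ?mulr0 // -tgauge_twrap; apply: (le_trans (tgauge_le_tnorm _)).
have := tnorm_ge0 (twrap x); nra.
Qed.

Lemma chi_antitone e e' x : 0 < e -> e <= e' -> chi e' x <= chi e x.
Proof.
move=> e0 ee'; rewrite /chi.
have h : tgauge x / e' - 1 <= tgauge x / e - 1.
  rewrite lerB // ler_wpM2l ?tgauge_ge0 // lef_pV2 ?posrE // (lt_le_trans e0) //.
rewrite le_min ge_min lexx /= ge_min; apply/orP; right.
by rewrite ge_max !le_max lexx h orbT.
Qed.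

End cutoff.

(** * Convergence away from 1 under a gauge bound *)

Section vague.
Context {R : realType} {d : nat}.
Implicit Types (mu rho tau sigma : {measure set (TB R d) -> \bar R}) (f : 'rV[R]_d -> R).

                                                                                                   
(** Inversion, with value 0 at 0, is the pointwise limit of the continuous functions x / (x^2 +
    1/(n+1)). *)
Lemma measurable_invr : measurable_fun setT (fun x : R => x^-1).
Proof.
apply: (@measurable_fun_cvg _ (measurableTypeR R) R setT
  (fun n x => x / (x ^+ 2 + n.+1%:R^-1)) (fun x => x^-1)) => [n|x _].
  apply: continuous_measurable_fun => x.
  have p : 0 < x ^+ 2 + n.+1%:R^-1 by rewrite ltr_wpDl ?sqr_ge0 // invr_gt0.
  apply: (@continuousM R R (fun x => x) (fun x => (x ^+ 2 + n.+1%:R^-1)^-1)) => //.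
  apply: (@continuousV R R (fun x => x ^+ 2 + n.+1%:R^-1)); first by rewrite gt_eqF.
  apply: (@continuousD R R R (fun x => x ^+ 2) (fun=> n.+1%:R^-1)); last exact: cst_continuous.
  exact: exprn_continuous.
have [->|x0] := eqVneq x 0.
  by rewrite invr0; under eq_fun do rewrite mul0r; exact: cvg_cst.
have -> : x^-1 = x / (x ^+ 2 + 0) by rewrite addr0 expr2 invfM mulrA divff // mul1r.
apply: cvgM; first exact: cvg_cst.
apply: cvgV; first by rewrite addr0 sqrf_eq0.
by apply: cvgD; [exact: cvg_cst|exact: cvg_harmonic].
Qed.

Lemma tcont_away_tgauge f : tcont_away f -> exists2 c, 0 < c & forall x, tgauge x < c -> f x = 0.
Proof.
move=> [tf [e e0 fe]]; exists (e ^+ 2 / 12); first by rewrite divr_gt0 // exprn_gt0.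
move=> x xc; rewrite -tf.2; apply: fe; rewrite twrap_twrap.
rewrite -(ltr_pXn2r (ltn0Sn 1)) ?nnegrE ?tnorm_ge0 ?(ltW e0) //.
apply: (le_lt_trans (tnorm_le_tgauge (tbox_twrap x))); rewrite tgauge_twrap; lra.
Qed.

Lemma tcontinuous_div_tgauge f : tcont_away f -> tcontinuous (fun x => f x * (tgauge x)^-1).
Proof.
move=> af; have [c c0 fc] := tcont_away_tgauge af.
rewrite (_ : (fun x => _) = fun x => f x * (Num.max (tgauge x) c)^-1); last first.
  apply/funext => x; case: (ltP (tgauge x) c) => xc; first by rewrite fc // !mul0r.
  by [].
apply: tcontinuousM; first exact: af.1.
split=> [x|x]; last by rewrite tgauge_twrap.
apply: (@continuousV _ _ (fun x => Num.max (tgauge x) c)); first by rewrite gt_eqF // lt_max c0 orbT.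
by apply: (@continuous_max _ _ tgauge (fun=> c)); [exact: continuous_tgauge|exact: cst_continuous].
Qed.

                                                                                                    
(** [helly] gives a weak limit sigma of the measures with density [tgauge], and tau is sigma divided
    by the gauge. Test functions vanish near 1, so their quotient by the gauge remains
    continuous. *)
Lemma vague_compact (rho : nat -> {measure set (TB R d) -> \bar R}) (M : R) :
  (forall n, (rho n setT < +oo)%E) -> (forall n, tint (rho n) tgauge <= M) ->
  exists2 psi : nat -> nat, {homo psi : m n / (m < n)%N} &
  exists2 tau : {measure set (TB R d) -> \bar R}, in_Mtilde tau &
    forall f, tcont_away f -> (fun n => tint (rho (psi n)) f) @ \oo --> tint tau f.
Proof.
move=> rho_fin gM.
have mg : measurable_fun setT (@tgauge R d : TB R d -> R).
  exact: tcontinuous_measurable tcontinuous_tgauge.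
have [||psi hpsi [sigma [sfin stor] sE]] := helly rho_fin mg _ _ gM.
- by move=> x; exact: tgauge_ge0.
- by exists (2 * d%:R) => x; exact: tgauge_le.
exists psi => //.
(* The convention that the inverse of 0 is 0 discards the atom of sigma at 1, as tau must not charge
   1; that atom is the source of the Gaussian part. *)
pose w (x : TB R d) : R := (tgauge (x : 'rV[R]_d))^-1.
have mw : measurable_fun setT w.
  by apply: (measurableT_comp measurable_invr).
have w0 x : 0 <= w x by rewrite invr_ge0 tgauge_ge0.
exists (densitym sigma mw w0).
  have mbC : measurable (~` @tbox R d : set (TB R d)).
    by apply: measurableC; exact: measurable_tbox.
  have nul (A : set (TB R d)) : measurable A -> sigma A = 0%E -> densitym sigma mw w0 A = 0%E.
    move=> mA A0; apply: null_set_integral => //.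
    by apply: measurable_funTS; exact/measurable_EFinP.
  split; first exact: nul.
  - rewrite /= /density -[RHS](integral0 sigma [set (0 : 'rV[R]_d)]).
    apply: eq_integral => x; rewrite inE => -> ; rewrite /w /tgauge big1 ?invr0 //.
    by move=> j _; rewrite mxE cos0 subrr.
  - move=> A mA [e e0 Ae].
    have mAb : measurable (A `&` @tbox R d : set (TB R d)).
      by apply: measurableI => //; exact: measurable_tbox.
    have -> : A = (A `&` @tbox R d) `|` (A `&` ~` @tbox R d) by rewrite -setIUr setUv setIT.
    apply: (le_lt_trans (measureU2 _ mAb (measurableI _ _ mA mbC))).
    rewrite [X in (_ + X)%E]nul ?adde0; [|exact: measurableI|]; last first.
      have s0 : sigma (~` @tbox R d) = 0%E := stor.
      apply/eqP; rewrite -measure_le0 -s0; apply: le_measure; rewrite ?inE //.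
      exact: measurableI.
    apply: (@le_lt_trans _ _ ((12 / e ^+ 2)%:E * sigma (A `&` @tbox R d))%E).
      rewrite [leLHS](_ : _ = (\int[sigma]_(x in A `&` @tbox R d) `|(w x)%:E|)%E); last first.
        by apply: eq_integral => x _; rewrite gee0_abs ?lee_fin.
      apply: integral_le_bound => //.
      + by apply: measurable_funTS; exact/measurable_EFinP.
      + by rewrite lee_fin divr_ge0 // sqr_ge0.
      + apply: aeW => x [Ax bx]; rewrite gee0_abs ?lee_fin // /w.
        have xe : e <= tnorm x.
          rewrite leNgt; apply/negP => xe.
          have : (A `&` [set x | tnorm x < e]) x by [].
          by rewrite Ae.
        have e2 : 0 < e ^+ 2 by rewrite exprn_gt0.
        have h : e ^+ 2 <= 12 * tgauge x.
          by apply: le_trans (tnorm_le_tgauge bx); rewrite ler_pXn2r // nnegrE ?tnorm_ge0 // ltW.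
        rewrite -[12 / _]invrK invf_div lef_pV2 ?posrE ?divr_gt0 //; lra.
    rewrite lte_mul_pinfty // ?lee_fin ?divr_ge0 ?sqr_ge0 //.
    by apply: (le_lt_trans _ sfin); apply: le_measure; rewrite ?inE.
move=> f af; have tfw := tcontinuous_div_tgauge af.
rewrite (_ : tint (densitym sigma mw w0) f = tint sigma (fun x => f x * (tgauge x)^-1)); last first.
  rewrite /tint /Rintegral integral_densitym //; exact: tcontinuous_measurable af.1.
rewrite (_ : (fun n => _) = fun n => tint (rho (psi n)) (fun x => f x * (tgauge x)^-1 * tgauge x)).
  exact: sE.
apply/funext => n; congr tint; apply/funext => x.
have [c c0 fc] := tcont_away_tgauge af.
have [x0|x0] := eqVneq (tgauge x) 0; last by rewrite mulfVK.
by rewrite fc ?mul0r // x0.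
Qed.

End vague.

Section vague_limits.
Context {R : realType} {d : nat}.
Implicit Types (mu tau : {measure set (TB R d) -> \bar R}) (f : 'rV[R]_d -> R).

(** f is o([tgauge]) at 1. *)
Definition tsmall f :=
  forall eta : R, 0 < eta -> exists2 eps : R, 0 < eps & forall x, tgauge x <= eps -> `|f x| <= eta * tgauge x.

Lemma tsmall_le_tgauge f : tcontinuous f -> tsmall f ->
  exists2 C : R, 0 <= C & forall x, `|f x| <= C * tgauge x.
Proof.
move=> tf sf; have [eps e0 fe] := sf 1 ltr01.
have [B fB] := tcontinuous_bounded tf.
have B0 : 0 <= B := le_trans (normr_ge0 _) (fB 0).
exists (1 + B / eps); first by rewrite addr_ge0 // divr_ge0 // ltW.
move=> x; have [xe|xe] := lerP (tgauge x) eps.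
  apply: (le_trans (fe x xe)); rewrite ler_wpM2r ?tgauge_ge0 // lerDl divr_ge0 //.
  exact: ltW.
apply: (le_trans (fB x)); rewrite mulrDl mul1r.
apply: (@le_trans _ _ (B / eps * tgauge x)); last by rewrite lerDr tgauge_ge0.
by rewrite mulrAC ler_pdivlMr // ler_wpM2l // ltW.
Qed.

Lemma tgauge_dominated_integrable mu f C : mu.-integrable setT (EFin \o (@tgauge R d)) ->
  tcontinuous f -> (forall x, `|f x| <= C * tgauge x) -> mu.-integrable setT (EFin \o f).
Proof.
move=> jg tf fC; apply: (@integrable_dominated _ (TB R d) R _ _ (fun x => C * tgauge x)) => //.
- exact: tcontinuous_measurable.
- exact: integrable_realZ.
Qed.

Lemma away_integrable tau f : in_Mtilde tau -> tcont_away f ->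
  tau.-integrable setT (EFin \o f).
Proof.
move=> [tau0 _ tfin] [tf [e e0 fe]]; have [B fB] := tcontinuous_bounded tf.
pose A : set (TB R d) := [set x | e <= tnorm (twrap x)].
have mA : measurable A.
  rewrite [X in measurable X](_ : _ = (@twrap R d) @^-1` (~` [set x | tnorm x < e])); last first.
    by apply/seteqP; split => x /=; rewrite /A /= leNgt => /negP.
  rewrite -[X in measurable X]setTI; apply: measurable_twrap => //.
  by apply: measurableC; exact: measurable_tnorm_lt.
have Afin : (tau A < +oo)%E.
  have mb := measurable_tbox (R := R) (d := d).
  have mbC := measurableC mb.
  have -> : A = (A `&` @tbox R d) `|` (A `&` ~` @tbox R d) by rewrite -setIUr setUv setIT.
  apply: (le_lt_trans (measureU2 _ (measurableI _ _ mA mb) (measurableI _ _ mA mbC))).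
  have s0 : tau (~` @tbox R d) = 0%E := tau0.
  rewrite [X in (_ + X)%E](_ : _ = 0%E) ?adde0; last first.
    apply/eqP; rewrite -measure_le0 -s0; apply: le_measure; rewrite ?inE //.
    exact: measurableI.
  apply: tfin; first exact: measurableI.
  exists e => //; apply/seteqP; split => x //= [[Ax bx] xe].
  by move: Ax; rewrite /A /= twrap_id // leNgt xe.
apply: (@integrable_dominated _ (TB R d) R _ _ (fun x => B * \1_A x)).
- exact: tcontinuous_measurable.
- move=> x; rewrite indicE; case: (boolP (x \in A)) => [_|]; first by rewrite mulr1.
  rewrite notin_setE /A /= => /negP; rewrite -ltNge => xe.
  by rewrite fe // normr0 mulr0.
apply: integrable_realZ; apply/integrableP; split.
  by apply/measurable_EFinP; exact: measurable_indic.
under eq_integral do rewrite gee0_abs ?lee_fin //.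
by rewrite integral_indic // setIT.
Qed.

Definition vcvg (rho : nat -> {measure set (TB R d) -> \bar R}) tau :=
  forall f, tcont_away f -> (fun n => tint (rho n) f) @ \oo --> tint tau f.

Variables (rho : nat -> {measure set (TB R d) -> \bar R}) (tau : {measure set (TB R d) -> \bar R}).
Variable M : R.
Hypotheses (rho_fin : forall n, (rho n setT < +oo)%E) (rhoM : forall n, tint (rho n) tgauge <= M).
Hypotheses (tauM : in_Mtilde tau) (rho_tau : vcvg rho tau).

Let jg n : (rho n).-integrable setT (EFin \o (@tgauge R d)).
Proof. by apply: tcontinuous_integrable => //; exact: tcontinuous_tgauge. Qed.

Let tint_away_le (e : R) : 0 < e -> tint tau (fun x => tgauge x * chi e x) <= M.
Proof.
move=> e0; have af := tcont_away_chi e0 (tcontinuous_tgauge (R := R) (d := d)).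
have h := rho_tau af; rewrite -(cvg_lim _ h) //; apply: limr_le.
  by apply/cvg_ex; eexists; exact: h.
apply: nearW => n; apply: le_trans (rhoM n); apply: le_Rintegral => //.
  by apply: tcontinuous_integrable => //; exact: af.1.
by move=> x _; rewrite ler_piMr ?tgauge_ge0 ?chi_le1.
Qed.

(** The gauge cut off near 1 is a test function, so its integral against tau is at most M; the
    cutoffs increase to 1 wherever the gauge is positive, and monotone convergence concludes. *)
Lemma vague_integral_tgauge :
  tau.-integrable setT (EFin \o (@tgauge R d)) /\ tint tau tgauge <= M.
Proof.
pose e n : R := n.+1%:R^-1.
have e0 n : 0 < e n by rewrite invr_gt0.
have af n := tcont_away_chi (e0 n) (tcontinuous_tgauge (R := R) (d := d)).
have jgc n : tau.-integrable setT (EFin \o (fun x => tgauge x * chi (e n) x)) by exact: away_integrable.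
have mg : measurable_fun setT (EFin \o (@tgauge R d) : TB R d -> \bar R).
  by apply/measurable_EFinP; exact: tcontinuous_measurable tcontinuous_tgauge.
have lim_g (x : 'rV[R]_d) : (fun n => (tgauge x * chi (e n) x)%:E) @ \oo --> (tgauge x)%:E.
  apply: cvg_EFin; first by apply: nearW.
  have [x0|x0] := eqVneq (tgauge x) 0.
    by rewrite x0; under eq_fun do rewrite /= mul0r; exact: cvg_cst.
  have {}x0 : 0 < tgauge x by rewrite lt_def x0 tgauge_ge0.
  apply: cvg_near_cst; exists (Num.truncn (2 / tgauge x)) => // n /= nx.
  rewrite chi1 ?mulr1 // /e -ler_pdivlMl // mulrC.
  rewrite -[tgauge x / 2]invrK invf_div lef_pV2 ?posrE ?divr_gt0 //.
  by apply/ltW/(lt_le_trans (truncnS_gt _)); rewrite ler_nat ltnS.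
have le_M : (\int[tau]_x (tgauge x)%:E <= M%:E)%E.
  have -> : (\int[tau]_x (tgauge x)%:E = \int[tau]_x (limn (fun n => (tgauge x * chi (e n) x)%:E)))%E.
    by apply: eq_integral => x _; apply/esym/cvg_lim => //; exact: lim_g.
  rewrite monotone_convergence //.
  - apply: lime_le.
      apply: ereal_nondecreasing_is_cvgn => m n mn; apply: ge0_le_integral => //.
      + by move=> x _; rewrite lee_fin mulr_ge0 ?tgauge_ge0 ?chi_ge0.
      + exact: (measurable_int _ (jgc m)).
      + exact: (measurable_int _ (jgc n)).
      + move=> x _; rewrite lee_fin ler_wpM2l ?tgauge_ge0 // chi_antitone //.
        by rewrite lef_pV2 ?posrE // ler_nat ltnS.
    apply: nearW => n.
    have /fineK <- := integrable_fin_num measurableT (jgc n).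
    by rewrite lee_fin; exact: (tint_away_le (e0 n)).
  - by move=> n; exact: (measurable_int _ (jgc n)).
  - by move=> n x _; rewrite lee_fin mulr_ge0 ?tgauge_ge0 ?chi_ge0.
  - move=> x _ m n mn; rewrite lee_fin ler_wpM2l ?tgauge_ge0 // chi_antitone //.
    by rewrite lef_pV2 ?posrE // ler_nat ltnS.
have jtau : tau.-integrable setT (EFin \o (@tgauge R d)).
  apply/integrableP; split => //.
  under eq_integral do rewrite gee0_abs ?lee_fin ?tgauge_ge0 //.
  exact: (le_lt_trans le_M (ltry _)).
split => //; rewrite -lee_fin; apply: le_trans le_M.
by rewrite /tint /Rintegral fineK // integrable_fin_num.
Qed.

(** Removing a small neighbourhood of 1 from f costs at most eta times M, uniformly in n and also
    for tau, because f is o([tgauge]) there; what remains is a test function. *)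
Lemma vague_cvg_small f : tcontinuous f -> tsmall f ->
  (fun n => tint (rho n) f) @ \oo --> tint tau f.
Proof.
move=> tf sf; have [jtau tauMle] := vague_integral_tgauge.
have [C C0 fC] := tsmall_le_tgauge tf sf.
have M0 : 0 <= M.
  by apply: le_trans (rhoM 0%N); apply: Rintegral_ge0 => x _; exact: tgauge_ge0.
have approx (mu : {measure set (TB R d) -> \bar R}) (eta eps : R) : 0 < eps -> 0 <= eta ->
    (forall x, tgauge x <= eps -> `|f x| <= eta * tgauge x) ->
    mu.-integrable setT (EFin \o (@tgauge R d)) -> tint mu tgauge <= M ->
    `|tint mu f - tint mu (fun x => f x * chi (eps / 2) x)| <= eta * M.
  move=> e0 eta0 fe jmu muM; have e2 : 0 < eps / 2 by rewrite divr_gt0.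
  have jf : mu.-integrable setT (EFin \o f) by exact: tgauge_dominated_integrable fC.
  have jfc : mu.-integrable setT (EFin \o (fun x => f x * chi (eps / 2) x)).
    apply: (@tgauge_dominated_integrable _ _ C) => //.
      by apply: tcontinuousM => //; exact: tcontinuous_chi.
    move=> x; rewrite normrM; apply: le_trans (fC x).
    by rewrite ler_piMr // ger0_norm ?chi_le1 ?chi_ge0.
  rewrite /tint -RintegralB //; apply: (@le_trans _ _ (\int[mu]_x (eta * tgauge x))).
    apply: norm_Rintegral_le; [exact: integrable_realB|exact: integrable_realZ|] => x.
    rewrite -{1}[f x]mulr1 -mulrBr normrM.
    have c1 := chi_le1 (eps / 2) x; have c0 := chi_ge0 (eps / 2) x.
    have [xe|xe] := lerP (tgauge x) eps.
      apply: le_trans (fe x xe); rewrite ler_piMr // ger0_norm ?subr_ge0 //; lra.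
    rewrite chi1 //; last by rewrite mulrC divfK // ltW.
    by rewrite subrr normr0 mulr0 mulr_ge0 // tgauge_ge0.
  by rewrite RintegralZl //; apply: ler_wpM2l.
apply/cvgrPdist_le => e e0.
pose eta := e / (3 * (M + 1)).
have eta0 : 0 < eta by rewrite divr_gt0 // mulr_gt0 //; lra.
have etaM : eta * M <= e / 3.
  rewrite /eta mulrAC ler_pdivrMr; last by rewrite mulr_gt0 //; lra.
  nra.
have [eps eps0 fe] := sf eta eta0.
have e2 : 0 < eps / 2 by rewrite divr_gt0.
have e3 : 0 < e / 3 by rewrite divr_gt0.
have /cvgrPdist_le/(_ _ e3) := rho_tau (tcont_away_chi e2 tf).
apply: filterS => n Hn.
have h1 := approx tau eta eps eps0 (ltW eta0) fe jtau tauMle.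
have h2 := approx (rho n) eta eps eps0 (ltW eta0) fe (jg n) (rhoM n).
have key (u v a b : R) : `|a - b| <= e / 3 -> `|u - a| <= eta * M -> `|v - b| <= eta * M -> `|u - v| <= e.
  move=> h4 h5 h6; rewrite (_ : u - v = (u - a) + (a - b) - (v - b)); last by ring.
  apply: (le_trans (ler_normB _ _)); apply: (le_trans (lerD (ler_normD _ _) (lexx _))); lra.
exact: key Hn h1 h2.
Qed.

End vague_limits.

                                     

(** * The Lévy-Khintchine integrands near 1 *)

Section levy_integrands.
Context {R : realType} {d : nat}.
Implicit Types (p : 'rV[int]_d) (x : 'rV[R]_d).

Definition psin p x : R := ipair p (\row_j sin (x ord0 j)).

Definition zabs p : R := \sum_j `|(p ord0 j)%:~R|.

Lemma zabs_ge0 p : 0 <= zabs p.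
Proof. exact: sumr_ge0. Qed.

Lemma ipair_sum_le p x (c : R) : (forall j, `|x ord0 j| <= c) -> `|ipair p x| <= zabs p * c.
Proof.
move=> xc; apply: (le_trans (ler_norm_sum _ _ _)); rewrite /zabs mulr_suml.
by apply: ler_sum => j _; rewrite normrM ler_wpM2l.
Qed.

Lemma psin_twrap p x : psin p (twrap x) = psin p x.
Proof. by congr ipair; apply/rowP => j; rewrite !mxE sin_wrap1. Qed.

Lemma psin_sqr_le p x : psin p x ^+ 2 <= 2 * zabs p ^+ 2 * tgauge x.
Proof.
have h : `|psin p x| <= zabs p * Num.sqrt (2 * tgauge x).
  apply: ipair_sum_le => j; rewrite mxE -sqrtr_sqr ler_wsqrtr //; exact: sin_sqr_le_tgauge.
have g0 : 0 <= 2 * tgauge x by rewrite mulr_ge0 // tgauge_ge0.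
rewrite -real_normK ?num_real //; apply: (@le_trans _ _ ((zabs p * Num.sqrt (2 * tgauge x)) ^+ 2)).
  by rewrite ler_pXn2r // nnegrE // mulr_ge0 ?zabs_ge0 ?sqrtr_ge0.
by rewrite exprMn sqr_sqrtr // mulrCA mulrA.
Qed.

Definition levy_re p x : R := cos (ipair p x) - 1.
Definition levy_im p x : R := sin (ipair p x) - psin p x.
                                                                                    
(** The real integrand without its quadratic part: a remainder of third order at 1. The subtracted
    term <p, Im s>^2 / 2 is the only one whose integral can lose mass at 1. *)
Definition levy_re_corr p x : R := levy_re p x + psin p x ^+ 2 / 2.

Lemma tcontinuous_psin p : tcontinuous (psin p).
Proof.
rewrite /psin /ipair (_ : (fun x => _) = fun x => \sum_j (p ord0 j)%:~R * sin (x ord0 j)).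
  by apply: tcontinuous_sum => j; apply: tcontinuousM; [exact: tcontinuous_cst|exact: tcontinuous_sinj].
by apply/funext => x; apply: eq_bigr => j _; rewrite mxE.
Qed.

Lemma tcontinuous_levy_re p : tcontinuous (levy_re p).
Proof. by apply: tcontinuousD; [exact: tcontinuous_cos|exact: tcontinuous_cst]. Qed.

Lemma tcontinuous_levy_im p : tcontinuous (levy_im p).
Proof.
by apply: tcontinuousD; [exact: tcontinuous_sin|apply: tcontinuousN; exact: tcontinuous_psin].
Qed.

Lemma tcontinuous_psin2 p : tcontinuous (fun x => psin p x ^+ 2 / 2).
Proof.
apply: tcontinuousM; last exact: tcontinuous_cst.
by under eq_fun do rewrite expr2; apply: tcontinuousM; exact: tcontinuous_psin.
Qed.

Lemma tcontinuous_levy_re_corr p : tcontinuous (levy_re_corr p).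
Proof. by apply: tcontinuousD; [exact: tcontinuous_levy_re|exact: tcontinuous_psin2]. Qed.

Lemma tsmall_cubic (f : 'rV[R]_d -> R) (K : R) : tcontinuous f -> 0 <= K ->
  (forall x, tbox x -> `|f x| <= K * tnorm x ^+ 3) -> tsmall f.
Proof.
(* If |x| <= a then K |x|^3 <= 12 K a [tgauge x], and 12 K a <= eta. *)
move=> tf K0 fK eta eta0; pose a := eta / (12 * K + 1).
have a0 : 0 < a by rewrite divr_gt0 //; lra.
exists (a ^+ 2 / 12); first by rewrite divr_gt0 // exprn_gt0.
move=> x xa; rewrite -tf.2 -tgauge_twrap; rewrite -tgauge_twrap in xa.
move: (tbox_twrap x) xa; move: (twrap x) => {}x bx xa.
have t0 := tnorm_ge0 x; have h := tnorm_le_tgauge bx; have g0 := tgauge_ge0 x.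
have ta : tnorm x <= a.
  by rewrite -(ler_pXn2r (ltn0Sn 1)) ?nnegrE ?(ltW a0) //; apply: (le_trans h); lra.
apply: (le_trans (fK x bx)).
have h1 : K * 12 * tnorm x <= eta.
  apply: (@le_trans _ _ (12 * K * a)); first by rewrite [K * 12]mulrC ler_wpM2l // mulr_ge0.
  rewrite /a mulrA ler_pdivrMr; last by lra.
  by rewrite mulrC ler_pM2l //; lra.
have h2 : K * tnorm x * tnorm x ^+ 2 <= K * tnorm x * (12 * tgauge x).
  by rewrite ler_wpM2l // mulr_ge0.
have h3 : K * 12 * tnorm x * tgauge x <= eta * tgauge x by rewrite ler_wpM2r.
rewrite exprS; lra.
Qed.

Lemma ipair_psin_cube p x : `|ipair p x - psin p x| <= zabs p * tnorm x ^+ 3.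
Proof.
rewrite /psin -ipairN -ipairD; apply: ipair_sum_le => j; rewrite !mxE distrC.
apply: (le_trans (norm_sin_sub_cube _)).
have h : `|x ord0 j| ^+ 3 <= tnorm x ^+ 3.
  by apply: lerXn2r; rewrite ?nnegrE ?tnorm_ge0 ?coord_le_tnorm.
have := exprn_ge0 3 (tnorm_ge0 x); lra.
Qed.

Lemma ipair_psin_sqr p x : `|ipair p x - psin p x| <= zabs p * tnorm x ^+ 2.
Proof.
rewrite /psin -ipairN -ipairD; apply: ipair_sum_le => j; rewrite !mxE distrC.
apply: (le_trans (norm_sin_sub_sqr _)); rewrite -real_normK ?num_real //.
by apply: lerXn2r; rewrite ?nnegrE ?tnorm_ge0 ?coord_le_tnorm.
Qed.

Lemma ipair_tnorm p x : `|ipair p x| <= zabs p * tnorm x.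
Proof. by apply: ipair_sum_le => j; exact: coord_le_tnorm. Qed.

Lemma psin_tnorm p x : `|psin p x| <= zabs p * tnorm x.
Proof.
apply: ipair_sum_le => j; rewrite mxE; apply: (le_trans (norm_sin_le _)).
exact: coord_le_tnorm.
Qed.

Lemma tsmall_levy_im p : tsmall (levy_im p).
Proof.
have P0 := zabs_ge0 p.
apply: (@tsmall_cubic _ (zabs p ^+ 3 + zabs p)); first exact: tcontinuous_levy_im.
  by rewrite addr_ge0 // exprn_ge0.
move=> x bx; rewrite /levy_im (_ : _ - _ = (sin (ipair p x) - ipair p x) + (ipair p x - psin p x)); last by ring.
apply: (le_trans (ler_normD _ _)); rewrite mulrDl; apply: lerD; last exact: ipair_psin_cube.
apply: (le_trans (norm_sin_sub_cube _)).
have h : `|ipair p x| ^+ 3 <= (zabs p * tnorm x) ^+ 3.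
  by apply: lerXn2r; rewrite ?nnegrE ?mulr_ge0 ?tnorm_ge0 ?ipair_tnorm.
have := exprn_ge0 3 (normr_ge0 (ipair p x)); rewrite exprMn in h; lra.
Qed.

Lemma tsmall_levy_re_corr p : tsmall (levy_re_corr p).
Proof.
have P0 := zabs_ge0 p.
apply: (@tsmall_cubic _ (zabs p ^+ 3 + zabs p ^+ 2)); first exact: tcontinuous_levy_re_corr.
  by rewrite addr_ge0 // exprn_ge0.
move=> x bx; rewrite /levy_re_corr /levy_re.
rewrite (_ : _ + _ = (cos (ipair p x) - 1 + ipair p x ^+ 2 / 2) -
   (ipair p x - psin p x) * (ipair p x + psin p x) / 2); last by field.
apply: (le_trans (ler_normB _ _)); rewrite [leRHS]mulrDl; apply: lerD.
  apply: (le_trans (norm_cos_sub_cube _)); rewrite -exprMn.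
  by apply: lerXn2r; rewrite ?nnegrE ?mulr_ge0 ?tnorm_ge0 ?ipair_tnorm.
rewrite !normrM [`|2^-1|]ger0_norm ?invr_ge0 // ler_pdivrMr //.
have h1 := ipair_psin_sqr p x.
have h2 : `|ipair p x + psin p x| <= 2 * (zabs p * tnorm x).
  by apply: (le_trans (ler_normD _ _)); have := ipair_tnorm p x; have := psin_tnorm p x; lra.
apply: (le_trans (ler_pM _ _ h1 h2)) => //.
have -> : zabs p * tnorm x ^+ 2 * (2 * (zabs p * tnorm x)) = zabs p ^+ 2 * tnorm x ^+ 3 * 2 by ring.
exact: lexx.
Qed.

Lemma levy_re_le_tgauge p : exists2 C : R, 0 <= C & forall x, `|levy_re p x| <= C * tgauge x.
Proof.
have [C C0 hC] := tsmall_le_tgauge (tcontinuous_levy_re_corr p) (tsmall_levy_re_corr p).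
exists (C + zabs p ^+ 2); first by rewrite addr_ge0 // exprn_ge0 // zabs_ge0.
move=> x; rewrite (_ : levy_re p x = levy_re_corr p x - psin p x ^+ 2 / 2); last by rewrite /levy_re_corr; ring.
apply: (le_trans (ler_normB _ _)); rewrite mulrDl; apply: lerD => //.
rewrite ger0_norm; last by rewrite divr_ge0 // sqr_ge0.
by have := psin_sqr_le p x; lra.
Qed.

Lemma levy_im_le_tgauge p : exists2 C : R, 0 <= C & forall x, `|levy_im p x| <= C * tgauge x.
Proof. exact: tsmall_le_tgauge (tcontinuous_levy_im p) (tsmall_levy_im p). Qed.

End levy_integrands.

(** * Centring a law at its truncated mean *)

Section centring.
Context {R : realType} {d : nat}.
Variables (nu : probability (TB R d) R) (th : R).
Hypotheses (nut : on_torus nu) (th01 : 0 < th < 1).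

Definition trunc_mean : 'rV[R]_d := \row_j Rintegral nu (Ueps th) (fun x => x ord0 j).

Let b := trunc_mean.
Let U : set (TB R d) := Ueps th.
Let mU : measurable U := measurable_Ueps th.
Let nu_fin : (nu setT < +oo)%E := probability_setT_lty nu.

Definition centered : {measure set (TB R d) -> \bar R} := push_measure nu (measurable_twrap_sub b).

Lemma centered_setT : centered setT = 1%E.
Proof. by rewrite push_measureE preimage_setT; exact: probability_setT. Qed.

Lemma centered_lty : (centered setT < +oo)%E.
Proof. by rewrite centered_setT ltry. Qed.

Lemma tint_centered (f : 'rV[R]_d -> R) : measurable_fun setT (f : TB R d -> R) ->
  (exists M, forall x, `|f x| <= M) ->
  tint centered f = tint nu (fun x => f (twrap (x - b))).
Proof.
move=> mf [M fM]; rewrite /tint Rintegral_push_measure //.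
apply: integrable_bounded => //; last by exists M => x; exact: fM.
by apply: (measurableT_comp mf); exact: measurable_twrap_sub.
Qed.

Lemma tint_centered_tcont f : tcontinuous f -> tint centered f = tint nu (fun x => f (x - b)).
Proof.
move=> tf; rewrite tint_centered; last exact: tcontinuous_bounded.
  by rewrite /tint; apply: eq_Rintegral => x _; rewrite tf.2.
exact: tcontinuous_measurable.
Qed.

Lemma tcontinuous_shift (f : 'rV[R]_d -> R) : tcontinuous f -> tcontinuous (fun x => f (x - b)).
Proof.
move=> [cf pf]; split => [x|x].
  apply: (@continuous_comp _ _ _ (fun x : 'rV[R]_d => x - b) f x); last exact: cf.
  by apply: continuousB => //; exact: cst_continuous.
by rewrite -pf twrapD pf.
Qed.

Let th0 : 0 < th. Proof. by case/andP: th01. Qed.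
Let th1 : th < 1. Proof. by case/andP: th01. Qed.

Let cU j (x : TB R d) : R := \1_U x * (x : 'rV[R]_d) ord0 j.

Let cU_le j x : `|cU j x| <= th.
Proof.
rewrite /cU indicE; case: (boolP (x \in U)) => [|_]; last first.
  by rewrite mul0r normr0 ltW.
rewrite inE mul1r => -[_ /ltW xt]; exact: le_trans (coord_le_tnorm _ _) xt.
Qed.

Let m_cU j : measurable_fun setT (cU j).
Proof. by apply: measurable_funM; [exact: measurable_indic|exact: measurable_coord]. Qed.

Let j_cU j : nu.-integrable setT (EFin \o cU j).
Proof. by apply: integrable_bounded => //; exists th. Qed.

Let bE j : b ord0 j = \int[nu]_x cU j x.
Proof.
rewrite mxE Rintegral_mkcond; apply: eq_Rintegral => x _.
by rewrite patchE /cU indicE; case: ifP => _; rewrite ?mul1r ?mul0r.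
Qed.

Lemma mean_le_th j : `|b ord0 j| <= th.
Proof.
rewrite bE -[leRHS](Rintegral_cst1 nu); apply: norm_Rintegral_le => //.
by apply: integrable_bounded => //; exists `|th|.
Qed.

Let far eps : set (TB R d) := [set x | tbox x /\ eps <= tnorm x].

Lemma measurable_far eps : measurable (far eps).
Proof.
apply: measurableI; first exact: measurable_tbox.
rewrite (_ : (fun x => _) = ~` [set x | tnorm x < eps]).
  by apply: measurableC; exact: measurable_tnorm_lt.
by apply/seteqP; split => x /=; [rewrite leNgt => /negP|move/negP; rewrite -leNgt].
Qed.

Let jind (A : set (TB R d)) : measurable A -> nu.-integrable setT (EFin \o (\1_A : TB R d -> R)).
Proof.
move=> mA; apply: integrable_bounded => //.
by exists 1 => x; rewrite indicE; case: (_ \in _); rewrite ?normr1 ?normr0.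
Qed.

Lemma mean_small eps j : 0 <= eps -> `|b ord0 j| <= eps + fine (nu (far eps)).
Proof.
move=> e0; have mf := measurable_far eps.
rewrite bE -(Rintegral_indic _ mf) -[X in X + _](Rintegral_cst1 nu) -RintegralD //; last first.
  - exact: jind.
  - by apply: integrable_bounded => //; exists `|eps|.
apply: norm_Rintegral_le => //.
  apply: integrable_realD; last exact: jind.
  by apply: integrable_bounded => //; exists `|eps|.
move=> x; have ind0 : 0 <= \1_(far eps) x :> R by rewrite indicE.
rewrite /cU [\1_U x]indicE; case: (boolP (x \in U)) => [|_]; last first.
  by rewrite mul0r normr0 addr_ge0.
rewrite inE mul1r => -[bx xt]; apply: (le_trans (coord_le_tnorm _ _)).
have [xe|xe] := ltrP (tnorm x) eps; first by rewrite -[leLHS]addr0 lerD // ltW.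
rewrite indicE mem_set //=; have := th1; lra.
Qed.

Let G := tint centered (@tgauge R d).

Let GE : G = tint nu (fun x => tgauge (x - b)).
Proof. by rewrite /G tint_centered_tcont //; exact: tcontinuous_tgauge. Qed.

(** The gauge of x - b is at most twice that of x plus twice that of b, and the gauge of x is at
    most eps^2 / 2 inside the eps-ball and 2 d elsewhere. *)
Lemma centered_tgauge_small eps : 0 <= eps ->
  G <= eps ^+ 2 + 4 * d%:R * fine (nu (far eps)) + 2 * tgauge b.
Proof.
move=> e0; have mf := measurable_far eps.
have tgs := tcontinuous_shift (tcontinuous_tgauge (R := R) (d := d)).
rewrite GE Rintegral_twrap //; last exact: tcontinuous_measurable.
have jc (c : R) : nu.-integrable setT (EFin \o (fun _ : TB R d => c)).
  by apply: integrable_bounded => //; exists `|c|.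
rewrite -(Rintegral_indic _ mf) -(RintegralZl _ measurableT (jind mf)).
rewrite -[X in X + _ + _](Rintegral_cst1 nu) -RintegralD //; last exact: (integrable_realZ _ (jind mf)).
rewrite -[X in _ <= _ + X](Rintegral_cst1 nu) -RintegralD //; last first.
  by apply: integrable_realD => //; exact: (integrable_realZ _ (jind mf)).
have jl : nu.-integrable setT (EFin \o (fun x => tgauge (twrap x - b))).
  apply: integrable_bounded => //.
    apply: (@measurable_comp_twrap _ _ (fun x => tgauge (x - b))).
    exact: tcontinuous_measurable.
  by exists (2 * d%:R) => x; rewrite ger0_norm ?tgauge_ge0 ?tgauge_le.
rewrite -[leRHS]/(tint nu (fun x => eps ^+ 2 + 4 * d%:R * \1_(far eps) x + 2 * tgauge b)).
rewrite [leRHS]Rintegral_twrap //; last first.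
  by do 2!apply: measurable_funD => //; apply: measurable_funM => //; exact: measurable_indic.
apply: le_Rintegral => //.
  apply: integrable_bounded => //.
    apply: (@measurable_comp_twrap _ _ (fun x => eps ^+ 2 + 4 * d%:R * \1_(far eps) x + 2 * tgauge b)).
    by do 2!apply: measurable_funD => //; apply: measurable_funM => //; exact: measurable_indic.
  exists (eps ^+ 2 + 4 * d%:R + 2 * tgauge b) => x.
  rewrite ger0_norm; last first.
    rewrite !addr_ge0 ?sqr_ge0 ?mulr_ge0 ?tgauge_ge0 // indicE //.
  rewrite !lerD // indicE; case: (_ \in _); rewrite ?mulr1 ?mulr0 // mulr_ge0 //.
move=> x _; apply: (le_trans (tgaugeD _ _)); rewrite tgaugeN; apply: lerD => //.
have [xe|xe] := ltrP (tnorm (twrap x)) eps.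
  have := tgauge_le_tnorm (twrap x); have := tnorm_ge0 (twrap x).
  have : tnorm (twrap x) ^+ 2 <= eps ^+ 2.
    by apply: lerXn2r; rewrite ?nnegrE ?tnorm_ge0 // ltW.
  have : 0 <= 4 * d%:R * \1_(far eps) (twrap x) :> R by rewrite !mulr_ge0 // indicE.
  lra.
rewrite [\1_(far eps) _]indicE mem_set /=; last by split=> //; exact: tbox_twrap.
by have := tgauge_le (twrap x); have := sqr_ge0 eps; lra.
Qed.

                                                                                                     
                                        
(** The first-order term cancels because b is the truncated mean. What is left on U_theta is sin t -
    t with t = (x - b)_j, at most t^2 and hence at most 12 times the gauge. Off U_theta the gauge of
    x is at least th^2 / 12, so that of x - b is at least th^2 / 48, and the trivial bound 2 is
    absorbed by 96 / th^2 times the gauge. *)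
Lemma centered_sin_le j : tgauge b <= th ^+ 2 / 48 ->
  `|tint centered (fun x => sin (x ord0 j))| <= (12 + 96 / th ^+ 2) * G.
Proof.
move=> bsmall.
have ts := tcontinuous_shift (tcontinuous_sinj (R := R) j).
have tgs := tcontinuous_shift (tcontinuous_tgauge (R := R) (d := d)).
have js : nu.-integrable setT (EFin \o (fun x => sin ((x - b) ord0 j))) by exact: tcontinuous_integrable.
have jg : nu.-integrable setT (EFin \o (fun x => tgauge (x - b))) by exact: tcontinuous_integrable.
rewrite tint_centered_tcont; last exact: tcontinuous_sinj.
have xbE x : (x - b) ord0 j = x ord0 j - b ord0 j by rewrite 2!mxE.
(* The added function b_j - [cU j] has integral zero. *)
have EH : tint nu (fun x => sin ((x - b) ord0 j)) =
    tint nu (fun x => sin ((x - b) ord0 j) - cU j x + b ord0 j).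
  have jb : nu.-integrable setT (EFin \o (fun _ : TB R d => b ord0 j)).
    by apply: integrable_bounded => //; exists `|b ord0 j|.
  rewrite /tint RintegralD //; last exact: integrable_realB.
  rewrite RintegralB // -bE Rintegral_cst1 subrK //.
rewrite EH GE.
have t2 : 0 < th ^+ 2 by rewrite exprn_gt0.
have mL : measurable_fun setT (fun x : TB R d => sin ((x - b) ord0 j) - cU j x + b ord0 j).
  apply: measurable_funD => //; apply: measurable_funB => //.
  exact: (tcontinuous_measurable ts).
rewrite Rintegral_twrap // [in leRHS]Rintegral_twrap //; last exact: (tcontinuous_measurable tgs).
have jgw : nu.-integrable setT (EFin \o (fun x => tgauge (twrap x - b))).
  apply: integrable_bounded => //.
    apply: (@measurable_comp_twrap _ _ (fun x => tgauge (x - b))).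
    exact: (tcontinuous_measurable tgs).
  by exists (2 * d%:R) => x; rewrite ger0_norm ?tgauge_ge0 ?tgauge_le.
rewrite /tint -(RintegralZl _ measurableT jgw).
apply: norm_Rintegral_le.
- apply: integrable_bounded => //; first exact: (measurable_comp_twrap mL).
  exists (1 + th + th) => x; apply: (le_trans (ler_normD _ _)); apply: lerD; last exact: mean_le_th.
  by apply: (le_trans (ler_normB _ _)); apply: lerD; [exact: sin_max|exact: cU_le].
- exact: (integrable_realZ _ jgw).
move=> x; move: (twrap x) (tbox_twrap x) => {}x bx.
have g0 := tgauge_ge0 (x - b).
have K0 : 0 <= 96 / th ^+ 2 * tgauge (x - b) by rewrite mulr_ge0 // divr_ge0 // ltW.
have pi2 := @pi_ge2 R.
rewrite /cU indicE; case: (boolP (x \in U)) => [|].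
  rewrite inE mul1r => -[_ xth].
  have xj := coord_le_tnorm x j; have bj := mean_le_th j.
  have tj : `|(x - b) ord0 j| <= pi.
    rewrite xbE; apply: (le_trans (ler_normB _ _)); have := th1; lra.
  rewrite (_ : _ - x ord0 j + _ = sin ((x - b) ord0 j) - (x - b) ord0 j); last first.
    by rewrite [X in _ = _ - X]xbE; ring.
  apply: (le_trans (norm_sin_sub_sqr _)); apply: (le_trans (sqr_le_onem_cos tj)).
  by have := onem_cos_le_tgauge (x - b) j; rewrite mulrDl; lra.
rewrite notin_setE mul0r subr0 => nU.
have xth : th <= tnorm x by rewrite leNgt; apply/negP => h; apply: nU.
have gx : th ^+ 2 / 12 <= tgauge x.
  have := tnorm_le_tgauge bx; have : th ^+ 2 <= tnorm x ^+ 2.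
    by apply: lerXn2r; rewrite ?nnegrE ?tnorm_ge0 // ltW.
  lra.
have gxb : th ^+ 2 / 48 <= tgauge (x - b).
  have := tgaugeD (x - b) b; rewrite subrK; lra.
have one : 1 <= 48 / th ^+ 2 * tgauge (x - b).
  by rewrite mulrAC ler_pdivlMr // mul1r; lra.
apply: (le_trans (ler_normD _ _)).
have := sin_max ((x - b) ord0 j); have := mean_le_th j; have := th1; rewrite mulrDl; lra.
Qed.

End centring.

                                                  

(** * Unit complex numbers, iterated convolutions and characteristic functions *)

Section unit_complex.
Context {R : realType}.
Implicit Types (t : R) (z w : R[i]).

Definition eix t : R[i] := cexp (Complex 0 t).

Lemma eixE t : eix t = Complex (cos t) (sin t).
Proof. by rewrite /eix /cexp /= expR0 !mul1r. Qed.

Lemma eixD s t : eix (s + t) = eix s * eix t.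
Proof. by rewrite /eix -cexpD; congr cexp; rewrite /GRing.add /= addr0. Qed.

Lemma eix0 : eix 0 = 1.
Proof. by rewrite eixE cos0 sin0. Qed.

Lemma normc_eix t : Normc.normc (eix t) = 1.
Proof. by rewrite /eix normc_cexp expR0. Qed.

Lemma normc_prod I (s : seq I) (a : I -> R[i]) :
  Normc.normc (\prod_(i <- s) a i) = \prod_(i <- s) Normc.normc (a i).
Proof. by rewrite (big_morph _ (@Normc.normcM R) (@Normc.normc1 R)). Qed.

Lemma cexp_sum I (s : seq I) (a : I -> R[i]) :
  cexp (\sum_(i <- s) a i) = \prod_(i <- s) cexp (a i).
Proof. by rewrite (big_morph _ (@cexpD R) (@cexp0 R)). Qed.

Lemma eix_sum I (s : seq I) (a : I -> R) :
  eix (\sum_(i <- s) a i) = \prod_(i <- s) eix (a i).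
Proof. by rewrite (big_morph _ eixD eix0). Qed.

Lemma prod_sub_le n (a c : nat -> R[i]) :
  (forall k, (k < n)%N -> Normc.normc (a k) <= 1) ->
  (forall k, (k < n)%N -> Normc.normc (c k) <= 1) ->
  Normc.normc (\prod_(k < n) a k - \prod_(k < n) c k) <= \sum_(k < n) Normc.normc (a k - c k).
Proof.
elim: n => [|n IH] ha hc; first by rewrite !big_ord0 subrr Normc.normc0.
rewrite !big_ord_recr /=.
set A := \prod_(k < n) a k; set C := \prod_(k < n) c k.
have -> : A * a n - C * c n = (A - C) * a n + C * (a n - c n) by ring.
apply: (le_trans (le_normcD _ _)); rewrite !Normc.normcM; apply: lerD.
  rewrite -[leRHS]mulr1; apply: ler_pM; rewrite ?normc_ge0 ?ha //.
  by apply: IH => k kn; [apply: ha|apply: hc]; exact: ltnW.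
rewrite -[leRHS]mul1r ler_wpM2r ?normc_ge0 // /C normc_prod.
apply: prodr_ile1 => k _; rewrite normc_ge0 /=; apply: hc.
by rewrite ltnW // ltnS ltn_ord.
Qed.

End unit_complex.

Section convolutions.
Context {R : realType} {d : nat}.
Implicit Types (p : 'rV[int]_d) (x : 'rV[R]_d) (l : seq (probability (TB R d) R)) (f : 'rV[R]_d -> R).

Lemma eix_ipair_twrap p x : eix (ipair p (twrap x)) = eix (ipair p x).
Proof. by rewrite !eixE cos_ipair_twrap sin_ipair_twrap. Qed.

Lemma tcontinuous_conv (nu : probability (TB R d) R) f : tcontinuous f ->
  tcontinuous (fun x => tint nu (fun t => f (tmul x t))).
Proof.
move=> tf.
have tfx x : tcontinuous (fun t => f (tmul x t)).
  split=> [t|t]; last by rewrite /tmul addrC twrapD addrC.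
  rewrite (_ : (fun t => _) = fun t => f (x + t)); last by apply/funext => u; rewrite tmulE.
  apply: (@continuous_comp _ _ _ (fun t : 'rV[R]_d => x + t) f t); last exact: tf.1.
  by apply: continuousD => //; exact: cst_continuous.
have jf x : nu.-integrable setT (EFin \o (fun t => f (tmul x t))).
  by apply: tcontinuous_integrable => //; exact: probability_setT_lty.
split=> [x|x]; last first.
  rewrite /tint; apply: eq_Rintegral => t _; congr f; exact: twrapD.
move=> A /nbhs_ballP[e /= e0 eA]; have e2 : 0 < e / 2 by rewrite divr_gt0.
have [delta d0 Hd] := tcontinuous_uniform tf e2.
apply/nbhs_ballP; exists delta => // y [_ xy]; apply: eA; rewrite /ball /=.
apply: (@le_lt_trans _ _ (e / 2)); last by rewrite ltr_pdivrMr // ltr_pMr // ltr1n.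
rewrite /tint -RintegralB // -[leRHS](Rintegral_cst1 nu).
apply: norm_Rintegral_le; first exact: integrable_realB.
  apply: integrable_bounded => //; first exact: probability_setT_lty.
  by exists `|e / 2|.
move=> t; rewrite !tmulE //; apply/ltW/Hd => j.
by rewrite !mxE opprD addrACA subrr addr0; exact: xy.
Qed.

Lemma tcontinuous_iconv l f : tcontinuous f -> tcontinuous (iconv l f).
Proof. by move=> tf; elim: l => [|nu l IH] //=; exact: tcontinuous_conv. Qed.

Lemma conv_integrable (nu : probability (TB R d) R) f x : tcontinuous f ->
  nu.-integrable setT (EFin \o (fun t => f (tmul x t))).
Proof.
move=> tf; apply: integrable_bounded; first exact: probability_setT_lty.
  apply: (@measurableT_comp _ _ _ _ (TB R d) _ f); first exact: tcontinuous_measurable.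
  exact: measurable_tmul.
by have [M fM] := tcontinuous_bounded tf; exists M => t; exact: fM.
Qed.

Lemma tmean_tint (nu : probability (TB R d) R) : tmean (tint nu).
Proof.
have jf f : tcontinuous f -> nu.-integrable setT (EFin \o f).
  by move=> tf; apply: tcontinuous_integrable => //; exact: probability_setT_lty.
split=> [f h tf th|c f tf|f h eta tf th fh].
- by rewrite /tint RintegralD //; exact: jf.
- by rewrite /tint RintegralZl //; exact: jf.
rewrite /tint -RintegralB //; [|exact: jf|exact: jf].
rewrite -[leRHS](Rintegral_cst1 nu); apply: norm_Rintegral_le => //.
  by apply: integrable_realB; exact: jf.
apply: integrable_bounded => //; first exact: probability_setT_lty.
by exists `|eta|.
Qed.

Lemma tmean_iconv l x : tmean (fun f => iconv l f x).
Proof.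
elim: l x => [|nu l IH] x.
  by split => //= f h eta _ _ fh; exact: fh.
split=> [f h tf th|c f tf|f h eta tf th fh] /=.
- rewrite /tint -RintegralD //; try by apply: conv_integrable; exact: tcontinuous_iconv.
  by apply: eq_Rintegral => t _; case: (IH (tmul x t)) => -> //.
- rewrite /tint -RintegralZl //; last by apply: conv_integrable; exact: tcontinuous_iconv.
  by apply: eq_Rintegral => t _; case: (IH (tmul x t)) => _ -> //.
have ti := tcontinuous_iconv l tf; have ti' := tcontinuous_iconv l th.
have j1 := conv_integrable nu x ti; have j2 := conv_integrable nu x ti'.
rewrite /tint -RintegralB // -[leRHS](Rintegral_cst1 nu).
apply: norm_Rintegral_le; first exact: integrable_realB.
  by apply: integrable_bounded => //; [exact: probability_setT_lty|exists `|eta|].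
by move=> t; case: (IH (tmul x t)) => _ _; apply.
Qed.

Lemma iconv_charfun l p x :
  Complex (iconv l (fun y => cos (ipair p y)) x) (iconv l (fun y => sin (ipair p y)) x) =
  eix (ipair p x) * \prod_(nu <- l) charfun nu p.
Proof.
elim: l x => [|nu l IH] x; first by rewrite big_nil mulr1 eixE.
rewrite big_cons /=; set P := \prod_(nu <- l) charfun nu p.
have tc := tcontinuous_cos (R := R) p; have ts := tcontinuous_sin (R := R) p.
have jf f : tcontinuous f -> nu.-integrable setT (EFin \o f).
  by move=> tf; apply: tcontinuous_integrable => //; exact: probability_setT_lty.
have E t := IH (tmul x t).
have e1 t : iconv l (fun y => cos (ipair p y)) (tmul x t) =
   complex.Re (eix (ipair p x) * P) * cos (ipair p t) + - complex.Im (eix (ipair p x) * P) * sin (ipair p t).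
  have := congr1 (@complex.Re R) (E t); rewrite /= eix_ipair_twrap ipairD eixD => ->.
  by rewrite mulrAC; move: (_ * P) => [a b]; rewrite eixE; simpc => /=; ring.
have e2 t : iconv l (fun y => sin (ipair p y)) (tmul x t) =
   complex.Im (eix (ipair p x) * P) * cos (ipair p t) + complex.Re (eix (ipair p x) * P) * sin (ipair p t).
  have := congr1 (@complex.Im R) (E t); rewrite /= eix_ipair_twrap ipairD eixD => ->.
  by rewrite mulrAC; move: (_ * P) => [a b]; rewrite eixE; simpc => /=; ring.
rewrite /tint; under eq_Rintegral do rewrite e1.
under [X in Complex _ X]eq_Rintegral do rewrite e2.
rewrite !RintegralD //; try by apply: integrable_realZ; exact: jf.
rewrite !RintegralZl //; try exact: jf.
rewrite mulrCA [RHS]mulrC; move: (eix _ * P) => [a b]; rewrite /charfun /tint; simpc.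
by congr Complex => /=; ring.
Qed.

Lemma charfun_le1 (mu : {measure set (TB R d) -> \bar R}) p : mu setT = 1%E ->
  Normc.normc (charfun mu p) <= 1.
Proof.
move=> mu1; have mufin : (mu setT < +oo)%E by rewrite mu1 ltry.
have tc := tcontinuous_cos (R := R) p; have ts := tcontinuous_sin (R := R) p.
have jf f : tcontinuous f -> mu.-integrable setT (EFin \o f).
  by move=> tf; apply: tcontinuous_integrable.
rewrite -(ler_pXn2r (ltn0Sn 1)) ?nnegrE ?normc_ge0 // expr1n normc_sqr /=.
set a := tint mu _; set s := tint mu _.
(* Integrating a cos + s sin <= (a^2 + s^2 + 1)/2, where a and s are themselves the integrals of cos
   and sin, yields a^2 + s^2 <= 1. *)
have h : a * a + s * s <= (a ^+ 2 + s ^+ 2 + 1) / 2.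
  have -> : (a ^+ 2 + s ^+ 2 + 1) / 2 = \int[mu]_x ((a ^+ 2 + s ^+ 2 + 1) / 2).
    by rewrite Rintegral_cst // mu1 /= mulr1.
  rewrite {2}/a {2}/s /tint -!RintegralZl //; [|exact: jf|exact: jf].
  rewrite -RintegralD //; [|exact: (integrable_realZ _ (jf _ tc))|exact: (integrable_realZ _ (jf _ ts))].
  apply: le_Rintegral => //.
  - by apply: integrable_realD; apply: integrable_realZ; exact: jf.
  - by apply: integrable_bounded => //; exists `|(a ^+ 2 + s ^+ 2 + 1) / 2|.
  move=> x _; have := cos2Dsin2 (ipair p x).
  have := sqr_ge0 (a - cos (ipair p x)); have := sqr_ge0 (s - sin (ipair p x)); lra.
lra.
Qed.

Lemma charfun_centered (nu : probability (TB R d) R) (th : R) p :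
  charfun nu p = eix (ipair p (trunc_mean nu th)) * charfun (centered nu th) p.
Proof.
have tc := tcontinuous_cos (R := R) p; have ts := tcontinuous_sin (R := R) p.
have jf f : tcontinuous f -> nu.-integrable setT (EFin \o f).
  by move=> tf; apply: tcontinuous_integrable => //; exact: probability_setT_lty.
rewrite /charfun !tint_centered_tcont //; set b := trunc_mean nu th.
have tc' := tcontinuous_shift nu th tc; have ts' := tcontinuous_shift nu th ts.
rewrite eixE; simpc; rewrite /tint -!RintegralZl //; try exact: jf.
rewrite -RintegralB -?RintegralD //; try (apply: integrable_realZ; exact: jf).
congr Complex; apply: eq_Rintegral => x _.
  by rewrite -cosD -/b; congr cos; rewrite -ipairD addrC subrK.
by rewrite addrC -sinD -/b; congr sin; rewrite -ipairD addrC subrK.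
Qed.

End convolutions.

                             

(** * The triangular array and its accompanying laws *)

Section array.
Context {R : realType} {d : nat}.
Variables (th : R) (kn : nat -> nat) (nu : nat -> nat -> probability (TB R d) R).
Variable xi : nat -> 'rV[R]_d.
Hypotheses (th01 : 0 < th < 1) (nut : forall n k, on_torus (nu n k)).
Implicit Types (p : 'rV[int]_d) (f : 'rV[R]_d -> R).

Definition row_measure n : {measure set (TB R d) -> \bar R} :=
  msum (fun k => centered (nu n k) th) (kn n).

Lemma row_measure_lty n : (row_measure n setT < +oo)%E.
Proof. by apply: msum_lty => k; exact: centered_lty. Qed.

Lemma tint_row_measure n f : measurable_fun setT (f : TB R d -> R) -> (exists M, forall x, `|f x| <= M) ->
  tint (row_measure n) f = \sum_(k < kn n) tint (centered (nu n k) th) f.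
Proof.
move=> mf [M fM]; rewrite /tint Rintegral_msum //; last by exists M.
by move=> k; exact: centered_lty.
Qed.

Lemma tint_row_measure_tcont n f : tcontinuous f ->
  tint (row_measure n) f = \sum_(k < kn n) tint (centered (nu n k) th) f.
Proof.
by move=> tf; apply: tint_row_measure; [exact: tcontinuous_measurable|exact: tcontinuous_bounded].
Qed.

Lemma rho_intE n f : measurable_fun setT (f : TB R d -> R) -> (exists M, forall x, `|f x| <= M) ->
  rho_int th kn nu n f = tint (row_measure n) f.
Proof.
by move=> mf bf; rewrite tint_row_measure //; apply: eq_bigr => k _; rewrite tint_centered.
Qed.

Lemma rho_int_tcont n f : tcontinuous f -> rho_int th kn nu n f = tint (row_measure n) f.
Proof.
by move=> tf; apply: rho_intE; [exact: tcontinuous_measurable|exact: tcontinuous_bounded].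
Qed.

Let G n k := tint (centered (nu n k) th) (@tgauge R d).
Let b n k := trunc_mean (nu n k) th.

Lemma centered_tgauge_ge0 n k : 0 <= G n k.
Proof. by apply: Rintegral_ge0 => x _; exact: tgauge_ge0. Qed.

Lemma row_measure_tgaugeE n : tint (row_measure n) tgauge = \sum_(k < kn n) G n k.
Proof. by rewrite tint_row_measure_tcont //; exact: tcontinuous_tgauge. Qed.

Definition row_small n (eta : R) :=
  forall k, (k < kn n)%N -> tgauge (b n k) <= eta /\ G n k <= eta.

Lemma infinitesimal_small : infinitesimal kn nu ->
  forall eta, 0 < eta -> \forall n \near \oo, row_small n eta.
Proof.
move=> [_ inf] eta eta0.
(* With every far mass at most c, the entries of b are at most 2 c, so its gauge is at most d c and
   G <= c^2 + 4 d c + 2 d c <= (1 + 6 d) c <= eta; c <= 1/2 absorbs the squares. *)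
pose c := Num.min (1 / 2) (eta / (1 + 6 * d%:R)).
have D0 : 0 <= d%:R :> R by [].
have c0 : 0 < c by rewrite lt_min divr_gt0 //= divr_gt0 //; lra.
have c1 : c <= 1 / 2 by rewrite ge_min lexx.
have ceta : (1 + 6 * d%:R) * c <= eta.
  by rewrite mulrC -ler_pdivlMr; [rewrite ge_min lexx orbT|lra].
have /fine_cvgP[fn /cvgrPdist_le/(_ _ c0)] := inf c c0.
move: fn; apply: filterS2 => n fn hn k kkn.
set B := \big[maxe/0%E]_(i < _) _ in fn hn.
pose F : set (TB R d) := [set x | tbox x /\ c <= tnorm x].
have far_le : fine (nu n k F) <= c.
  have h1 : (nu n k F <= B)%E.
    by rewrite /B (bigD1 (Ordinal kkn)) //= le_max lexx.
  apply: (@le_trans _ _ (fine B)); last by have := hn; rewrite sub0r normrN; apply: le_trans; exact: ler_norm.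
  apply: fine_le => //; rewrite ge0_fin_numE ?measure_ge0 //.
  by apply: (le_lt_trans h1); rewrite ltey_eq fn.
have bj j : b n k ord0 j ^+ 2 <= 2 * c.
  have := mean_small (nu n k) th01 j (ltW c0).
  rewrite -/(b n k) => h; have hb : `|b n k ord0 j| <= 2 * c by lra.
  rewrite -real_normK ?num_real //.
  have := normr_ge0 (b n k ord0 j); nra.
have tb : tgauge (b n k) <= d%:R * c.
  apply: (le_trans (tgauge_le_tnorm _)); rewrite tnorm_sqr ler_pdivrMr //.
  apply: (le_trans (ler_sum _ (fun j _ => bj j))).
  by rewrite sumr_const card_ord -mulr_natl; lra.
split; first by apply: (le_trans tb); lra.
have := centered_tgauge_small th (nut n k) (ltW c0); rewrite -/(G n k) -/(b n k) => h.
have : 4 * d%:R * fine (nu n k [set x | tbox x /\ c <= tnorm x]) <= 4 * d%:R * c.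
  by rewrite ler_wpM2l // mulr_ge0.
have : c ^+ 2 <= c by nra.
lra.
Qed.

Let psi n k p := charfun (centered (nu n k) th) p.
Let K : R := 12 + 96 / th ^+ 2.

Let K_ge0 : 0 <= K.
Proof. by rewrite addr_ge0 // divr_ge0 // sqr_ge0. Qed.

Let ssin n k : 'rV[R]_d := \row_j tint (centered (nu n k) th) (fun x => sin (x ord0 j)).

Let jf n k f : tcontinuous f -> (centered (nu n k) th).-integrable setT (EFin \o f).
Proof. by move=> tf; apply: tcontinuous_integrable => //; exact: centered_lty. Qed.

Let tint_psin n k p : tint (centered (nu n k) th) (psin p) = ipair p (ssin n k).
Proof.
rewrite /ipair (eq_bigr (fun j => \int[centered (nu n k) th]_x ((p ord0 j)%:~R * sin (x ord0 j)))).
  rewrite -Rintegral_sum; last first.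
    by move=> j; apply: integrable_realZ; apply: jf; exact: tcontinuous_sinj.
  by apply: eq_Rintegral => x _; apply: eq_bigr => j _; rewrite mxE.
move=> j _; rewrite mxE [RHS]RintegralZl //; apply: jf; exact: tcontinuous_sinj.
Qed.

Let psi_sub1 n k p : psi n k p - 1 =
  Complex (tint (centered (nu n k) th) (levy_re p))
    (tint (centered (nu n k) th) (levy_im p) + ipair p (ssin n k)).
Proof.
have tc := tcontinuous_cos (R := R) p; have ts := tcontinuous_sin (R := R) p.
rewrite -tint_psin /psi /charfun; simpc; congr Complex.
  rewrite /tint /levy_re RintegralB //; [|exact: jf|]; last first.
    by apply: jf; exact: tcontinuous_cst.
  by rewrite Rintegral_cst // centered_setT mulr1.
rewrite /tint -RintegralD //; last 2 first.
- by apply: jf; exact: tcontinuous_levy_im.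
- by apply: jf; exact: tcontinuous_psin.
by apply: eq_Rintegral => x _; rewrite /levy_im subrK.
Qed.

Lemma ssin_le n k j : tgauge (b n k) <= th ^+ 2 / 48 -> `|ssin n k ord0 j| <= K * G n k.
Proof. by move=> tb; rewrite mxE; exact: (centered_sin_le (nut n k) th01). Qed.

Lemma psi_sub1_le p : exists2 C : R, 0 <= C & forall n k,
  tgauge (b n k) <= th ^+ 2 / 48 -> Normc.normc (psi n k p - 1) <= C * G n k.
Proof.
have [C1 C10 h1] := levy_re_le_tgauge (R := R) p; have [C2 C20 h2] := levy_im_le_tgauge (R := R) p.
exists (C1 + (C2 + zabs p * K)); first by rewrite !addr_ge0 // mulr_ge0 // zabs_ge0.
move=> n k tb; rewrite psi_sub1; apply: (le_trans (normc_le_sum _)) => /=.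
have jg := jf n k (tcontinuous_tgauge (R := R) (d := d)).
have bnd f C : tcontinuous f -> (forall x, `|f x| <= C * tgauge x) ->
    `|tint (centered (nu n k) th) f| <= C * G n k.
  move=> tf fC; rewrite /G /tint -RintegralZl //.
  by apply: norm_Rintegral_le => //; [exact: jf|exact: integrable_realZ].
rewrite !mulrDl; apply: lerD; first by apply: bnd => //; exact: tcontinuous_levy_re.
apply: (le_trans (ler_normD _ _)); apply: lerD; first by apply: bnd => //; exact: tcontinuous_levy_im.
by rewrite -mulrA; apply: ipair_sum_le => j; exact: ssin_le.
Qed.

Definition array_cf n p : R[i] := eix (ipair p (xi n)) * \prod_(k < kn n) charfun (nu n k) p.

(** The Lévy-Khintchine expression with triplet (gamma_n, 0, rho_n). *)
Definition levy_approx n p : R[i] :=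
  eix (ipair p (gam_n th kn nu xi n)) * cexp (levy_int (row_measure n) p).

Lemma iconv_arow n p :
  Complex (iconv (arow kn nu n) (fun y => cos (ipair p y)) (xi n))
          (iconv (arow kn nu n) (fun y => sin (ipair p y)) (xi n)) = array_cf n p.
Proof.
rewrite iconv_charfun /array_cf /arow big_map; congr (_ * _).
by rewrite -(big_mkord xpredT (fun k => charfun (nu n k) p)) /index_iota subn0.
Qed.

Lemma ipair_sum p I (s : seq I) (v : I -> 'rV[R]_d) :
  ipair p (\sum_(i <- s) v i) = \sum_(i <- s) ipair p (v i).
Proof.
apply: (big_morph (ipair p)) => [x y|]; first exact: ipairD.
by rewrite /ipair big1 // => j _; rewrite mxE mulr0.
Qed.

Lemma Complex_sum I (s : seq I) (u v : I -> R) :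
  \sum_(i <- s) Complex (u i) (v i) = Complex (\sum_(i <- s) u i) (\sum_(i <- s) v i).
Proof.
elim: s => [|i s IH]; first by rewrite !big_nil.
by rewrite !big_cons IH.
Qed.

(** The sine means built into gamma_n cancel the linear compensator of the Lévy integral, so what
    remains besides the translations is the product of the exp(psi - 1). This explains the form of
    gamma_n. *)
Lemma levy_approxE n p : levy_approx n p =
  eix (ipair p (xi n)) * (\prod_(k < kn n) eix (ipair p (b n k))) *
  \prod_(k < kn n) cexp (psi n k p - 1).
Proof.
rewrite /levy_approx /gam_n eix_ipair_twrap ipairD eixD -!mulrA; congr (_ * _).
rewrite ipair_sum eix_sum.
have -> : levy_int (row_measure n) p = \sum_(k < kn n)
    Complex (tint (centered (nu n k) th) (levy_re p)) (tint (centered (nu n k) th) (levy_im p)).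
  rewrite -[LHS]/(Complex (tint (row_measure n) (levy_re p)) (tint (row_measure n) (levy_im p))).
  rewrite !tint_row_measure_tcont; [|exact: tcontinuous_levy_im|exact: tcontinuous_levy_re].
  by rewrite Complex_sum.
rewrite cexp_sum -!big_split; apply: eq_bigr => k _ /=.
rewrite ipairD eixD eix_ipair_twrap -mulrA; congr (_ * _).
have -> : (\row_j ring_int th nu n k (fun s : 'rV_d => sin (s ord0 j))) = ssin n k.
  apply/rowP => j; rewrite !mxE tint_centered //.
  - by apply: tcontinuous_measurable; exact: tcontinuous_sinj.
  - by apply: tcontinuous_bounded; exact: tcontinuous_sinj.
rewrite psi_sub1 /eix -cexpD; congr cexp; rewrite /GRing.add /=.
by congr Complex; rewrite ?add0r // addrC.
Qed.

Lemma array_cfE n p : array_cf n p =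
  eix (ipair p (xi n)) * (\prod_(k < kn n) eix (ipair p (b n k))) * \prod_(k < kn n) psi n k p.
Proof.
rewrite /array_cf -mulrA -big_split /=; congr (_ * _); apply: eq_bigr => k _.
exact: charfun_centered.
Qed.

Lemma normc_array_cf n p : Normc.normc (array_cf n p) = \prod_(k < kn n) Normc.normc (psi n k p).
Proof.
rewrite array_cfE !Normc.normcM normc_eix mul1r !normc_prod big1 ?mul1r // => k _.
exact: normc_eix.
Qed.

                                                                         
(** All factors have modulus at most 1, so the products differ by at most the sum of |psi - exp(psi
    - 1)| <= 4 |psi - 1|^2 <= 4 C^2 G^2, and one factor G is bounded by eta. *)
Lemma array_approx p : exists2 C : R, 0 <= C & forall n (eta : R), eta <= th ^+ 2 / 48 ->
  row_small n eta -> Normc.normc (array_cf n p - levy_approx n p) <= C * eta * tint (row_measure n) tgauge.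
Proof.
have [C C0 hC] := psi_sub1_le p.
exists (4 * C ^+ 2); first by rewrite mulr_ge0 // sqr_ge0.
move=> n eta eth sm; rewrite array_cfE levy_approxE -mulrBr !Normc.normcM normc_eix mul1r.
rewrite normc_prod big1 ?mul1r; last by move=> k _; exact: normc_eix.
have re_le k : complex.Re (psi n k p - 1) <= 0.
  rewrite psi_sub1 /=; rewrite -oppr_ge0 /tint.
  have -> : - (\int[centered (nu n k) th]_x levy_re p x) = \int[centered (nu n k) th]_x ((-1) * levy_re p x).
    by rewrite RintegralZl ?mulN1r //; apply: jf; exact: tcontinuous_levy_re.
  by apply: Rintegral_ge0 => x _; rewrite /levy_re mulN1r opprB onem_cos_ge0.
apply: (le_trans (@prod_sub_le R (kn n) (fun k => psi n k p) (fun k => cexp (psi n k p - 1)) _ _)).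
- by move=> k _; apply: charfun_le1; exact: centered_setT.
- by move=> k _; rewrite normc_cexp -expR0 ler_expR.
rewrite row_measure_tgaugeE mulr_sumr; apply: ler_sum => k _.
have [tb gk] := sm k (ltn_ord k).
have := cexp_sub_sqr (re_le k); rewrite [1 + _]addrC subrK -normcN opprB => /le_trans; apply.
have h := hC n k (le_trans tb eth); have n0 := normc_ge0 (psi n k p - 1).
have g0 := centered_tgauge_ge0 n k.
have h2 : Normc.normc (psi n k p - 1) ^+ 2 <= (C * G n k) ^+ 2.
  by apply: lerXn2r; rewrite ?nnegrE // mulr_ge0.
have h3 : C ^+ 2 * G n k * G n k <= C ^+ 2 * eta * G n k.
  by rewrite ler_wpM2r // ler_wpM2l // sqr_ge0.
rewrite exprMn in h2; lra.
Qed.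

                                                                                                    
                                                             
(** Let q be the squared modulus of psi at a coordinate character. From q <= exp(q - 1) and the
    lower bound c on the product, the sum of the 1 - q over the row is at most -ln c. Conversely,
    summed over the coordinates, the 1 - q control G/2, because the sine means contribute only O(eta
    G). *)
Lemma array_mass n (eta c : R) : eta <= th ^+ 2 / 48 -> eta <= 1 ->
  d%:R * K ^+ 2 * eta <= 1 / 2 -> row_small n eta -> 0 < c ->
  (forall j, c <= Normc.normc (array_cf n (zdelta j)) ^+ 2) ->
  tint (row_measure n) tgauge <= 2 * d%:R * - ln c.
Proof.
move=> eth e1 dK sm c0 hc.
pose q j k := Normc.normc (psi n k (zdelta j)) ^+ 2.
have sum_le j : \sum_(k < kn n) (1 - q j k) <= - ln c.
  rewrite lerNr -ler_expR lnK ?posrE //; apply: (le_trans (hc j)).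
  rewrite normc_array_cf -prodrXl -sumrN (big_morph _ (@expRD R) (@expR0 R)).
  apply: ler_prod => k _; rewrite sqr_ge0 /= opprB.
  by have := expR_ge1Dx (q j k - 1); rewrite addrC subrK.
have row_le k : (k < kn n)%N -> G n k <= 2 * \sum_j (1 - q j k).
  move=> kkn; have [tb gk] := sm k kkn; have g0 := centered_tgauge_ge0 n k.
  pose a j := tint (centered (nu n k) th) (fun x => 1 - cos (x ord0 j)).
  have GE : G n k = \sum_j a j.
    rewrite /G /tgauge /tint Rintegral_sum // => j; apply: jf.
    apply: tcontinuousD; first exact: tcontinuous_cst.
    by apply: tcontinuousN; under eq_fun do rewrite -ipair_zdelta; exact: tcontinuous_cos.
  have a0 j : 0 <= a j by apply: Rintegral_ge0 => x _; exact: onem_cos_ge0.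
  have aG j : a j <= G n k by rewrite GE (bigD1 j) //= lerDl sumr_ge0.
  have qE j : q j k = (1 - a j) ^+ 2 + ssin n k ord0 j ^+ 2.
    rewrite /q normc_sqr /psi /charfun /=; congr (_ ^+ 2 + _ ^+ 2).
      rewrite /a /tint RintegralB //; last 2 first.
      - by apply: jf; exact: tcontinuous_cst.
      - by apply: jf; under eq_fun do rewrite -ipair_zdelta; exact: tcontinuous_cos.
      rewrite Rintegral_cst // centered_setT mulr1 opprB addrC subrK.
      by apply: eq_Rintegral => x _; rewrite ipair_zdelta.
    by rewrite mxE; apply: eq_Rintegral => x _; rewrite ipair_zdelta.
  have s2 j : ssin n k ord0 j ^+ 2 <= K ^+ 2 * eta * G n k.
    have h := ssin_le j (le_trans tb eth).
    rewrite -real_normK ?num_real //.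
    have h2 : `|ssin n k ord0 j| ^+ 2 <= (K * G n k) ^+ 2.
      by apply: lerXn2r; rewrite ?nnegrE // mulr_ge0.
    have h3 : K ^+ 2 * G n k * G n k <= K ^+ 2 * eta * G n k.
      by rewrite ler_wpM2r // ler_wpM2l // sqr_ge0.
    by rewrite exprMn in h2; lra.
  (* Here 1 - q = 2 a - a^2 minus the squared sine mean, and a^2 <= a since a <= G <= eta <= 1. *)
  have one j : a j - K ^+ 2 * eta * G n k <= 1 - q j k.
    have := s2 j; rewrite qE; have := a0 j; have := aG j; nra.
  have : \sum_j (a j - K ^+ 2 * eta * G n k) <= \sum_j (1 - q j k) by apply: ler_sum.
  rewrite sumrB -GE sumr_const card_ord -mulr_natl.
  have : d%:R * K ^+ 2 * eta * G n k <= 1 / 2 * G n k by rewrite ler_wpM2r.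
  lra.
rewrite row_measure_tgaugeE; apply: (@le_trans _ _ (\sum_(k < kn n) 2 * \sum_j (1 - q j k))).
  by apply: ler_sum => k _; exact: row_le.
rewrite -mulr_sumr exchange_big /= -mulrA ler_pM2l //.
apply: (le_trans (ler_sum _ (fun j _ => sum_le j))).
by rewrite sumr_const card_ord -[leLHS]mulr_natl.
Qed.

End array.

                       

(** * Convergence of complex sequences and subsequence criteria *)

Section complex_convergence.
Context {R : realType}.
Implicit Types (u v : nat -> R[i]) (z w : R[i]).

Definition ccvg u z := (fun n => complex.Re (u n)) @ \oo --> complex.Re z /\
  (fun n => complex.Im (u n)) @ \oo --> complex.Im z.

Lemma ReM z w : complex.Re (z * w) = complex.Re z * complex.Re w - complex.Im z * complex.Im w.
Proof. by case: z w => [a b] [x y]. Qed.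

Lemma ImM z w : complex.Im (z * w) = complex.Re z * complex.Im w + complex.Im z * complex.Re w.
Proof. by case: z w => [a b] [x y] /=; rewrite addrC. Qed.

Lemma ccvgM u v z w : ccvg u z -> ccvg v w -> ccvg (fun n => u n * v n) (z * w).
Proof.
move=> [ur ui] [vr vi]; split.
  by under eq_fun do rewrite ReM; rewrite ReM; apply: cvgB; apply: cvgM.
by under eq_fun do rewrite ImM; rewrite ImM; apply: cvgD; apply: cvgM.
Qed.

Lemma ccvg_cst z : ccvg (fun=> z) z.
Proof. by split; exact: cvg_cst. Qed.

Lemma ccvg_prod I (s : seq I) (u : I -> nat -> R[i]) (z : I -> R[i]) :
  (forall i, ccvg (u i) (z i)) ->
  ccvg (fun n => \prod_(i <- s) u i n) (\prod_(i <- s) z i).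
Proof.
move=> uz; elim: s => [|i s IH].
  by under eq_fun do rewrite big_nil; rewrite big_nil; exact: ccvg_cst.
by under eq_fun do rewrite big_cons; rewrite big_cons; exact: ccvgM.
Qed.

Lemma ccvg_cexp u z : ccvg u z -> ccvg (fun n => cexp (u n)) (cexp z).
Proof.
move=> [ur ui].
have er : (fun n => expR (complex.Re (u n))) @ \oo --> expR (complex.Re z).
  by apply: continuous_cvg => //; exact: continuous_expR.
split => /=; apply: cvgM => //; apply: continuous_cvg => //.
  exact: continuous_cos.
exact: continuous_sin.
Qed.

Lemma ccvg_normc u z : ccvg u z -> (fun n => Normc.normc (u n)) @ \oo --> Normc.normc z.
Proof.
move=> [ur ui].
have nE w : Normc.normc w = Num.sqrt (complex.Re w * complex.Re w + complex.Im w * complex.Im w).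
  by case: w => a b /=; rewrite -!expr2.
under eq_fun do rewrite nE; rewrite nE.
apply: continuous_cvg; first exact: sqrt_continuous.
by apply: cvgD; apply: cvgM.
Qed.

Lemma ccvg_near u v z : ccvg u z -> (fun n => Normc.normc (u n - v n)) @ \oo --> (0 : R) ->
  ccvg v z.
Proof.
move=> [ur ui] uv.
have close (f : R[i] -> R) : (forall a b, f (a - b) = f a - f b) ->
    (forall w, `|f w| <= Normc.normc w) -> (fun n => f (u n)) @ \oo --> f z ->
    (fun n => f (v n)) @ \oo --> f z.
  move=> fB fle uz; rewrite -[f z]subr0.
  rewrite (_ : (fun n => f (v n)) = (fun n => f (u n) - f (u n - v n))); last first.
    by apply/funext => n; rewrite fB; ring.
  apply: cvgB => //; apply/cvgrPdist_le => e e0; move/cvgrPdist_le: uv => /(_ e e0).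
  apply: filterS => n; rewrite !sub0r !normrN; apply: le_trans.
  by rewrite (le_trans (fle _)) // ler_norm.
split; apply: close => //.
- by move=> [a b] [x y].
- exact: norm_Re_le.
- by move=> [a b] [x y].
- exact: norm_Im_le.
Qed.

Lemma ccvg_unique u z w : ccvg u z -> ccvg u w -> z = w.
Proof.
case: z w => [a b] [x y] [/= ua ub] [/= ux uy].
by rewrite (cvg_unique _ ua ux) ?(cvg_unique _ ub uy).
Qed.

Lemma ccvg_subsequence u z (psi : nat -> nat) : {homo psi : m n / (m < n)%N} ->
  ccvg u z -> ccvg (fun n => u (psi n)) z.
Proof.
by move=> hp [ur ui]; split; [exact: (cvg_subsequence hp ur)|exact: (cvg_subsequence hp ui)].
Qed.

Lemma not_cvg_subsequence (u : nat -> R) l : ~ u @ \oo --> l ->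
  exists2 e : R, 0 < e & exists2 phi : nat -> nat, {homo phi : m n / (m < n)%N} &
    forall n, e <= `|u (phi n) - l|.
Proof.
move=> ul; apply: contrapT => H; apply: ul; apply/cvgrPdist_lt => e e0.
apply: contrapT => ne; apply: H; exists e => //.
have [|phi hphi phiP] := @extract_subsequence (fun _ n => e <= `|u n - l|).
  move=> m _; apply: contrapT => H; apply: ne; exists m => // n /= mn.
  by rewrite distrC ltNge; apply/negP => en; apply: H; exists n.
by exists phi.
Qed.

Lemma cvg_by_subsequences (u : nat -> R) (l : R) :
  (forall phi : nat -> nat, {homo phi : m n / (m < n)%N} ->
    exists2 psi : nat -> nat, {homo psi : m n / (m < n)%N} &
      (fun n => u (phi (psi n))) @ \oo --> l) ->
  u @ \oo --> l.
Proof.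
move=> H; apply: contrapT => /not_cvg_subsequence[e e0 [phi hphi ephi]].
have [psi hpsi /cvgrPdist_lt/(_ e e0)[N _ /(_ N (leqnn N))]] := H phi hphi.
by rewrite /= distrC ltNge ephi.
Qed.

Lemma ccvg_by_subsequences u z :
  (forall phi : nat -> nat, {homo phi : m n / (m < n)%N} ->
    exists2 psi : nat -> nat, {homo psi : m n / (m < n)%N} &
      ccvg (fun n => u (phi (psi n))) z) ->
  ccvg u z.
Proof.
by move=> H; split; apply: cvg_by_subsequences => phi /H[psi hpsi []]; exists psi.
Qed.

(** Convergence in the torus does not make the angles converge, as they may jump between -pi and pi.
    Integer powers of the exponentials are used instead. *)
Lemma ccvg_eix_mul (t : nat -> R) s : ccvg (fun n => eix (t n)) (eix s) ->
  forall k : int, ccvg (fun n => eix (k%:~R * t n)) (eix (k%:~R * s)).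
Proof.
move=> ts.
have H m : ccvg (fun n => eix (m%:R * t n)) (eix (m%:R * s)).
  elim: m => [|m IH].
    by under eq_fun do rewrite mul0r; rewrite mul0r; exact: ccvg_cst.
  have E x : eix (m.+1%:R * x) = eix x * eix (m%:R * x) :> R[i].
    by rewrite -eixD -natr1 mulrDl mul1r addrC.
  by under eq_fun do rewrite E; rewrite E; exact: ccvgM.
case=> m; first exact: H.
have [hr hi] := H m.+1.
have E x : eix ((Negz m)%:~R * x) =
    Complex (complex.Re (eix (m.+1%:R * x))) (- complex.Im (eix (m.+1%:R * x))) :> R[i].
  by rewrite NegzE mulrNz mulNr !eixE cosN sinN.
by under eq_fun do rewrite E; rewrite E; split => //=; apply: cvgN.
Qed.

Lemma tcvg_eix {d : nat} (v : nat -> 'rV[R]_d) g : tcvg v g ->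
  forall p, ccvg (fun n => eix (ipair p (v n))) (eix (ipair p g)).
Proof.
move=> vg p; rewrite /ipair; under eq_fun do rewrite eix_sum; rewrite eix_sum.
apply: ccvg_prod => j; apply: ccvg_eix_mul; have [hc hs] := vg j.
by split; (under eq_fun do rewrite eixE); rewrite eixE.
Qed.


(** Taking moduli shows that r n tends to r0 > 0; dividing by it leaves the directions. *)
Lemma ccvg_eix_polar (t r : nat -> R) t0 r0 : (forall n, 0 < r n) -> 0 < r0 ->
  ccvg (fun n => eix (t n) * Complex (r n) 0) (eix t0 * Complex r0 0) ->
  ccvg (fun n => eix (t n)) (eix t0).
Proof.
move=> rn r00 h.
have nE x (y : R) : 0 < y -> Normc.normc (eix x * Complex y 0) = y.
  move=> y0; rewrite Normc.normcM normc_eix mul1r /= expr0n /= addr0 sqrtr_sqr.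
  by rewrite gtr0_norm.
have rc : r @ \oo --> r0.
  have := ccvg_normc h; rewrite nE //.
  by under eq_fun do rewrite nE //.
have ir : ccvg (fun n => Complex (r n)^-1 0) (Complex r0^-1 0).
  by split => /=; [apply: cvgV => //; exact: lt0r_neq0|exact: cvg_cst].
have E (x y : R) : 0 < y -> eix x = eix x * Complex y 0 * Complex y^-1 0.
  move=> y0; rewrite -mulrA [X in _ * X](_ : _ = 1) ?mulr1 //.
  by simpc; rewrite divff ?lt0r_neq0.
rewrite (E _ _ r00); under eq_fun => n do rewrite (E _ _ (rn n)).
exact: ccvgM.
Qed.

End complex_convergence.

                                       

(** * Energies and uniqueness of the quadratic part *)

Lemma Rintegral_zero {dd : measure_display} {T : measurableType dd} {R : realType}
    (mu : {measure set T -> \bar R}) : \int[mu]_(x in setT) (0 : R) = 0.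
Proof. by rewrite /Rintegral integral0. Qed.

Lemma Rintegral_dominated_cvg {dd : measure_display} {T : measurableType dd} {R : realType}
    (mu : {measure set T -> \bar R}) (f_ : nat -> T -> R) (f g : T -> R) :
  (forall n, measurable_fun setT (f_ n)) -> measurable_fun setT f ->
  (forall x, (fun n => f_ n x) @ \oo --> f x) ->
  mu.-integrable setT (EFin \o g) -> (forall n x, `|f_ n x| <= g x) ->
  (fun n => \int[mu]_x f_ n x) @ \oo --> \int[mu]_x f x.
Proof.
move=> mf_ mf ff jg fg.
have [|||||jf _ cv] := @dominated_convergence _ T R mu setT measurableT
  (fun n => EFin \o f_ n) (EFin \o f) (EFin \o g).
- by move=> n; exact/measurable_EFinP.
- exact/measurable_EFinP.
- by apply: aeW => x _; apply: cvg_EFin; [exact: nearW|exact: ff].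
- exact: jg.
- by apply: aeW => x n _; rewrite lee_fin fg.
by apply: fine_cvg; rewrite fineK ?integrable_fin_num.
Qed.

Section energy.
Context {R : realType} {d : nat}.
Implicit Types (mu tau : {measure set (TB R d) -> \bar R}) (p : 'rV[int]_d).

Lemma tcontinuous_psin_sqr p : tcontinuous (fun x : 'rV[R]_d => psin p x ^+ 2).
Proof. by under eq_fun do rewrite expr2; apply: tcontinuousM; exact: tcontinuous_psin. Qed.

Lemma norm_psin_sqr_le p (x : 'rV[R]_d) : `|psin p x ^+ 2| <= 2 * zabs p ^+ 2 * tgauge x.
Proof. by rewrite ger0_norm ?sqr_ge0 // psin_sqr_le. Qed.

Definition energy mu p : R := tint mu (fun x => psin p x ^+ 2).

Lemma energy_ge0 mu p : 0 <= energy mu p.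
Proof. by apply: Rintegral_ge0 => x _; exact: sqr_ge0. Qed.

Lemma integrable_psin_sqr mu p : mu.-integrable setT (EFin \o (@tgauge R d)) ->
  mu.-integrable setT (EFin \o (fun x : TB R d => psin p x ^+ 2)).
Proof.
move=> jg; apply: (tgauge_dominated_integrable jg (tcontinuous_psin_sqr p)) => x.
exact: norm_psin_sqr_le.
Qed.

Lemma energy_le mu p : mu.-integrable setT (EFin \o (@tgauge R d)) ->
  energy mu p <= 2 * zabs p ^+ 2 * tint mu tgauge.
Proof.
move=> jg; rewrite /energy /tint -RintegralZl //; apply: le_Rintegral => //.
- exact: integrable_psin_sqr.
- exact: integrable_realZ.
- by move=> x _; exact: psin_sqr_le.
Qed.

Lemma ipair_muln p k (x : 'rV[R]_d) : ipair (p *+ k) x = k%:R * ipair p x.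
Proof.
by rewrite /ipair mulr_sumr; apply: eq_bigr => j _; rewrite mulmxnE rmorphMn /= mulrnAl mulr_natl.
Qed.

Lemma energy_muln mu p k : mu.-integrable setT (EFin \o (@tgauge R d)) ->
  energy mu (p *+ k) = k%:R ^+ 2 * energy mu p.
Proof.
move=> jg; rewrite /energy /tint -RintegralZl //; last exact: integrable_psin_sqr.
by apply: eq_Rintegral => x _; rewrite /psin ipair_muln exprMn.
Qed.

Lemma energy_subsequence (rho : nat -> {measure set (TB R d) -> \bar R}) (M : R) :
  (forall n, (rho n setT < +oo)%E) -> (forall n, tint (rho n) tgauge <= M) ->
  exists2 psi : nat -> nat, {homo psi : m n / (m < n)%N} &
    exists c : 'rV[int]_d -> R, forall p, (fun n => energy (rho (psi n)) p) @ \oo --> c p.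
Proof.
(* Division by [a p] makes the energies bounded uniformly in p, as the diagonal extraction
   requires. *)
move=> rho_fin rhoM; pose a p : R := 2 * zabs p ^+ 2 + 1.
have a0 p : 0 < a p by rewrite ltr_pwDr // mulr_ge0 // sqr_ge0.
have jg n : (rho n).-integrable setT (EFin \o (@tgauge R d)).
  by apply: tcontinuous_integrable => //; exact: tcontinuous_tgauge.
have g0 n : 0 <= tint (rho n) tgauge by apply: Rintegral_ge0 => x _; exact: tgauge_ge0.
have [|psi hpsi [c hc]] := @diagonal_subsequence R 'rV[int]_d
    (fun n p => energy (rho n) p / a p) M.
  move=> n p; rewrite ger0_norm ?divr_ge0 ?energy_ge0 ?(ltW (a0 p)) //.
  rewrite ler_pdivrMr //; apply: (le_trans (energy_le p (jg n))).
  rewrite mulrC; apply: ler_pM => //; first by rewrite mulr_ge0 // sqr_ge0.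
  by rewrite lerDl.
exists psi => //; exists (fun p => c p * a p) => p.
have E n : energy (rho (psi n)) p = energy (rho (psi n)) p / a p * a p.
  by rewrite divfK // lt0r_neq0.
by under eq_fun do rewrite E; apply: cvgMl; exact: hc.
Qed.

Lemma local_energy_small tau p : tau.-integrable setT (EFin \o (@tgauge R d)) ->
  forall eta : R, 0 < eta -> exists2 e0 : R, 0 < e0 & forall e, 0 < e -> e <= e0 ->
    tint tau (fun x => psin p x ^+ 2 * (1 - chi e x)) <= eta.
Proof.
move=> jg eta eta0; pose e n : R := n.+1%:R^-1.
have e0 n : 0 < e n by rewrite invr_gt0.
have tc (c : R) : tcontinuous (fun x : 'rV[R]_d => psin p x ^+ 2 * (1 - chi c x)).
  apply: tcontinuousM; first exact: tcontinuous_psin_sqr.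
  apply: tcontinuousD; first exact: tcontinuous_cst.
  by apply: tcontinuousN; exact: tcontinuous_chi.
have c01 (c : R) (x : 'rV[R]_d) : 0 <= 1 - chi c x <= 1.
  by rewrite subr_ge0 chi_le1 lerBlDr lerDl chi_ge0.
have nle (c : R) (x : 'rV[R]_d) : `|psin p x ^+ 2 * (1 - chi c x)| <= psin p x ^+ 2.
  have /andP[h1 h2] := c01 c x; rewrite ger0_norm ?(mulr_ge0 (sqr_ge0 _) h1) //.
  by rewrite ler_piMr // sqr_ge0.
have jp (c : R) : tau.-integrable setT (EFin \o (fun x : TB R d => psin p x ^+ 2 * (1 - chi c x))).
  apply: (@integrable_dominated _ (TB R d) R _ _ (fun x => psin p x ^+ 2)) => //.
  - exact: tcontinuous_measurable (tc c).
  - exact: integrable_psin_sqr.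
have /cvgrPdist_le/(_ _ eta0)[N _ hN] :
    (fun n => tint tau (fun x => psin p x ^+ 2 * (1 - chi (e n) x))) @ \oo --> (0 : R).
  rewrite -[X in _ --> X](Rintegral_zero tau).
  apply: (@Rintegral_dominated_cvg _ (TB R d) R tau _ _ (fun x => psin p x ^+ 2)).
  - by move=> n; exact: tcontinuous_measurable.
  - exact: measurable_cst.
  - move=> x; have [x0|x0] := eqVneq (tgauge x) 0.
      have -> : psin p x ^+ 2 = 0.
        apply/eqP; rewrite eq_le sqr_ge0 andbT; have := psin_sqr_le p x.
        by rewrite x0 mulr0.
      by under eq_fun do rewrite mul0r; exact: cvg_cst.
    have {}x0 : 0 < tgauge x by rewrite lt_def x0 tgauge_ge0.
    apply: cvg_near_cst; exists (Num.truncn (2 / tgauge x)) => // n /= nx.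
    rewrite chi1 ?subrr ?mulr0 // /e -ler_pdivlMl // mulrC.
    rewrite -[tgauge x / 2]invrK invf_div lef_pV2 ?posrE ?divr_gt0 //.
    by apply/ltW/(lt_le_trans (truncnS_gt _)); rewrite ler_nat ltnS.
  - exact: integrable_psin_sqr.
  - by move=> n x; exact: nle.
exists (e N) => // c c0 cN; apply: (@le_trans _ _ (tint tau (fun x => psin p x ^+ 2 * (1 - chi (e N) x)))).
  apply: le_Rintegral => // x _; rewrite ler_wpM2l ?sqr_ge0 // lerD2l lerN2.
  exact: chi_antitone.
have := hN N (leqnn N); rewrite /= sub0r normrN; apply: le_trans; exact: ler_norm.
Qed.

Lemma norm_sin_muln k (t : R) : `|sin (k%:R * t)| <= k%:R * `|sin t|.
Proof.
elim: k => [|k IH]; first by rewrite !mul0r sin0 normr0.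
rewrite -natr1 !mulrDl !mul1r sinD; apply: (le_trans (ler_normD _ _)); rewrite !normrM.
have := cos_max t; have := cos_max (k%:R * t); have := normr_ge0 (sin t).
have := normr_ge0 (sin (k%:R * t)); nra.
Qed.

Lemma onem_cosE (t : R) : 1 - cos t = 2 * sin (t / 2) ^+ 2.
Proof.
have -> : cos t = cos (t / 2 + t / 2) by rewrite -splitr.
by rewrite cosD -!expr2 cos2sin2; ring.
Qed.

Lemma onem_cos_muln k (t : R) : 1 - cos (k%:R * t) <= k%:R ^+ 2 * (1 - cos t).
Proof.
rewrite !onem_cosE -[k%:R * t / 2]mulrA [leRHS]mulrCA ler_pM2l // -exprMn.
rewrite -[leLHS]real_normK ?num_real // -[leRHS]real_normK ?num_real //.
apply: lerXn2r; rewrite ?nnegrE // [leRHS]normrM normr_nat; exact: norm_sin_muln.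
Qed.

(** After division by n^2 the integrand tends to 0 pointwise, and it is dominated by 1 - cos<p, x>
    through 1 - cos(n t) <= n^2 (1 - cos t). *)
Lemma levy_re_growth mu p : mu.-integrable setT (EFin \o (@tgauge R d)) ->
  (fun n => tint mu (levy_re (p *+ n.+1)) / n.+1%:R ^+ 2) @ \oo --> (0 : R).
Proof.
move=> jg; have jl q : mu.-integrable setT (EFin \o (levy_re q : TB R d -> R)).
  have [C C0 hC] := levy_re_le_tgauge (R := R) q.
  exact: (tgauge_dominated_integrable jg (tcontinuous_levy_re q) hC).
have lreE q (x : 'rV[R]_d) : `|levy_re q x| = 1 - cos (ipair q x).
  by rewrite /levy_re distrC ger0_norm // onem_cos_ge0.
rewrite (_ : (fun n => _) =
    fun n => \int[mu]_x ((n.+1%:R ^+ 2)^-1 * levy_re (p *+ n.+1) x)); last first.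
  by apply/funext => n; rewrite mulrC /tint RintegralZl.
rewrite -[X in _ --> X](Rintegral_zero mu).
apply: (@Rintegral_dominated_cvg _ (TB R d) R mu _ _ (fun x => `|levy_re p x|)).
- move=> n; apply: measurable_funM => //.
  by apply: tcontinuous_measurable; exact: tcontinuous_levy_re.
- exact: measurable_cst.
- move=> x; apply/cvgrPdist_le => e e0; exists (Num.truncn (2 / e)) => // n /= nx.
  rewrite sub0r normrN normrM lreE ger0_norm ?invr_ge0 ?sqr_ge0 //.
  rewrite mulrC ler_pdivrMr ?exprn_gt0 //.
  have h : 2 <= e * n.+1%:R.
    rewrite mulrC -ler_pdivrMr //; apply/ltW/(lt_le_trans (truncnS_gt _)).
    by rewrite ler_nat ltnS.
  have := cos_geN1 (ipair (p *+ n.+1) x).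
  have : 1 <= n.+1%:R :> R by rewrite ler1n.
  nra.
- exact: integrable_abse (jl p).
- move=> n x; rewrite normrM !lreE ger0_norm ?invr_ge0 ?sqr_ge0 //.
  by rewrite ipair_muln [leLHS]mulrC ler_pdivrMr ?exprn_gt0 // [leRHS]mulrC onem_cos_muln.
Qed.

                                                                                                 
(** At n p the quadratic terms scale by n^2 while the integrals are o(n^2); dividing by n^2 and
    letting n grow leaves only the former. *)
Lemma quadratic_part_unique (Q1 Q2 : 'rV[int]_d -> R) mu1 mu2 :
  mu1.-integrable setT (EFin \o (@tgauge R d)) -> mu2.-integrable setT (EFin \o (@tgauge R d)) ->
  (forall p k, Q1 (p *+ k) = k%:R ^+ 2 * Q1 p) -> (forall p k, Q2 (p *+ k) = k%:R ^+ 2 * Q2 p) ->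
  (forall p, - Q1 p / 2 + tint mu1 (levy_re p) = - Q2 p / 2 + tint mu2 (levy_re p)) ->
  forall p, Q1 p = Q2 p.
Proof.
move=> j1 j2 h1 h2 H p; have l1 := levy_re_growth p j1; have l2 := levy_re_growth p j2.
have : (fun=> (Q1 p - Q2 p) / 2) @ \oo --> (0 - 0 : R).
  have E n : (Q1 p - Q2 p) / 2 = tint mu1 (levy_re (p *+ n.+1)) / n.+1%:R ^+ 2 -
                                 tint mu2 (levy_re (p *+ n.+1)) / n.+1%:R ^+ 2.
    have := H (p *+ n.+1); rewrite h1 h2 => Hn.
    have n0 : n.+1%:R != 0 :> R by rewrite pnatr_eq0.
    rewrite -mulrBl; apply: (mulIf (expf_neq0 2 n0)); rewrite divfK ?expf_neq0 //.
    lra.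
  by rewrite (_ : (fun=> _) = fun n => tint mu1 (levy_re (p *+ n.+1)) / n.+1%:R ^+ 2 -
      tint mu2 (levy_re (p *+ n.+1)) / n.+1%:R ^+ 2); [exact: cvgB|exact/funext].
have h0 : (fun=> (Q1 p - Q2 p) / 2) @ \oo --> ((Q1 p - Q2 p) / 2 : R) by exact: cvg_cst.
rewrite subrr => h; have E : (Q1 p - Q2 p) / 2 = 0 :> R by exact: (cvg_unique _ h0 h).
by lra.
Qed.

End energy.

Section levy.
Context {R : realType} {d : nat}.
Implicit Types (mu tau : {measure set (TB R d) -> \bar R}) (p : 'rV[int]_d) (x : 'rV[R]_d).

Let onemc x : 'rV[R]_d := \row_j (1 - cos (x ord0 j)).

Let measurable_onemc : measurable_fun setT ((fun x => tnorm (onemc x)) : TB R d -> R).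
Proof.
apply: continuous_measurable_TB => x.
apply: (@continuous_comp _ _ _ (fun x => \sum_j onemc x ord0 j ^+ 2) Num.sqrt); last first.
  exact: sqrt_continuous.
apply: continuous_sum => j _ {}x; rewrite /onemc.
have := (@tcontinuousD R d _ _ (tcontinuous_cst 1) (tcontinuousN (tcontinuous_cos (zdelta j)))).
move=> h; have [h2 _] := tcontinuousM h h.
by under eq_fun do rewrite mxE expr2 -ipair_zdelta; exact: h2.
Qed.

Lemma levy_measure_tgauge mu : levy_measure mu -> mu.-integrable setT (EFin \o (@tgauge R d)).
Proof.
move=> [_ _ j]; apply: (@integrable_dominated _ (TB R d) R _ _ (fun x => d%:R * tnorm (onemc x))).
- by apply: tcontinuous_measurable; exact: tcontinuous_tgauge.
- move=> x; rewrite ger0_norm ?tgauge_ge0 //.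
  have -> : d%:R * tnorm (onemc x) = \sum_(k < d) tnorm (onemc x).
    by rewrite sumr_const card_ord mulr_natl.
  apply: ler_sum => k _; apply: (le_trans (ler_norm _)).
  by have := coord_le_tnorm (onemc x) k; rewrite mxE.
- exact: integrable_realZ.
Qed.

Lemma in_Mtilde_levy tau : in_Mtilde tau -> tau.-integrable setT (EFin \o (@tgauge R d)) ->
  levy_measure tau.
Proof.
move=> [t0 t1 _] jg; split => //.
apply: (@integrable_dominated _ (TB R d) R _ (fun x => tnorm (onemc x)) _ measurable_onemc _ jg).
move=> x; rewrite ger0_norm ?tnorm_ge0 //; apply: (le_trans (tnorm_le_sum _)).
by apply: ler_sum => k _; rewrite mxE ger0_norm // onem_cos_ge0.
Qed.

Lemma levy_cf00 mu p : levy_cf 0 0 mu p = cexp (levy_int mu p).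
Proof.
rewrite /levy_cf (_ : ipair p 0 = 0); last by rewrite /ipair big1 // => j _; rewrite mxE mulr0.
rewrite (_ : quadform 0 p = 0); last first.
  by rewrite /quadform big1 // => j _; rewrite big1 // => l _; rewrite mxE !mul0r.
rewrite -[X in cexp X * _]/(0 : R[i]) cexp0 mul1r oppr0 mul0r; congr cexp.
by rewrite [X in X + _](_ : _ = 0) ?add0r.
Qed.

End levy.

(** * Limits of Lévy exponents along a convergent subsequence *)

Section limits.
Context {R : realType} {d : nat}.
Variables (rho : nat -> {measure set (TB R d) -> \bar R}) (tau : {measure set (TB R d) -> \bar R}).
Variables (M : R) (c : 'rV[int]_d -> R).
Hypotheses (rho_fin : forall n, (rho n setT < +oo)%E) (rhoM : forall n, tint (rho n) tgauge <= M).
Hypotheses (tauM : in_Mtilde tau) (rho_tau : vcvg rho tau).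
Hypothesis rho_c : forall p, (fun n => energy (rho n) p) @ \oo --> c p.
Implicit Types p : 'rV[int]_d.

                                                                                         
(** Energy lost to the point 1 in the passage to the limit; it becomes the Gaussian quadratic
    form. *)
Definition defect p : R := c p - energy tau p.

Let jg n : (rho n).-integrable setT (EFin \o (@tgauge R d)).
Proof. by apply: tcontinuous_integrable => //; exact: tcontinuous_tgauge. Qed.

Let jgt : tau.-integrable setT (EFin \o (@tgauge R d)) :=
  (vague_integral_tgauge rho_fin rhoM tauM rho_tau).1.

Lemma defect_muln p k : defect (p *+ k) = k%:R ^+ 2 * defect p.
Proof.
rewrite /defect energy_muln // mulrBr; congr (_ - _).
have h : (fun n => energy (rho n) (p *+ k)) @ \oo --> c (p *+ k) by exact: rho_c.
rewrite (_ : (fun n => _) = fun n => k%:R ^+ 2 * energy (rho n) p) in h; last first.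
  by apply/funext => n; rewrite energy_muln.
have h2 : (fun n => k%:R ^+ 2 * energy (rho n) p) @ \oo --> k%:R ^+ 2 * c p.
  by apply: cvgM; [exact: cvg_cst|exact: rho_c].
exact: (cvg_unique _ h h2).
Qed.

Let jlre (mu : {measure set (TB R d) -> \bar R}) p :
  mu.-integrable setT (EFin \o (@tgauge R d)) -> mu.-integrable setT (EFin \o (levy_re p : TB R d -> R)).
Proof.
move=> j; have [C C0 hC] := levy_re_le_tgauge (R := R) p.
exact: (tgauge_dominated_integrable j (tcontinuous_levy_re p) hC).
Qed.

Let rreE (mu : {measure set (TB R d) -> \bar R}) p : mu.-integrable setT (EFin \o (@tgauge R d)) ->
  tint mu (levy_re_corr p) = tint mu (levy_re p) + energy mu p / 2.
Proof.
move=> j; rewrite mulrC /energy /tint -RintegralZl //; last exact: integrable_psin_sqr.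
rewrite -RintegralD //; first by apply: eq_Rintegral => x _; rewrite /levy_re_corr [in RHS]mulrC.
  exact: jlre.
by apply: integrable_realZ; exact: integrable_psin_sqr.
Qed.

(** The imaginary integrand and the corrected real one are o([tgauge]), so their integrals pass to
    the limit. The correction contributes -c/2, and c is the defect plus the energy of tau. *)
Lemma levy_int_cvg p :
  ccvg (fun n => levy_int (rho n) p) (Complex (- defect p / 2) 0 + levy_int tau p).
Proof.
split => /=.
  have h := vague_cvg_small rho_fin rhoM tauM rho_tau (tcontinuous_levy_re_corr p) (tsmall_levy_re_corr (R := R) p).
  have E (mu : {measure set (TB R d) -> \bar R}) : mu.-integrable setT (EFin \o (@tgauge R d)) ->
      tint mu (fun x => cos (ipair p x) - 1) = tint mu (levy_re_corr p) - energy mu p / 2.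
    by move=> j; rewrite rreE // addrK.
  under eq_fun do rewrite E //.
  have -> : - defect p / 2 + tint tau (fun x => cos (ipair p x) - 1) = tint tau (levy_re_corr p) - c p / 2.
    by rewrite E // /defect; field.
  by apply: cvgB => //; apply: cvgMl; exact: rho_c.
rewrite add0r.
exact: (vague_cvg_small rho_fin rhoM tauM rho_tau (tcontinuous_levy_im p) (tsmall_levy_im (R := R) p)).
Qed.

Lemma local_energy_cvg p (e : R) : 0 < e ->
  (fun n => tint (rho n) (fun x => psin p x ^+ 2 * (1 - chi e x))) @ \oo -->
  defect p + tint tau (fun x => psin p x ^+ 2 * (1 - chi e x)).
Proof.
move=> e0; have ta := tcont_away_chi e0 (tcontinuous_psin_sqr (R := R) p).
have jc (mu : {measure set (TB R d) -> \bar R}) : mu.-integrable setT (EFin \o (@tgauge R d)) ->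
    mu.-integrable setT (EFin \o (fun x : TB R d => psin p x ^+ 2 * chi e x)).
  move=> j; apply: (tgauge_dominated_integrable j ta.1) => x.
  apply: le_trans (norm_psin_sqr_le p x); rewrite normrM ler_piMr //.
  by rewrite ger0_norm ?chi_ge0 ?chi_le1.
have E (mu : {measure set (TB R d) -> \bar R}) : mu.-integrable setT (EFin \o (@tgauge R d)) ->
    tint mu (fun x => psin p x ^+ 2 * (1 - chi e x)) =
    energy mu p - tint mu (fun x => psin p x ^+ 2 * chi e x).
  move=> j; rewrite /energy /tint -RintegralB //; last 2 first.
  - exact: integrable_psin_sqr.
  - exact: jc.
  by apply: eq_Rintegral => x _; rewrite mulrBr mulr1.
under eq_fun do rewrite E //.
rewrite E // /defect addrA subrK; apply: cvgB; [exact: rho_c|exact: rho_tau].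
Qed.

End limits.

                       

(** * Double limits, and quadratic forms by polarization *)

Section double_limits.
Context {R : realType}.
Implicit Types (F G : R -> nat -> R) (u : nat -> R).

(** Expresses at once that the limits in e of both the upper and the lower limits in n equal c.
    Unlike either of those taken alone, it is stable under linear combinations, which polarization
    needs. *)
Definition dlim F (c : R) := forall eta : R, 0 < eta -> exists2 e0 : R, 0 < e0 &
  forall e, 0 < e -> e < e0 -> \forall n \near \oo, `|F e n - c| <= eta.

Lemma limn_esup_le u (a : R) : (\forall n \near \oo, u n <= a) ->
  (limn_esup (fun n => (u n)%:E) <= a%:E)%E.
Proof.
move=> h; apply: (@le_trans _ _ (ereal_sup ((fun n => (u n)%:E) @` [set n | u n <= a]))).
  by apply: ereal_inf_lbound; exists [set n | u n <= a].
by apply: ge_ereal_sup => _ [n /= un <-]; rewrite lee_fin.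
Qed.

Lemma limn_esup_lt u (a : R) : (limn_esup (fun n => (u n)%:E) < a%:E)%E ->
  \forall n \near \oo, u n <= a.
Proof.
move=> /ereal_inf_lt[_ [V hV <-] Va]; apply: filterS hV => n Vn.
rewrite -lee_fin; apply/ltW/le_lt_trans/Va.
by apply: ereal_sup_ubound; exists n.
Qed.

Let limn_einfE u : limn_einf (fun n => (u n)%:E) = (- limn_esup (fun n => (- u n)%:E))%E.
Proof. by []. Qed.

Lemma limn_einf_ge u (a : R) : (\forall n \near \oo, a <= u n) ->
  (a%:E <= limn_einf (fun n => (u n)%:E))%E.
Proof.
move=> h; rewrite limn_einfE leeNr -EFinN; apply: limn_esup_le.
by apply: filterS h => n; rewrite lerN2.
Qed.

Lemma limn_einf_gt u (a : R) : (a%:E < limn_einf (fun n => (u n)%:E))%E ->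
  \forall n \near \oo, a <= u n.
Proof.
rewrite limn_einfE lteNr -EFinN => /limn_esup_lt; apply: filterS => n.
by rewrite lerN2.
Qed.

Lemma at_right0P (P : R -> Prop) : (\forall e \near 0^'+, P e) <->
  exists2 e0 : R, 0 < e0 & forall e, 0 < e -> e < e0 -> P e.
Proof.
split=> [[e0 /= e00 he]|[e0 e00 he]].
  by exists e0 => // e ep ee0; apply: he => //=; rewrite sub0r normrN gtr0_norm.
exists e0 => //= e; rewrite /= sub0r normrN => h ep; apply: he => //.
by rewrite -(gtr0_norm ep).
Qed.

Lemma dlimP F c : dlim F c <->
  (fun e => limn_esup (fun n => (F e n)%:E)) @ 0^'+ --> c%:E /\
  (fun e => limn_einf (fun n => (F e n)%:E)) @ 0^'+ --> c%:E.
Proof.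
pose up e := limn_esup (fun n => (F e n)%:E); pose lo e := limn_einf (fun n => (F e n)%:E).
split.
  move=> h.
  have bnd eta : 0 < eta -> \forall e \near 0^'+,
      ((c - eta)%:E <= lo e)%E /\ (up e <= (c + eta)%:E)%E.
    move=> eta0; have [e0 e00 he] := h eta eta0.
    apply/at_right0P; exists e0 => // e ep ee0; have hn := he e ep ee0; split.
      apply: limn_einf_ge; apply: filterS hn => n; rewrite ler_norml => /andP[]; lra.
    apply: limn_esup_le; apply: filterS hn => n; rewrite ler_norml => /andP[]; lra.
  (* Anything squeezed between the lower and upper limits converges to c; this applies to both of
     them. *)
  have close (v : R -> \bar R) : (forall e, (lo e <= v e)%E /\ (v e <= up e)%E) ->
      v @ 0^'+ --> c%:E.
    move=> hv; have fin eta e : ((c - eta)%:E <= lo e)%E -> (up e <= (c + eta)%:E)%E ->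
        v e \is a fin_num /\ `|c - fine (v e)| <= eta.
      have [h1 h2] := hv e => h3 h4.
      have h5 := le_trans h3 h1; have h6 := le_trans h2 h4.
      have vf : v e \is a fin_num.
        rewrite fin_numE; apply/andP; split; apply/eqP => ve; rewrite ve in h5 h6.
          by move: h5; rewrite leeNy_eq.
        by move: h6; rewrite leye_eq.
      split => //; move: h5 h6; rewrite -{1 2}(fineK vf) !lee_fin => h5 h6.
      by rewrite ler_norml; apply/andP; split; lra.
    apply/fine_cvgP; split.
      by apply: filterS (bnd 1 ltr01) => e [h1 h2]; exact: (fin _ _ h1 h2).1.
    apply/cvgrPdist_le => eta eta0.
    by apply: filterS (bnd eta eta0) => e [h1 h2]; exact: (fin _ _ h1 h2).2.
  by split; apply: close => e; split; rewrite /lo /up ?lexx // limn_einf_sup.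
move=> [/fine_cvgP[uf /cvgrPdist_lt uc] /fine_cvgP[lf /cvgrPdist_lt lc]] eta eta0.
have [e0 e00 he] := (at_right0P _).1 (filterI (filterI uf (uc eta eta0)) (filterI lf (lc eta eta0))).
exists e0 => // e ep ee0.
have [[uf1 uc1] [lf1 lc1]] := he e ep ee0.
have h1 : \forall n \near \oo, F e n <= c + eta.
  apply: limn_esup_lt; rewrite -(fineK uf1) lte_fin.
  by move: uc1; rewrite ltr_norml /= => /andP[]; rewrite /comp; lra.
have h2 : \forall n \near \oo, c - eta <= F e n.
  apply: limn_einf_gt; rewrite -(fineK lf1) lte_fin.
  by move: lc1; rewrite ltr_norml /= => /andP[]; rewrite /comp; lra.
move: h1 h2; apply: filterS2 => n h1 h2; rewrite ler_norml; apply/andP; split; lra.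
Qed.

Lemma dlim_ext F G c : (forall e n, F e n = G e n) -> dlim F c -> dlim G c.
Proof.
move=> FG h eta /h[e0 e00 he]; exists e0 => // e ep ee0.
by under eq_near do rewrite -FG; exact: he.
Qed.

Lemma dlimD F G c k : dlim F c -> dlim G k -> dlim (fun e n => F e n + G e n) (c + k).
Proof.
move=> h1 h2 eta eta0; have eta2 : 0 < eta / 2 by rewrite divr_gt0.
have [e1 e10 he1] := h1 _ eta2; have [e2 e20 he2] := h2 _ eta2.
exists (Num.min e1 e2); first by rewrite lt_min e10.
move=> e ep; rewrite lt_min => /andP[ee1 ee2].
move: (he1 e ep ee1) (he2 e ep ee2); apply: filterS2 => n.
rewrite !ler_norml => /andP[a1 a2] /andP[b1 b2]; apply/andP; split; lra.
Qed.

Lemma dlimZ (a : R) F c : dlim F c -> dlim (fun e n => a * F e n) (a * c).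
Proof.
move=> h eta eta0; have a0 : 0 < `|a| + 1 by rewrite ltr_wpDl.
have [e0 e00 he] := h (eta / (`|a| + 1)) (divr_gt0 eta0 a0).
exists e0 => // e ep ee0; move: (he e ep ee0); apply: filterS => n.
rewrite ler_pdivlMr // -mulrBr normrM => hn.
have := normr_ge0 (F e n - c); have := normr_ge0 a; nra.
Qed.

Lemma dlim_sum I (s : seq I) (F : I -> R -> nat -> R) (c : I -> R) :
  (forall i, dlim (F i) (c i)) ->
  dlim (fun e n => \sum_(i <- s) F i e n) (\sum_(i <- s) c i).
Proof.
move=> h; elim: s => [|i s IH].
  move=> eta eta0; exists 1 => // e _ _; apply: nearW => n.
  by rewrite !big_nil subrr normr0 ltW.
rewrite big_cons; apply: (dlim_ext (F := fun e n => F i e n + \sum_(j <- s) F j e n)).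
  by move=> e n; rewrite big_cons.
exact: dlimD.
Qed.

End double_limits.

Section quadratic_forms.
Context {R : realType} {d : nat}.
Implicit Types (A : 'M[R]_d) (p : 'rV[int]_d).

Let bform A (p q : 'rV[int]_d) : R := \sum_j \sum_l A j l * (p ord0 j)%:~R * (q ord0 l)%:~R.

Let bform_zdelta A j l : bform A (zdelta j) (zdelta l) = A j l.
Proof.
rewrite /bform (bigD1 j) //= [X in _ + X]big1 => [|a aj]; last first.
  by rewrite big1 // => b _; rewrite mxE eqxx (negbTE aj) mulr0 mul0r.
rewrite addr0 (bigD1 l) //= [X in _ + X]big1 => [|b bl]; last first.
  by rewrite [X in _ * X](_ : _ = 0) ?mulr0 // mxE eqxx (negbTE bl).
by rewrite addr0 !mxE !eqxx !mulr1.
Qed.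

Lemma quadform_zdelta A j : quadform A (zdelta j) = A j j.
Proof. exact: bform_zdelta. Qed.

Lemma quadform_zdeltaD A j l :
  quadform A (zdelta j + zdelta l) = A j j + A j l + A l j + A l l.
Proof.
rewrite -!(bform_zdelta A) /bform -!big_split; apply: eq_bigr => a _ /=.
by rewrite -!big_split; apply: eq_bigr => b _ /=; rewrite !mxE !intrD; ring.
Qed.

Lemma quadform_muln A p k : quadform A (p *+ k) = k%:R ^+ 2 * quadform A p.
Proof.
have E (z : int) : (z *+ k)%:~R = k%:R * z%:~R :> R by rewrite rmorphMn /= mulr_natl.
rewrite /quadform mulr_sumr; apply: eq_bigr => a _; rewrite mulr_sumr; apply: eq_bigr => b _.
by rewrite !mulmxnE !E; ring.
Qed.

Lemma psinDl p q (x : 'rV[R]_d) : psin (p + q) x = psin p x + psin q x.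
Proof. exact: ipairDl. Qed.

Lemma psin_zdelta j (x : 'rV[R]_d) : psin (zdelta j) x = sin (x ord0 j).
Proof. by rewrite /psin ipair_zdelta mxE. Qed.

Lemma psin_sqrE p (x : 'rV[R]_d) : psin p x ^+ 2 =
  \sum_j \sum_l (p ord0 j)%:~R * (p ord0 l)%:~R * (sin (x ord0 j) * sin (x ord0 l)).
Proof.
rewrite expr2 /psin /ipair mulr_suml; apply: eq_bigr => j _; rewrite mulr_sumr.
by apply: eq_bigr => l _; rewrite !mxE; ring.
Qed.

End quadratic_forms.

Lemma onem_cos_le_sin_sqr {R : realType} (t : R) : `|t| <= 1 -> 1 - cos t <= sin t ^+ 2.
Proof.
move=> t1; have t2 : t ^+ 2 <= 1 by rewrite -real_normK ?num_real // expr_le1.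
have hc := cos_ge_sqr t; have c1 := cos_le1 t; rewrite sin2cos2.
by move: (cos t) hc c1 => c hc c1; nra.
Qed.

(** The reciprocal of 1 plus the sum of the reciprocals is used in place of a minimum, which also
    covers the empty index set. *)
Lemma finite_positive_bound {R : realType} (I : finType) (a : I -> R) : (forall i, 0 < a i) ->
  exists e : R, [/\ 0 < e, e <= 1 & forall i, e < a i].
Proof.
move=> a0; have aV i : 0 < (a i)^-1 by rewrite invr_gt0.
have s0 : 0 <= \sum_i (a i)^-1 by apply: sumr_ge0 => i _; exact: ltW.
have s1 : 0 < 1 + \sum_i (a i)^-1 by lra.
exists (1 + \sum_i (a i)^-1)^-1; rewrite invr_gt0 invf_le1 // lerDl; split => // j.
have sj : (a j)^-1 <= \sum_i (a i)^-1.
  by rewrite (bigD1 j) //= lerDl sumr_ge0 // => i _; exact: ltW.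
by rewrite -[ltRHS]invrK ltf_pV2 ?posrE //; lra.
Qed.

(** * Energy in small balls, its double limit, and the mass bound *)

Section local_energy.
Context {R : realType} {d : nat}.
Variable rho : nat -> {measure set (TB R d) -> \bar R}.
Hypotheses (rho_fin : forall n, (rho n setT < +oo)%E) (rho_torus : forall n, on_torus (rho n)).
Implicit Types (f : 'rV[R]_d -> R) (p : 'rV[int]_d) (tau : {measure set (TB R d) -> \bar R}).

Definition local_int f (e : R) n : R := tint (rho n) (fun x => \1_(Ueps e) x * f x).

Let jf n f : tcontinuous f -> (rho n).-integrable setT (EFin \o f).
Proof. by move=> tf; exact: tcontinuous_integrable. Qed.

Let mind (e : R) : measurable_fun setT (\1_(Ueps e) : TB R d -> R).
Proof. exact: (@measurable_indic _ (TB R d) R setT _ (measurable_Ueps e)). Qed.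

Let jloc n f e : tcontinuous f ->
  (rho n).-integrable setT (EFin \o ((fun x => \1_(Ueps e) x * f x) : TB R d -> R)).
Proof.
move=> tf; have [B hB] := tcontinuous_bounded tf.
apply: integrable_bounded => //.
  by apply: measurable_funM; [exact: mind|exact: tcontinuous_measurable].
exists B => x; rewrite normrM; apply: le_trans (hB x); rewrite ler_piMl //.
by rewrite indicE; case: (_ \in _); rewrite ?normr1 ?normr0.
Qed.

Lemma local_intD f g e n : tcontinuous f -> tcontinuous g ->
  local_int (fun x => f x + g x) e n = local_int f e n + local_int g e n.
Proof.
move=> tf tgauge; rewrite /local_int /tint -RintegralD //; [|exact: jloc|exact: jloc].
by apply: eq_Rintegral => x _; rewrite mulrDr.
Qed.

Lemma local_intZ (a : R) f e n : tcontinuous f -> local_int (fun x => a * f x) e n = a * local_int f e n.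
Proof.
move=> tf; rewrite /local_int /tint -RintegralZl //; last exact: jloc.
by apply: eq_Rintegral => x _; rewrite mulrCA.
Qed.

Lemma local_int_sum I (s : seq I) (f : I -> 'rV[R]_d -> R) e n : (forall i, tcontinuous (f i)) ->
  local_int (fun x => \sum_(i <- s) f i x) e n = \sum_(i <- s) local_int (f i) e n.
Proof.
move=> tf; rewrite /local_int /tint -Rintegral_sum; last by move=> i; exact: jloc.
by apply: eq_Rintegral => x _; rewrite mulr_sumr.
Qed.

Let local_int_twrap f e n : tcontinuous f ->
  local_int f e n = tint (rho n) (fun x => \1_(Ueps e) (twrap x) * f x).
Proof.
move=> tf; rewrite /local_int Rintegral_twrap //; last first.
  by apply: measurable_funM; [exact: mind|exact: tcontinuous_measurable].
by apply: eq_Rintegral => x _; rewrite tf.2.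
Qed.

Let jloct n f e : tcontinuous f ->
  (rho n).-integrable setT (EFin \o ((fun x => \1_(Ueps e) (twrap x) * f x) : TB R d -> R)).
Proof.
move=> tf; have [B hB] := tcontinuous_bounded tf.
apply: integrable_bounded => //.
  apply: measurable_funM; last exact: tcontinuous_measurable.
  exact: (measurable_comp_twrap (mind e)).
exists B => x; rewrite normrM; apply: le_trans (hB x); rewrite ler_piMl //.
by rewrite indicE; case: (_ \in _); rewrite ?normr1 ?normr0.
Qed.

Let tcontinuous_cut f e : tcontinuous f -> tcontinuous (fun x => f x * (1 - chi e x)).
Proof.
move=> tf; apply: tcontinuousM => //; apply: tcontinuousD; first exact: tcontinuous_cst.
by apply: tcontinuousN; exact: tcontinuous_chi.
Qed.

(** Outside the ball of radius e the gauge is at least e^2 / 12, twice the cutoff level e^2 / 24. *)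
Let chi1_far (e : R) (x : 'rV[R]_d) : 0 < e -> twrap x \notin Ueps e -> chi (e ^+ 2 / 24) x = 1.
Proof.
move=> e0 xU; rewrite chi1 // ?divr_gt0 ?exprn_gt0 // -(tgauge_twrap x).
have en : e <= tnorm (twrap x).
  rewrite leNgt; apply: contra xU => h; rewrite mem_set //; split => //; exact: tbox_twrap.
have := tnorm_le_tgauge (tbox_twrap x).
have : e ^+ 2 <= tnorm (twrap x) ^+ 2 by apply: lerXn2r; rewrite ?nnegrE ?tnorm_ge0 // ltW.
lra.
Qed.

(** With [local_int_le], this encloses the sharp ball between continuous cutoffs, to which
    convergence away from 1 applies whatever the mass of the sphere bounding the ball. *)
Lemma local_int_ge f e n : tcontinuous f -> (forall x, 0 <= f x) -> 0 < e ->
  tint (rho n) (fun x => f x * (1 - chi (e ^+ 2 / 24) x)) <= local_int f e n.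
Proof.
move=> tf f0 e0; rewrite local_int_twrap //; apply: le_Rintegral => //.
- by apply: jf; exact: tcontinuous_cut.
- exact: jloct.
move=> x _; rewrite mulrC ler_wpM2r // indicE.
have [xU|xU] := boolP (_ \in _); first by rewrite lerBlDr lerDl chi_ge0.
by rewrite (chi1_far e0 xU) subrr.
Qed.

Lemma local_int_le f e c n : tcontinuous f -> (forall x, 0 <= f x) -> 0 < c -> e ^+ 2 <= 2 * c ->
  local_int f e n <= tint (rho n) (fun x => f x * (1 - chi c x)).
Proof.
move=> tf f0 c0 ec; apply: le_Rintegral => //.
- exact: jloc.
- by apply: jf; exact: tcontinuous_cut.
move=> x _; rewrite [leRHS]mulrC ler_wpM2r // indicE.
have [|xU] := boolP (_ \in _); last by rewrite subr_ge0 chi_le1.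
rewrite inE => -[_ xe]; rewrite chi0 ?subr0 //.
apply: (le_trans (tgauge_le_tnorm x)); have := tnorm_ge0 x; nra.
Qed.

Lemma local_int_le_mono f e e' n : tcontinuous f -> (forall x, 0 <= f x) -> e <= e' ->
  local_int f e n <= local_int f e' n.
Proof.
move=> tf f0 ee; apply: le_Rintegral => //; [exact: jloc|exact: jloc|].
move=> x _; rewrite ler_wpM2r // !indicE.
have [|] := boolP (x \in Ueps e) => // /set_mem[bx xe].
by rewrite mem_set //; split => //; exact: lt_le_trans ee.
Qed.

Definition subsequential_defect (Q : 'rV[int]_d -> R) :=
  forall (phi : nat -> nat) tau (c : 'rV[int]_d -> R), {homo phi : m n / (m < n)%N} ->
    in_Mtilde tau -> vcvg (fun n => rho (phi n)) tau ->
    (forall p, (fun n => energy (rho (phi n)) p) @ \oo --> c p) ->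
    forall p, defect tau c p = Q p.

Lemma bounded_subsequence (M : R) : (\forall n \near \oo, tint (rho n) tgauge <= M) ->
  forall phi : nat -> nat, {homo phi : m n / (m < n)%N} ->
  exists psi : nat -> nat, exists tau, exists c : 'rV[int]_d -> R,
    [/\ {homo psi : m n / (m < n)%N}, in_Mtilde tau, vcvg (fun n => rho (phi (psi n))) tau,
      (forall p, (fun n => energy (rho (phi (psi n))) p) @ \oo --> c p) &
      forall n, tint (rho (phi (psi n))) tgauge <= M].
Proof.
move=> [N _ hN] phi hphi.
have hM n : tint (rho (phi (n + N)%N)) tgauge <= M.
  by apply: hN => /=; apply: leq_trans (homo_ltn_ge hphi _); exact: leq_addl.
have [psi1 h1 [tau tM tc]] := vague_compact (fun n => rho_fin (phi (n + N)%N)) hM.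
have [psi2 h2 [c hc]] := energy_subsequence (fun n => rho_fin (phi (psi1 n + N)%N))
  (fun n => hM (psi1 n)).
exists (fun n => psi1 (psi2 n) + N)%N, tau, c; split => //.
- by move=> m n mn; rewrite ltn_add2r; apply: h1; exact: h2.
- by move=> f ff; exact: (cvg_subsequence h2 (tc f ff)).
Qed.

                                                                                                    
                                                                        
(** Either failure yields a subsequence, and compactness a further one along which the smoothly cut
    energies converge to Q plus a nonnegative tail of tau. A lower failure at a fixed radius
    contradicts the sign of that tail; an upper failure at all radii contradicts its smallness. *)
Lemma local_energy_dlim (M : R) Q : (\forall n \near \oo, tint (rho n) tgauge <= M) ->
  subsequential_defect Q -> forall p, dlim (local_int (fun x => psin p x ^+ 2)) (Q p).
Proof.
move=> bM HQ p; pose q x : R := psin p x ^+ 2.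
have tq : tcontinuous q := tcontinuous_psin_sqr p.
have q0 x : 0 <= q x := sqr_ge0 _.
have lower e eta : 0 < e -> 0 < eta -> \forall n \near \oo, Q p - eta <= local_int q e n.
  move=> e0 eta0; apply: contrapT => H.
  have [|phi hphi hlt] := @extract_subsequence (fun _ n => local_int q e n < Q p - eta).
    move=> m _; apply: contrapT => H'; apply: H; exists m => // n /= mn.
    by rewrite leNgt; apply/negP => hn; apply: H'; exists n.
  have [psi [tau [c [hpsi tM tc ec bn]]]] := bounded_subsequence bM hphi.
  have d0 : 0 < e ^+ 2 / 24 by rewrite divr_gt0 ?exprn_gt0.
  have := local_energy_cvg (fun n => rho_fin (phi (psi n))) bn tM tc ec d0.
  move=> /(_ p); rewrite (HQ (fun n => phi (psi n)) tau c) //; last by move=> m n mn; exact/hphi/hpsi.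
  move=> cv; suff h : Q p + tint tau (fun x => q x * (1 - chi (e ^+ 2 / 24) x)) <= Q p - eta.
    have : 0 <= tint tau (fun x => q x * (1 - chi (e ^+ 2 / 24) x)).
      by apply: Rintegral_ge0 => x _; rewrite mulr_ge0 // subr_ge0 chi_le1.
    lra.
  apply: (cvgr_to_le cv); apply: nearW => n.
  by apply: (le_trans (local_int_ge _ tq q0 e0)); exact/ltW/hlt.
have upper eta : 0 < eta -> exists2 e0 : R, 0 < e0 & \forall n \near \oo, local_int q e0 n <= Q p + eta.
  move=> eta0; apply: contrapT => H.
  (* The radii 1/(m+1) shrink along the subsequence, so they eventually fit inside any fixed
     cutoff. *)
  have [|phi hphi hgt] := @extract_subsequence (fun m n => Q p + eta < local_int q m.+1%:R^-1 n).
    move=> m N; apply: contrapT => H'; apply: H; exists N.+1%:R^-1; first by rewrite invr_gt0.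
    exists m => // n /= mn; rewrite leNgt; apply/negP => hn; apply: H'; exists n => //.
  have [psi [tau [c [hpsi tM tc ec bn]]]] := bounded_subsequence bM hphi.
  have jt := (vague_integral_tgauge (fun n => rho_fin (phi (psi n))) bn tM tc).1.
  have eta2 : 0 < eta / 2 by rewrite divr_gt0.
  have [e0 e00 he] := local_energy_small p jt eta2.
  have := local_energy_cvg (fun n => rho_fin (phi (psi n))) bn tM tc ec e00.
  move=> /(_ p); rewrite (HQ (fun n => phi (psi n)) tau c) //; last by move=> m n mn; exact/hphi/hpsi.
  move=> cv; have he0 : tint tau (fun x => q x * (1 - chi e0 x)) <= eta / 2 := he _ e00 (lexx _).
  suff : Q p + eta <= Q p + tint tau (fun x => q x * (1 - chi e0 x)) by lra.
  apply: (cvgr_to_ge cv).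
    exists (Num.truncn e0^-1) => // n /= hn.
    have e1 : (psi n).+1%:R^-1 <= e0.
      rewrite -[e0]invrK lef_pV2 ?posrE ?invr_gt0 //; apply/ltW/(lt_le_trans (truncnS_gt _)).
      by rewrite ler_nat ltnS (leq_trans hn) // homo_ltn_ge.
    apply: (le_trans (ltW (hgt _))); apply: local_int_le => //.
    have h1 : (psi n).+1%:R^-1 <= 1 :> R by rewrite invf_le1 ?ler1n.
    have h0 : 0 <= (psi n).+1%:R^-1 :> R by rewrite invr_ge0.
    have sq (t : R) : 0 <= t -> t <= 1 -> t <= e0 -> t ^+ 2 <= 2 * e0 by nra.
    exact: sq.
(* The lower bound holds at every radius and the upper one at e0; monotonicity in the radius extends
   the latter to every smaller e. *)
move=> eta eta0; have [e0 e00 he] := upper eta eta0; exists e0 => // e ep ee0.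
move: (lower e eta ep eta0) he; apply: filterS2 => n h1 h2.
have h3 := local_int_le_mono n tq q0 (ltW ee0).
by rewrite ler_norml; apply/andP; split; rewrite -/q; lra.
Qed.

(** Comparing sharp balls with smooth cutoffs, the defect plus a nonnegative tail of tau is at most
    a + eta in one direction, and at least a - eta/2 with a tail of at most eta/2 in the other. *)
Lemma dlim_defect (phi : nat -> nat) tau (c : 'rV[int]_d -> R) (M : R) p (a : R) :
  {homo phi : m n / (m < n)%N} -> (forall n, tint (rho (phi n)) tgauge <= M) ->
  in_Mtilde tau -> vcvg (fun n => rho (phi n)) tau ->
  (forall p, (fun n => energy (rho (phi n)) p) @ \oo --> c p) ->
  dlim (local_int (fun x => psin p x ^+ 2)) a -> defect tau c p = a.
Proof.
move=> hphi bn tM tc ec ha; pose q x : R := psin p x ^+ 2.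
have tq : tcontinuous q := tcontinuous_psin_sqr p.
have q0 x : 0 <= q x := sqr_ge0 _.
have jt := (vague_integral_tgauge (fun n => rho_fin (phi n)) bn tM tc).1.
have tail0 (e : R) : 0 <= tint tau (fun x => q x * (1 - chi e x)).
  by apply: Rintegral_ge0 => x _; rewrite mulr_ge0 // subr_ge0 chi_le1.
have lc e e0 := @local_energy_cvg R d _ _ _ _ (fun n => rho_fin (phi n)) bn tM tc ec p e e0.
have sub (P : nat -> Prop) : (\forall n \near \oo, P n) -> \forall n \near \oo, P (phi n).
  by move=> [N _ hN]; exists N => // n /= Nn; apply: hN; rewrite /= (leq_trans Nn) ?homo_ltn_ge.
apply/eqP; rewrite eq_le; apply/andP; split; apply/ler_addgt0Pr => eta eta0.
  have [e0 e00 he] := ha eta eta0.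
  have e2 : 0 < e0 / 2 by rewrite divr_gt0.
  have e2e : e0 / 2 < e0 by lra.
  have d0 : 0 < (e0 / 2) ^+ 2 / 24 by rewrite divr_gt0 ?exprn_gt0.
  have h : \forall n \near \oo, tint (rho (phi n)) (fun x => q x * (1 - chi ((e0 / 2) ^+ 2 / 24) x)) <= a + eta.
    apply: filterS (sub _ (he _ e2 e2e)) => n; rewrite ler_norml => /andP[_ hn].
    have {}hn : local_int q (e0 / 2) (phi n) - a <= eta := hn.
    by apply: (le_trans (local_int_ge _ tq q0 e2)); lra.
  by apply: le_trans (cvgr_to_le (lc _ d0) h); rewrite lerDl; exact: tail0.
have eta2 : 0 < eta / 2 by rewrite divr_gt0.
have [e0 e00 he] := ha _ eta2; have [e1 e10 he1] := local_energy_small p jt eta2.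
pose e := Num.min (e0 / 2) (Num.min 1 e1).
have ep : 0 < e by rewrite !lt_min divr_gt0 ?ltr01 ?e10.
have ee0 : e < e0.
  by apply: (@le_lt_trans _ _ (e0 / 2)); [rewrite ge_min lexx|lra].
have ee1 : e <= e1 by rewrite !ge_min lexx !orbT.
have e1' : e <= 1 by rewrite !ge_min lexx !orbT.
have h : \forall n \near \oo, a - eta / 2 <= tint (rho (phi n)) (fun x => q x * (1 - chi e1 x)).
  apply: filterS (sub _ (he _ ep ee0)) => n; rewrite ler_norml => /andP[hn _].
  apply: (@le_trans _ _ (local_int q e (phi n))); first by rewrite /q; lra.
  by apply: local_int_le => //; nra.
have h2 : a - eta / 2 <= defect tau c p + tint tau (fun x => q x * (1 - chi e1 x)).
  exact: cvgr_to_ge (lc _ e10) h.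
have h3 : tint tau (fun x => q x * (1 - chi e1 x)) <= eta / 2 := he1 _ e10 (lexx _).
lra.
Qed.

(** Near 1 the gauge is at most the sum of the squared sines, whose local integrals are bounded by
    hypothesis. Away from 1 it is a test function, and an unbounded sequence of integrals would
    contradict the existence of convergent further subsequences. *)
Lemma mass_bound (a : 'I_d -> R) :
  (forall j, dlim (local_int (fun x => psin (zdelta j) x ^+ 2)) (a j)) ->
  (forall phi : nat -> nat, {homo phi : m n / (m < n)%N} ->
    exists2 psi : nat -> nat, {homo psi : m n / (m < n)%N} &
    exists tau, vcvg (fun n => rho (phi (psi n))) tau) ->
  exists M : R, \forall n \near \oo, tint (rho n) tgauge <= M.
Proof.
move=> ha cpt.
have away_bounded f : tcont_away f -> exists B : R, \forall n \near \oo, tint (rho n) f <= B.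
  move=> af; apply: contrapT => H.
  have [|phi hphi hgt] := @extract_subsequence (fun m n => m%:R < tint (rho n) f).
    move=> m N; apply: contrapT => H'; apply: H; exists N%:R; exists m => // n /= mn.
    by rewrite leNgt; apply/negP => hn; apply: H'; exists n.
  have [psi hpsi [tau tc]] := cpt phi hphi.
  have := tc f af => /cvgr_le/(_ (tint tau f + 1)); rewrite ltrDl => /(_ ltr01)[N _ hN].
  pose n := maxn N (Num.truncn (tint tau f + 1)).+1.
  have := hN n (leq_maxl _ _); rewrite leNgt => /negP; apply.
  apply: (lt_trans _ (hgt _)); apply: (lt_le_trans (truncnS_gt _)).
  by rewrite ler_nat (leq_trans _ (homo_ltn_ge hpsi n)) // leq_maxr.
have e0j j : exists e0 : R, 0 < e0 /\ forall e, 0 < e -> e < e0 ->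
    \forall n \near \oo, local_int (fun x => psin (zdelta j) x ^+ 2) e n <= a j + 1.
  have [e0 e00 he] := ha j 1 ltr01; exists e0; split => // e ep ee0.
  by apply: filterS (he e ep ee0) => n; rewrite ler_norml => /andP[_]; lra.
have {e0j} [e0 he0] := choice e0j.
have [e [ep e1 ee]] := finite_positive_bound (fun j => (he0 j).1).
have d0 : 0 < e ^+ 2 / 24 by rewrite divr_gt0 ?exprn_gt0.
have [B hB] := away_bounded _ (tcont_away_chi d0 (tcontinuous_tgauge (R := R) (d := d))).
exists (\sum_j (a j + 1) + B).
have hloc : \forall n \near \oo, forall j, local_int (fun x => psin (zdelta j) x ^+ 2) e n <= a j + 1.
  apply: filter_forall => j; have [_ h] := he0 j; exact: h.
move: hloc hB; apply: filterS2 => n h1 h2.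
pose g j (x : 'rV[R]_d) : R := \1_(Ueps e) (twrap x) * psin (zdelta j) x ^+ 2.
pose h (x : 'rV[R]_d) : R := tgauge x * chi (e ^+ 2 / 24) x.
have jg j : (rho n).-integrable setT (EFin \o (g j : TB R d -> R)).
  by apply: jloct; exact: tcontinuous_psin_sqr.
have jh : (rho n).-integrable setT (EFin \o (h : TB R d -> R)).
  by apply: jf; apply: tcontinuousM; [exact: tcontinuous_tgauge|exact: tcontinuous_chi].
apply: (@le_trans _ _ (\int[rho n]_x (\sum_j g j x + h x))); last first.
  rewrite RintegralD //; last exact: integrable_real_sum.
  rewrite Rintegral_sum //; apply: lerD => //; apply: ler_sum => j _.
  by rewrite (le_trans _ (h1 j)) // local_int_twrap //; exact: tcontinuous_psin_sqr.
apply: le_Rintegral => //.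
- by apply: jf; exact: tcontinuous_tgauge.
- by apply: integrable_realD => //; exact: integrable_real_sum.
move=> x _; rewrite /g /h indicE.
have [xU|xU] := boolP (_ \in _); last first.
  rewrite (chi1_far ep xU) mulr1 lerDr; apply: sumr_ge0 => j _.
  by rewrite mul0r.
apply: (@le_trans _ _ (\sum_j (1%:R * psin (zdelta j) x ^+ 2))); last first.
  by rewrite lerDl mulr_ge0 ?tgauge_ge0 ?chi_ge0.
rewrite -[leLHS]/(tgauge x) -(tgauge_twrap x); apply: ler_sum => j _.
rewrite -psin_twrap psin_zdelta mul1r; move: xU; rewrite inE => -[_].
move: (twrap x) => y ye; apply: onem_cos_le_sin_sqr.
by rewrite (le_trans (coord_le_tnorm y j)) // (le_trans (ltW ye)).
Qed.

End local_energy.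

                          

(** * Uniqueness in the Lévy-Khintchine formula *)

Section levy_khintchine.
Context {R : realType} {d : nat}.
Implicit Types (gam : 'rV[R]_d) (A : 'M[R]_d) (p : 'rV[int]_d)
  (rho tau : {measure set (TB R d) -> \bar R}).

Lemma levy_cfE gam A rho p : levy_cf gam A rho p =
  eix (ipair p gam) * cexp (Complex (- quadform A p / 2) 0 + levy_int rho p).
Proof. by []. Qed.

Lemma in_LP rho tau : in_L rho tau <->
  levy_measure tau /\ forall p, cexp (levy_int rho p) = cexp (levy_int tau p).
Proof.
by split=> -[h1 h2]; split => // p; have := h2 p; rewrite !levy_cf00.
Qed.

(** For a coordinate character the compensator equals the sine, so the imaginary integrand vanishes
    identically. *)
Lemma cexp_levy_int_zdelta rho j : cexp (levy_int rho (zdelta j)) =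
  Complex (expR (tint rho (levy_re (zdelta j)))) 0.
Proof.
rewrite /levy_int (_ : tint rho (fun x => sin _ - _) = 0).
  by rewrite /cexp /= cos0 sin0 mulr1 mulr0.
rewrite /tint -[RHS](Rintegral_zero rho); apply: eq_Rintegral => x _.
by rewrite !ipair_zdelta mxE subrr.
Qed.

Lemma levy_cf_zdelta gam A rho j : levy_cf gam A rho (zdelta j) =
  eix (gam ord0 j) *
  Complex (expR (- quadform A (zdelta j) / 2) * expR (tint rho (levy_re (zdelta j)))) 0.
Proof.
rewrite levy_cfE ipair_zdelta cexpD cexp_levy_int_zdelta; congr (_ * _).
by rewrite /cexp /= cos0 sin0 mulr1 mulr0; simpc.
Qed.

(** Moduli give equality of the real exponents, hence Q1 = Q2 by the growth argument, and the
    Gaussian factor cancels. Imaginary exponents are known only modulo 2 pi, so the conclusion is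
    membership in L(rho). *)
Lemma levy_unique (Q1 Q2 : 'rV[int]_d -> R) rho tau :
  levy_measure rho -> levy_measure tau ->
  (forall p k, Q1 (p *+ k) = k%:R ^+ 2 * Q1 p) -> (forall p k, Q2 (p *+ k) = k%:R ^+ 2 * Q2 p) ->
  (forall p, cexp (Complex (- Q1 p / 2) 0 + levy_int rho p) =
             cexp (Complex (- Q2 p / 2) 0 + levy_int tau p)) ->
  (forall p, Q1 p = Q2 p) /\ in_L rho tau.
Proof.
move=> l1 l2 h1 h2 H.
have E : forall p, Q1 p = Q2 p.
  apply: (quadratic_part_unique (levy_measure_tgauge l1) (levy_measure_tgauge l2)) => // p.
  by have := congr1 (@Normc.normc R) (H p); rewrite !normc_cexp => /expR_inj.
split => //; apply/in_LP; split => // p; have := H p; rewrite E !cexpD.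
by move/(mulfI (cexp_neq0 _)).
Qed.

End levy_khintchine.

(** * Identification of the limits of the array *)

Section array_limits.
Context {R : realType} {d : nat}.
Variables (th : R) (kn : nat -> nat) (nu : nat -> nat -> probability (TB R d) R).
Variable xi : nat -> 'rV[R]_d.
Hypotheses (th01 : 0 < th < 1) (nut : forall n k, on_torus (nu n k)).
Hypothesis nu_inf : infinitesimal kn nu.
Variables (gam : 'rV[R]_d) (A : 'M[R]_d) (rho : {measure set (TB R d) -> \bar R}).
Hypothesis triplet : levy_triplet gam A rho.
Implicit Types (p : 'rV[int]_d) (tau : {measure set (TB R d) -> \bar R}).

Let mu := row_measure th kn nu.
Let mu_fin n : (mu n setT < +oo)%E := row_measure_lty th kn nu n.

Lemma row_measure_torus n : on_torus (mu n).
Proof.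
rewrite /on_torus /= /msum big1 // => k _.
rewrite /centered push_measureE (_ : _ @^-1` _ = set0) ?measure0 //.
by apply/seteqP; split => // x; apply; exact: tbox_twrap.
Qed.

Lemma Mtilde_cvg_vcvg (phi : nat -> nat) tau :
  Mtilde_cvg (fun k => rho_int th kn nu (phi k)) tau <-> vcvg (fun k => mu (phi k)) tau.
Proof.
have E f : tcontinuous f -> (fun k => rho_int th kn nu (phi k) f) = (fun k => tint (mu (phi k)) f).
  by move=> tf; apply/funext => k; rewrite rho_int_tcont.
by split=> h f ff; have := h f ff; rewrite E //; case: ff.
Qed.

Lemma rho_int_local_int j l e n :
  rho_int th kn nu n (fun s => \1_(Ueps e) s * sin (s ord0 j) * sin (s ord0 l)) =
  local_int mu (fun x => sin (x ord0 j) * sin (x ord0 l)) e n.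
Proof.
have tf : tcontinuous (fun x : 'rV[R]_d => sin (x ord0 j) * sin (x ord0 l)).
  by apply: tcontinuousM; exact: tcontinuous_sinj.
have [B hB] := tcontinuous_bounded tf.
rewrite (_ : (fun s => _) = fun s => \1_(Ueps e) s * (sin (s ord0 j) * sin (s ord0 l))); last first.
  by apply/funext => x; rewrite mulrA.
rewrite rho_intE //.
  apply: measurable_funM; last exact: tcontinuous_measurable.
  exact: (@measurable_indic _ (TB R d) R setT _ (measurable_Ueps e)).
exists B => x; rewrite normrM; apply: le_trans (hB x); rewrite ler_piMl //.
by rewrite indicE; case: (_ \in _); rewrite ?normr1 ?normr0.
Qed.

Let tss j l : tcontinuous (fun x : 'rV[R]_d => sin (x ord0 j) * sin (x ord0 l)).
Proof. by apply: tcontinuousM; exact: tcontinuous_sinj. Qed.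

Lemma dlim_polarization : A^T = A ->
  (forall p, dlim (local_int mu (fun x => psin p x ^+ 2)) (quadform A p)) ->
  forall j l, dlim (local_int mu (fun x => sin (x ord0 j) * sin (x ord0 l))) (A j l).
Proof.
move=> At H j l.
have AT : A l j = A j l by rewrite -[in LHS]At mxE.
have tq p := tcontinuous_psin_sqr (R := R) p.
have := dlimZ 2^-1 (dlimD (H (zdelta j + zdelta l)) (dlimD (dlimZ (-1) (H (zdelta j))) (dlimZ (-1) (H (zdelta l))))).
rewrite quadform_zdeltaD !quadform_zdelta AT.
rewrite (_ : _ * _ = A j l); last by field.
have tz (a : R) q : tcontinuous (fun x : 'rV[R]_d => a * psin q x ^+ 2).
  by apply: tcontinuousM => //; exact: tcontinuous_cst.
have tD := tcontinuousD (tz (-1) (zdelta j)) (tz (-1) (zdelta l)).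
apply: dlim_ext => e n.
rewrite -(local_intZ mu_fin _ e n (tq (zdelta j))) -(local_intZ mu_fin _ e n (tq (zdelta l))).
rewrite -(local_intD mu_fin e n (tz _ _) (tz _ _)) -(local_intD mu_fin e n (tq _) tD).
rewrite -(local_intZ mu_fin _ e n (tcontinuousD (tq _) tD)).
congr (local_int mu _ e n); apply/funext => x; by rewrite psinDl !psin_zdelta; field.
Qed.

Lemma dlim_quadform :
  (forall j l, dlim (local_int mu (fun x => sin (x ord0 j) * sin (x ord0 l))) (A j l)) ->
  forall p, dlim (local_int mu (fun x => psin p x ^+ 2)) (quadform A p).
Proof.
move=> H p.
have := dlim_sum (index_enum 'I_d) (fun j => dlim_sum (index_enum 'I_d)
  (fun l => dlimZ ((p ord0 j)%:~R * (p ord0 l)%:~R) (H j l))).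
rewrite (_ : \sum_(j <- _) _ = quadform A p); last first.
  by apply: eq_bigr => j _; apply: eq_bigr => l _; ring.
have tz j l : tcontinuous (fun x : 'rV[R]_d =>
    (p ord0 j)%:~R * (p ord0 l)%:~R * (sin (x ord0 j) * sin (x ord0 l))).
  by apply: tcontinuousM => //; exact: tcontinuous_cst.
apply: dlim_ext => e n; rewrite [in RHS](_ : (fun x => psin p x ^+ 2) = fun x =>
    \sum_j \sum_l (p ord0 j)%:~R * (p ord0 l)%:~R * (sin (x ord0 j) * sin (x ord0 l))); last first.
  by apply/funext => x; exact: psin_sqrE.
rewrite local_int_sum //; last by move=> j; apply: tcontinuous_sum.
apply: eq_bigr => j _; rewrite local_int_sum //; apply: eq_bigr => l _.
by rewrite local_intZ.
Qed.

Lemma array_approx_cvg (M : R) : (\forall n \near \oo, tint (mu n) tgauge <= M) ->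
  forall p, (fun n => Normc.normc (array_cf kn nu xi n p - levy_approx th kn nu xi n p)) @ \oo --> (0 : R).
Proof.
move=> bM p; have [C C0 hC] := array_approx kn xi th01 nut p.
apply/cvgrPdist_le => e e0.
pose eta := Num.min (th ^+ 2 / 48) (e / (C * `|M| + 1)).
have D0 : 0 < C * `|M| + 1 by rewrite ltr_wpDl // mulr_ge0.
have th0 : 0 < th by case/andP: th01.
have eta0 : 0 < eta by rewrite lt_min !divr_gt0 // exprn_gt0.
have eta1 : eta <= th ^+ 2 / 48 by rewrite ge_min lexx.
have eta2 : eta * (C * `|M| + 1) <= e.
  by rewrite -ler_pdivlMr // ge_min lexx orbT.
move: (infinitesimal_small th01 nut nu_inf eta0) bM; apply: filterS2 => n sm hM.
rewrite sub0r normrN ger0_norm ?normc_ge0 //; apply: (le_trans (hC n eta eta1 sm)).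
have g0 : 0 <= tint (mu n) tgauge by apply: Rintegral_ge0 => x _; exact: tgauge_ge0.
have hM' : tint (mu n) tgauge <= `|M| by apply: (le_trans hM); exact: ler_norm.
have : C * eta * tint (mu n) tgauge <= C * eta * `|M|.
  by apply: ler_wpM2l => //; rewrite mulr_ge0 // ltW.
rewrite -/mu; lra.
Qed.

(** A Lévy-Khintchine characteristic function never vanishes, so its squared moduli at the finitely
    many coordinate characters admit a positive lower bound c, inherited by the array for large
    n. *)
Lemma array_mass_bound : (forall p, ccvg (fun n => array_cf kn nu xi n p) (levy_cf gam A rho p)) ->
  exists M : R, \forall n \near \oo, tint (mu n) tgauge <= M.
Proof.
move=> H; pose z j := Normc.normc (levy_cf gam A rho (zdelta j)) ^+ 2.
have z0 j : 0 < z j / 2.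
  rewrite divr_gt0 // exprn_gt0 // /levy_cf Normc.normcM -[X in X * _]/(Normc.normc (eix _)).
  by rewrite normc_eix mul1r normc_cexp expR_gt0.
have [c [c0 _ hc]] := finite_positive_bound z0.
have th0 : 0 < th by case/andP: th01.
pose D : R := d%:R * (12 + 96 / th ^+ 2) ^+ 2.
have D0 : 0 <= D by rewrite mulr_ge0 // sqr_ge0.
pose eta := Num.min (th ^+ 2 / 48) (Num.min 1 (2 * (D + 1))^-1).
have eta0 : 0 < eta.
  by rewrite !lt_min divr_gt0 ?exprn_gt0 //= ltr01 invr_gt0 mulr_gt0 // ltr_wpDl.
have eta1 : eta <= th ^+ 2 / 48 by rewrite ge_min lexx.
have eta2 : eta <= 1 by rewrite !ge_min lexx orbT.
have eta3 : D * eta <= 1 / 2.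
  have : eta <= (2 * (D + 1))^-1 by rewrite !ge_min lexx !orbT.
  by rewrite -div1r ler_pdivlMr ?mulr_gt0 ?ltr_wpDl //; nra.
exists (2 * d%:R * - ln c).
have cj : \forall n \near \oo, forall j, c <= Normc.normc (array_cf kn nu xi n (zdelta j)) ^+ 2.
  apply: filter_forall => j.
  have hn : (fun n => Normc.normc (array_cf kn nu xi n (zdelta j)) ^+ 2) @ \oo --> z j.
    by rewrite /z expr2; under eq_fun do rewrite expr2; apply: cvgM; exact: ccvg_normc.
  have cz : c < z j by have := hc j; have := z0 j; lra.
  exact: cvgr_ge hn _ cz.
move: cj (infinitesimal_small th01 nut nu_inf eta0); apply: filterS2 => n cn sm.
exact: (array_mass th01 nut eta1 eta2 eta3 sm c0 cn).
Qed.

(** Any subsequence has a further one converging to some tau in L(rho) with defect <Ap, p>. The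
    limit of the expressions is then the prescribed one, independently of the subsequence. *)
Lemma levy_approx_cvg (M : R) : (\forall n \near \oo, tint (mu n) tgauge <= M) ->
  tcvg (gam_n th kn nu xi) gam ->
  (forall p, dlim (local_int mu (fun x => psin p x ^+ 2)) (quadform A p)) ->
  (forall (phi : nat -> nat) tau, {homo phi : m n / (m < n)%N} -> in_Mtilde tau ->
    vcvg (fun n => mu (phi n)) tau -> in_L rho tau) ->
  forall p, ccvg (fun n => levy_approx th kn nu xi n p) (levy_cf gam A rho p).
Proof.
move=> bM hg hQ hL p; apply: ccvg_by_subsequences => phi hphi.
have [psi [tau [c [hpsi tM tc ec bn]]]] := bounded_subsequence mu_fin bM hphi.
exists psi => //; have hh : {homo (fun n => phi (psi n)) : m n / (m < n)%N}.
  by move=> m n mn; exact/hphi/hpsi.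
have /in_LP[_ hcf] := hL _ _ hh tM tc.
have E q := dlim_defect mu_fin row_measure_torus hh bn tM tc ec (hQ q).
rewrite levy_cfE cexpD hcf -cexpD -(E p); apply: ccvgM.
  apply: (@ccvg_subsequence _ (fun n => eix (ipair p (gam_n th kn nu xi n))) _ _ hh).
  exact: tcvg_eix.
apply: ccvg_cexp; exact: (levy_int_cvg (fun n => mu_fin (phi (psi n))) bn tM tc ec).
Qed.

Section forward.
Hypothesis cf_cvg : forall p, ccvg (fun n => array_cf kn nu xi n p) (levy_cf gam A rho p).
Variable M : R.
Hypothesis bM : \forall n \near \oo, tint (mu n) tgauge <= M.

Let approx_cvg p : ccvg (fun n => levy_approx th kn nu xi n p) (levy_cf gam A rho p) :=
  ccvg_near (cf_cvg p) (array_approx_cvg bM p).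

(** At coordinate characters [levy_approx] is the direction of gamma_n times a positive real, so the
    polar decomposition of the limit applies. *)
Lemma gam_n_tcvg : tcvg (gam_n th kn nu xi) gam.
Proof.
move=> j; have := approx_cvg (zdelta j); rewrite levy_cf_zdelta /levy_approx.
under eq_fun do rewrite ipair_zdelta cexp_levy_int_zdelta.
move=> h; have [h1 h2] := ccvg_eix_polar (fun n => expR_gt0 _) (mulr_gt0 (expR_gt0 _) (expR_gt0 _)) h.
by split; [move: h1|move: h2]; under eq_fun do rewrite eixE; rewrite eixE.
Qed.

(** Two expressions for the same limit along the subsequence: the assumed one, and the one computed
    from tau and its defect. The common factor of gamma cancels and [levy_unique] applies. *)
Lemma subsequential_limit (phi : nat -> nat) tau (c : 'rV[int]_d -> R) :
  {homo phi : m n / (m < n)%N} -> in_Mtilde tau -> vcvg (fun n => mu (phi n)) tau ->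
  (forall p, (fun n => energy (mu (phi n)) p) @ \oo --> c p) ->
  (forall p, quadform A p = defect tau c p) /\ in_L rho tau.
Proof.
move=> hphi tM tc ec; have [N _ hN] := bM.
(* Shifting by N makes the eventual mass bound hold for every term. *)
have hs : {homo (fun n => n + N)%N : m n / (m < n)%N} by move=> m n; rewrite ltn_add2r.
have hphiN : {homo (fun n => phi (n + N)%N) : m n / (m < n)%N}.
  by move=> m n mn; exact/hphi/hs.
have bn n : tint (mu (phi (n + N)%N)) tgauge <= M.
  by apply: hN => /=; apply: leq_trans (homo_ltn_ge hphi _); exact: leq_addl.
have tc' : vcvg (fun n => mu (phi (n + N)%N)) tau.
  by move=> f ff; exact: (cvg_subsequence hs (tc f ff)).
have ec' p : (fun n => energy (mu (phi (n + N)%N)) p) @ \oo --> c p.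
  by have h := ec p; exact: (cvg_subsequence hs h).
have jt := (vague_integral_tgauge (fun n => mu_fin _) bn tM tc').1.
have [_ _ lrho] := triplet.
apply: levy_unique => //.
- exact: in_Mtilde_levy.
- by move=> p k; exact: quadform_muln.
- by move=> p k; exact: (defect_muln (fun n => mu_fin (phi (n + N)%N)) bn tM tc' ec').
move=> p; have h1 := ccvg_subsequence hphiN (approx_cvg p).
have h2 : ccvg (fun n => levy_approx th kn nu xi (phi (n + N)%N) p)
    (eix (ipair p gam) * cexp (Complex (- defect tau c p / 2) 0 + levy_int tau p)).
  apply: ccvgM.
    apply: (@ccvg_subsequence _ (fun n => eix (ipair p (gam_n th kn nu xi n))) _ _ hphiN).
    exact: (tcvg_eix gam_n_tcvg).
  apply: ccvg_cexp; exact: (levy_int_cvg (fun n => mu_fin (phi (n + N)%N)) bn tM tc' ec').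
by have := ccvg_unique h1 h2; rewrite levy_cfE => /(mulfI (cexp_neq0 _)).
Qed.

Lemma limit_points_in_L (phi : nat -> nat) tau : {homo phi : m n / (m < n)%N} ->
  in_Mtilde tau -> vcvg (fun n => mu (phi n)) tau -> in_L rho tau.
Proof.
move=> hphi tM tc; have [N _ hN] := bM.
have bn n : tint (mu (phi (n + N)%N)) tgauge <= M.
  by apply: hN => /=; apply: leq_trans (homo_ltn_ge hphi _); exact: leq_addl.
have [psi hpsi [c hc]] := energy_subsequence (fun n => mu_fin (phi (n + N)%N)) bn.
have hs : {homo (fun n => psi n + N)%N : m n / (m < n)%N}.
  by move=> m n mn; rewrite ltn_add2r; exact: hpsi.
apply: (@subsequential_limit (fun n => phi (psi n + N)%N) tau c _ tM _ hc).2.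
  by move=> m n mn; exact/hphi/hs.
by move=> f ff; exact: (cvg_subsequence hs (tc f ff)).
Qed.

Lemma forward_dlim p : dlim (local_int mu (fun x => psin p x ^+ 2)) (quadform A p).
Proof.
apply: (local_energy_dlim mu_fin row_measure_torus bM) => phi tau c hphi tM tc ec q.
by apply/esym; exact: (subsequential_limit hphi tM tc ec).1.
Qed.

End forward.

End array_limits.

(** * Assembly of the two implications *)

Theorem theorem6p6 (R : realType) (d : nat) (th : R)
  (gam : 'rV[R]_d) (A : 'M[R]_d) (rho : {measure set (TB R d) -> \bar R})
  (nuL : probability (TB R d) R)
  (kn : nat -> nat) (nu : nat -> nat -> probability (TB R d) R)
  (xi : nat -> 'rV[R]_d) :
  0 < th < 1 ->
  levy_triplet gam A rho ->
  is_levy_law gam A rho nuL ->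
  (0 < kn 0)%N ->
  (forall n k, on_torus (nu n k)) ->
  infinitesimal kn nu ->
  (forall f, tcontinuous f ->
     (fun n => iconv (arow kn nu n) f (xi n)) @ \oo --> tint nuL f)
  <->
  [/\ tcvg (gam_n th kn nu xi) gam,
      (forall j l : 'I_d,
        (fun eps => limn_esup (fun n =>
           (rho_int th kn nu n (fun s => \1_(Ueps eps) s * sin (s ord0 j) * sin (s ord0 l)))%:E))
          @ 0^'+ --> (A j l)%:E /\
        (fun eps => limn_einf (fun n =>
           (rho_int th kn nu n (fun s => \1_(Ueps eps) s * sin (s ord0 j) * sin (s ord0 l)))%:E))
          @ 0^'+ --> (A j l)%:E) &
      ((forall phi : nat -> nat, {homo phi : m n / (m < n)%N} ->
          exists2 psi : nat -> nat, {homo psi : m n / (m < n)%N} &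
            exists2 tau : {measure set (TB R d) -> \bar R}, in_Mtilde tau &
              Mtilde_cvg (fun k => rho_int th kn nu (phi (psi k))) tau) /\
       (forall (phi : nat -> nat) (tau : {measure set (TB R d) -> \bar R}),
          {homo phi : m n / (m < n)%N} -> in_Mtilde tau ->
          Mtilde_cvg (fun k => rho_int th kn nu (phi k)) tau -> in_L rho tau))].
Proof.
move=> th01 triplet [_ nuL_cf] _ nut nu_inf.
pose mu := row_measure th kn nu; have mu_fin n : (mu n setT < +oo)%E := row_measure_lty th kn nu n.
have locE j l : dlim (fun e n => rho_int th kn nu n
      (fun s => \1_(Ueps e) s * sin (s ord0 j) * sin (s ord0 l))) (A j l) <->
    dlim (local_int mu (fun x => sin (x ord0 j) * sin (x ord0 l))) (A j l).
  by split; apply: dlim_ext => e n; rewrite rho_int_local_int.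
split.
  move=> H.
  have cf_cvg p : ccvg (fun n => array_cf kn nu xi n p) (levy_cf gam A rho p).
    rewrite -nuL_cf; under eq_fun do rewrite -iconv_arow.
    by split; apply: H; [exact: tcontinuous_cos|exact: tcontinuous_sin].
  have [M bM] := array_mass_bound th01 nut nu_inf cf_cvg.
  split.
  - exact: (gam_n_tcvg th01 nut nu_inf cf_cvg bM).
  - move=> j l; apply/dlimP/locE; have [At _ _] := triplet.
    by apply: dlim_polarization At _ j l => p; exact: (forward_dlim th01 nut nu_inf triplet cf_cvg bM).
  split.
    move=> phi hphi.
    have [psi [tau [c [hpsi tM tc _ _]]]] := bounded_subsequence mu_fin bM hphi.
    by exists psi => //; exists tau => //; exact/Mtilde_cvg_vcvg.
  move=> phi tau hphi tM /Mtilde_cvg_vcvg tc.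
  exact: (limit_points_in_L th01 nut nu_inf triplet cf_cvg bM hphi tM tc).
(* Conversely, (2) gives the double limits of the energies for all p and, with compactness, the mass
   bound; the accompanying laws then converge, and with them the Fourier coefficients. *)
move=> [hg hA [hcpt hL]].
have hQ p : dlim (local_int mu (fun x => psin p x ^+ 2)) (quadform A p).
  by apply: dlim_quadform => j l; exact/locE/dlimP.
have [|M bM] := mass_bound mu_fin (row_measure_torus th kn nu) (fun j => hQ (zdelta j)).
  move=> phi /hcpt[psi hpsi [tau _ /Mtilde_cvg_vcvg tc]].
  by exists psi => //; exists tau.
have acvg := levy_approx_cvg bM hg hQ.
have cf_cvg p : ccvg (fun n => array_cf kn nu xi n p) (charfun nuL p).
  rewrite nuL_cf; apply: (@ccvg_near _ (fun n => levy_approx th kn nu xi n p)).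
    by apply: acvg => phi tau hphi tM tc; apply: (hL phi tau hphi tM); exact/Mtilde_cvg_vcvg.
  under eq_fun do rewrite -normcN opprB; exact: array_approx_cvg bM p.
move=> f tf.
apply: (tmean_cvg (fun n => tmean_iconv (arow kn nu n) (xi n)) (tmean_tint nuL)) => //.
  move=> p; have [h _] := cf_cvg p; move: h.
  by under eq_fun do rewrite -iconv_arow.
move=> p; have [_ h] := cf_cvg p; move: h.
by under eq_fun do rewrite -iconv_arow.
Qed.
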